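(* Let $\mathbb P\neq\mathbb Q$ be Gaussian probability measures on $\mathbb R^d$, $\mathbb P = N(\mu,\Sigma)$, $\mathbb Q= N(\nu,\Xi)$, with $\mu,\nu\in\mathbb R^d$ and covariance matrices $\Sigma,\Xi$ of full rank. Let $X_1,\dots,X_n$ be i.i.d. with law $N(\mu,\Sigma)$, and let $\widehat{\mathcal{GW}}_n=\mathcal W_2^2\big(N(\hat\mu_n,\hat\Sigma_n),N(\nu,\Xi)\big)$ and $\mathcal{GW}=\mathcal W_2^2(\mathbb P,\mathbb Q)$. Then, as $n\to\infty$, $$\sqrt n\,\big(\widehat{\mathcal{GW}}_n-\mathcal{GW}\big)\Rightarrow N(0,\upsilon^2),$$ where $$\upsilon^2 = 4(\nu-\mu)^t\Sigma(\nu-\mu)+2\,\mathrm{tr}(\Sigma^2)+2\,\mathrm{tr}(\Sigma\Xi)-4\sum_{k=1}^d\kappa_k^{1/2}\,r_k^t\,\Xi^{-1/2}\Sigma\,\Xi^{1/2}r_k .$$ Here $\{(\kappa_k,r_k):k=1,\dots,d\}$ is the eigendecomposition of the symmetric matrix $\Xi^{1/2}\Sigma\Xi^{1/2}$ into orthonormal eigenpairs (eigenvalues $\kappa_k$, eigenvectors $r_k$).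
   Context: $\mathcal W_2$ is the 2-Wasserstein distance on $\mathbb R^d$: $\mathcal W_2^2(\mathbb P,\mathbb Q)=\inf_{\pi}\int\|x-y\|^2\,\pi(dx,dy)$, the infimum over all couplings $\pi$ of $\mathbb P$ and $\mathbb Q$, with $\|\cdot\|$ the Euclidean norm. For Gaussians it is known that $\mathcal W_2^2(N(\mu,\Sigma),N(\nu,\Xi))=\|\mu-\nu\|^2+\mathrm{tr}(\Sigma)+\mathrm{tr}(\Xi)-2\,\mathrm{tr}\big[(\Sigma^{1/2}\Xi\Sigma^{1/2})^{1/2}\big]$. Square roots of symmetric nonnegative definite matrices are the spectral (nonnegative definite) ones. The empirical mean and covariance are $\hat\mu_n=\frac1n\sum_{i=1}^nX_i$ and $\hat\Sigma_n=\frac1{n-1}\sum_{i=1}^n(X_i-\hat\mu_n)(X_i-\hat\mu_n)^t$. The symbol $\Rightarrow$ denotes weak convergence (convergence in law); ${}^t$ denotes transpose. *)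

(* Defs.v *)
From HB Require Import structures.
From mathcomp Require Import all_boot all_order all_algebra.
From mathcomp Require Import all_classical all_reals all_analysis.
From mathcomp Require Import measurable_realfun giry.

Set Implicit Arguments.
Unset Strict Implicit.
Unset Printing Implicit Defensive.

Import Order.TTheory GRing.Theory Num.Theory.
Import numFieldNormedType.Exports.

Local Open Scope classical_set_scope.
Local Open Scope ring_scope.

(* Matrices over R (in particular R^d = 'cV[R]_d) carry the sigma-algebra
   generated by the entries, i.e. the product (= Borel) sigma-algebra. *)

Definition measure_matrix_display : measure_display -> measure_display.
Proof. exact. Qed.

Section measurable_matrix.
Context (R : realType) (m n : nat).

Definition matrix_measurable : set (set 'M[R]_(m, n)) :=
  <<s \bigcup_(ij in [set: 'I_m * 'I_n])
        preimage_set_system setT (fun M : 'M[R]_(m, n) => M ij.1 ij.2)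
          measurable >>.

Let matrix_set0 : matrix_measurable set0.
Proof. exact: sigma_algebra0. Qed.

Let matrix_setC A : matrix_measurable A -> matrix_measurable (~` A).
Proof. exact: sigma_algebraC. Qed.

Let matrix_bigcup (F : _^nat) : (forall i, matrix_measurable (F i)) ->
  matrix_measurable (\bigcup_i (F i)).
Proof. exact: sigma_algebra_bigcup. Qed.

HB.instance Definition _ := @isMeasurable.Build
  (measure_matrix_display default_measure_display)
  'M[R]_(m, n) matrix_measurable matrix_set0 matrix_setC matrix_bigcup.

Lemma measurable_entry (i : 'I_m) (j : 'I_n) :
  measurable_fun setT (fun M : 'M[R]_(m, n) => M i j).
Proof.
move=> _ Y mY; rewrite setTI; apply: sub_sigma_algebra => /=.
by exists (i, j) => //; exists Y => //; rewrite setTI.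
Qed.

Lemma measurable_fun_matrix d (T : measurableType d) (f : T -> 'M[R]_(m, n)) :
  (forall i j, measurable_fun setT (fun t => f t i j)) ->
  measurable_fun setT f.
Proof.
move=> mf.
apply: (@measurability _ _ _ _ _ f (\bigcup_(ij in [set: 'I_m * 'I_n])
        preimage_set_system setT (fun M : 'M[R]_(m, n) => M ij.1 ij.2)
          measurable)) => //.
move=> _ [_ [[i j] _ [B mB <-]] <-].
by have := mf i j measurableT B mB; rewrite !setTI.
Qed.

End measurable_matrix.

(* Note that the norm `|_| of the library on matrices is the sup norm. *)
Definition sqnorm {R : realType} {d : nat} (x : 'cV[R]_d) : R :=
  \sum_(i < d) x i 0 ^+ 2.

Definition bform {R : realType} {d : nat}
  (x : 'cV[R]_d) (A : 'M[R]_d) (y : 'cV[R]_d) : R := (x^T *m A *m y) 0 0.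

(* symmetric nonnegative definite matrices *)
Definition covariance_matrix {R : realType} {d : nat} (A : 'M[R]_d) : Prop :=
  A^T = A /\ forall x : 'cV[R]_d, 0 <= bform x A x.

Definition spectral_sqrt {R : realType} {d : nat} (A B : 'M[R]_d) : Prop :=
  exists (U : 'M[R]_d) (l : 'rV[R]_d),
    [/\ U *m U^T = 1%:M,
        forall i, 0 <= l 0 i,
        A = U *m diag_mx l *m U^T &
        B = U *m diag_mx (map_mx Num.sqrt l) *m U^T].

(* A^(1/2); 0 by convention unless A is symmetric nonnegative definite. *)
Definition sqrtm {R : realType} {d : nat} (A : 'M[R]_d) : 'M[R]_d :=
  xget 0 [set B | spectral_sqrt A B].

Definition orthonormal_eigenpairs {R : realType} {d : nat} (A : 'M[R]_d)
    (kappa : 'I_d -> R) (r : 'I_d -> 'cV[R]_d) : Prop :=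
  (forall k, A *m r k = kappa k *: r k) /\
  (forall j k, ((r j)^T *m r k) 0 0 = (j == k)%:R).

Section gaussian.
Context {R : realType}.

Definition consv d (z : measurableTypeR R * 'cV[R]_d) : 'cV[R]_d.+1 :=
  col_mx (z.1%:M : 'M[R]_1) z.2.

Let measurable_consv d : measurable_fun setT (@consv d).
Proof.
apply: measurable_fun_matrix => i j; case: (@split_ordP 1 d i) => k ->.
- rewrite (_ : (fun z => _) = fst); first exact: measurable_fst.
  by apply/funext => z; rewrite /consv (@col_mxEu _ 1) !ord1 mxE eqxx mulr1n.
- rewrite (_ : (fun z => _) = (fun v : 'cV[R]_d => v k j) \o snd).
    exact: measurableT_comp (measurable_entry k j) measurable_snd.
  by apply/funext => z; rewrite /consv (@col_mxEd _ 1).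
Qed.

HB.instance Definition _ d := @isMeasurableFun.Build _ _ _ _
  (@consv d) (@measurable_consv d).

(* the standard Gaussian N(0, I_d): the d-fold product of N(0, 1) *)
Fixpoint std_gaussian (d : nat) : probability 'cV[R]_d R :=
  match d with
  | 0 => \d_(0 : 'cV[R]_0)
  | d'.+1 => distribution (normal_prob 0 1 \x std_gaussian d')%E (@consv d')
  end.

Definition affine d (m : 'cV[R]_d) (A : 'M[R]_d) (z : 'cV[R]_d) : 'cV[R]_d :=
  m + A *m z.

Let measurable_affine d m A : measurable_fun setT (@affine d m A).
Proof.
apply: measurable_fun_matrix => i j; rewrite /affine.
under eq_fun do rewrite !mxE.
apply: measurable_funD => //=; apply: measurable_sum => k.
by apply: measurable_funM => //; exact: measurable_entry.
Qed.

HB.instance Definition _ d m A := @isMeasurableFun.Build _ _ _ _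
  (@affine d m A) (@measurable_affine d m A).

(* N(m, S), the law of m + S^(1/2) Z for Z standard Gaussian; S may be
   singular, as the empirical covariance matrix is for small samples. *)
Definition gaussian d (m : 'cV[R]_d) (S : 'M[R]_d) : probability 'cV[R]_d R :=
  distribution (std_gaussian d) (affine m (sqrtm S)).

End gaussian.

Section wasserstein.
Context {R : realType} {d : nat}.
Implicit Types P Q : probability 'cV[R]_d R.

Definition coupling P Q : set (probability ('cV[R]_d * 'cV[R]_d)%type R) :=
  [set pi | forall A, measurable A ->
    pi (A `*` setT) = P A /\ pi (setT `*` A) = Q A].

(* W_2 ^ 2 *)
Definition wasserstein2sq P Q : \bar R :=
  ereal_inf [set (\int[pi]_z (sqnorm (z.1 - z.2))%:E)%E | pi in coupling P Q].

End wasserstein.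

Section sampling.
Context {d0 : measure_display} {T : measurableType d0} {R : realType}.
Variable P : probability T R.

Definition mutually_independent {d1} {T' : measurableType d1}
    (X : nat -> T -> T') : Prop :=
  forall (J : seq nat) (A : nat -> set T'),
    uniq J -> (forall i, measurable (A i)) ->
    P (\bigcap_(i in [set` J]) (X i @^-1` A i)) =
    (\prod_(i <- J) P (X i @^-1` A i))%E.

Definition iid {d1} {T' : measurableType d1}
    (X : nat -> {RV P >-> T'}) (L : probability T' R) : Prop :=
  mutually_independent (fun i => X i : T -> T') /\
  forall i, measure_eq (distribution P (X i)) L.

Definition cvg_in_law (Y : nat -> T -> R) (L : probability (measurableTypeR R) R) : Prop :=
  (forall n, measurable_fun setT (Y n)) /\
  forall f : R -> R, continuous f -> (exists M, forall x, `|f x| <= M) ->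
    (fun n => \int[P]_t (f (Y n t))%:E)%E @ \oo --> (\int[L]_x (f x)%:E)%E.

(* The sample of size n is X 0, ..., X n.-1. *)
Definition emp_mean {d} (X : nat -> T -> 'cV[R]_d) (n : nat) (t : T)
  : 'cV[R]_d := n%:R^-1 *: \sum_(i < n) X i t.

Definition emp_cov {d} (X : nat -> T -> 'cV[R]_d) (n : nat) (t : T)
  : 'M[R]_d := (n%:R - 1)^-1 *:
    \sum_(i < n) (X i t - emp_mean X n t) *m (X i t - emp_mean X n t)^T.

End sampling.

(* Main.v *)
(* For Gaussians the squared distance is the explicit function
   g(m, S) = |m - nu|^2 + tr S + tr Xi - 2 tr (Xi^(1/2) S Xi^(1/2))^(1/2), so the
   statement is a delta method for g at (mu, Sigma). The derivative of g there is
   (e, H) |-> 2 (mu - nu)^t e + tr (G H) with G = 1 - T, where T is the matrix of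
   the optimal transport map, and T Sigma T = Xi. Hence, up to an error which is
   quadratic in the deviations of the empirical moments and has expectation
   O(1 / n), g(emp. moments) - g(mu, Sigma) is the empirical mean of
   q(X_i) = c^t (X_i - mu) + (X_i - mu)^t G (X_i - mu) - tr (G Sigma),
   c = 2 (mu - nu). These variables are centered, with variance
   c^t Sigma c + 2 tr (G Sigma G Sigma), which is the announced variance by
   T Sigma T = Xi, and vanishes only if c = 0 and G = 0, that is, if the two
   measures coincide. The central limit theorem for q(X_i) is proved by
   Lindeberg's method. *)
Require Import Defs.
From HB Require Import structures.
From mathcomp Require Import all_boot all_order all_algebra.
From mathcomp Require Import all_classical all_reals all_analysis.
From mathcomp Require Import measurable_realfun giry.
From mathcomp Require complex.
From mathcomp Require Import ring lra.

Set Implicit Arguments.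
Unset Strict Implicit.
Unset Printing Implicit Defensive.

Import Order.TTheory GRing.Theory Num.Theory.
Import numFieldNormedType.Exports.

Local Open Scope classical_set_scope.
Local Open Scope ring_scope.

(** * Expectations of real functions *)

(** The expansion is a global inequality: its remainder is bounded for every nonnegative definite S,
    since perturbing a square root is controlled by the coercivity of the unperturbed one alone. No
    event on which the empirical covariance is close to Sigma has to be split off, and an L^1 bound
    of order 1/n on the remainder, tested against Lipschitz functions, takes the place of Slutsky's
    lemma. The computations with Gaussian vectors rest on one invariance: the law of m + A Z depends
    only on A A^t. It is reduced to sign changes and plane rotations, and these to reflections and
    shears, hence to invariances of Lebesgue measure on the line. Lindeberg's method asks for a
    third order Taylor bound on the test function. It is obtained by a Gaussian smoothing at a small
    fixed scale, which moves a Lipschitz function uniformly little. *)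

Definition mfun_of d d' (T : measurableType d) (T' : measurableType d') (f : T -> T')
  (mf : measurable_fun [set: T] f) : {mfun T >-> T'} :=
  HB.pack f (isMeasurableFun.Build _ _ _ _ f mf).

Section real_expectation.
Context {d} {T : measurableType d} {R : realType} (P : probability T R).
Implicit Types f g : T -> R.

Definition intg f := P.-integrable [set: T] (EFin \o f).

Lemma intg_meas f : intg f -> measurable_fun [set: T] f.
Proof. by move=> /measurable_int/measurable_EFinP. Qed.

Lemma intg_cst c : intg (fun=> c).
Proof. exact: finite_measure_integrable_cst. Qed.

Lemma intgD f g : intg f -> intg g -> intg (fun x => f x + g x).
Proof. by move=> fi gi; have := integrableD measurableT fi gi. Qed.

Lemma intgB f g : intg f -> intg g -> intg (fun x => f x - g x).
Proof. by move=> fi gi; have := integrableB measurableT fi gi. Qed.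

Lemma intgZ c f : intg f -> intg (fun x => c * f x).
Proof. by move=> fi; have := integrableZl measurableT c fi. Qed.

Lemma intg_sum (I : Type) (s : seq I) (F : I -> T -> R) :
  (forall i, intg (F i)) -> intg (fun x => \sum_(i <- s) F i x).
Proof.
move=> Fi; elim: s => [|i s IH].
  by under eq_fun do rewrite big_nil; exact: intg_cst.
by under eq_fun do rewrite big_cons; exact: intgD.
Qed.

Lemma intg_le f g : measurable_fun [set: T] f -> (forall x, `|f x| <= g x) ->
  intg g -> intg f.
Proof.
move=> mf fg; apply: le_integrable => //; first exact/measurable_EFinP.
by move=> x _ /=; rewrite lee_fin; apply: (le_trans (fg x)); exact: ler_norm.
Qed.

Lemma intg_bounded f C : measurable_fun [set: T] f -> (forall x, `|f x| <= C) -> intg f.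
Proof. by move=> mf fC; apply: (intg_le mf fC); exact: intg_cst. Qed.

Lemma intg_norm f : intg f -> intg (fun x => `|f x|).
Proof. by move=> fi; have := integrable_abse fi. Qed.

Lemma mean_cst c : \int[P]_x c = c.
Proof. by rewrite Rintegral_cst//= probability_setT mulr1. Qed.

Lemma meanD f g : intg f -> intg g -> \int[P]_x (f x + g x) = \int[P]_x f x + \int[P]_x g x.
Proof. by move=> fi gi; rewrite RintegralD. Qed.

Lemma meanB f g : intg f -> intg g -> \int[P]_x (f x - g x) = \int[P]_x f x - \int[P]_x g x.
Proof. by move=> fi gi; rewrite RintegralB. Qed.

Lemma meanZ c f : intg f -> \int[P]_x (c * f x) = c * \int[P]_x f x.
Proof. by move=> fi; rewrite RintegralZl. Qed.

Lemma mean_sum (I : Type) (s : seq I) (F : I -> T -> R) : (forall i, intg (F i)) ->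
  \int[P]_x (\sum_(i <- s) F i x) = \sum_(i <- s) \int[P]_x F i x.
Proof.
move=> Fi; elim: s => [|i s IH].
  by under eq_Rintegral do rewrite big_nil; rewrite mean_cst big_nil.
under eq_Rintegral do rewrite big_cons.
by rewrite meanD//; [rewrite IH big_cons|exact: intg_sum].
Qed.

Lemma le_mean f g : intg f -> intg g -> (forall x, f x <= g x) ->
  \int[P]_x f x <= \int[P]_x g x.
Proof. by move=> fi gi fg; apply: le_Rintegral. Qed.

Lemma mean_ge0 f : (forall x, 0 <= f x) -> 0 <= \int[P]_x f x.
Proof. by move=> f0; apply: Rintegral_ge0. Qed.

Lemma ler_norm_mean f : intg f -> `|\int[P]_x f x| <= \int[P]_x `|f x|.
Proof. by move=> fi; apply: le_normr_Rintegral. Qed.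

Lemma norm_mean_le f g : intg f -> intg g -> (forall x, `|f x| <= g x) ->
  `|\int[P]_x f x| <= \int[P]_x g x.
Proof.
by move=> fi gi fg; apply: (le_trans (ler_norm_mean fi)); apply: le_mean => //; exact: intg_norm.
Qed.

Lemma EFin_mean f : intg f -> (\int[P]_x (f x)%:E = (\int[P]_x f x)%:E)%E.
Proof. by move=> fi; rewrite /Rintegral fineK//; exact: integrable_fin_num fi. Qed.

Lemma ge0_intg f : measurable_fun [set: T] f -> (forall x, 0 <= f x) ->
  (\int[P]_x (f x)%:E < +oo)%E -> intg f.
Proof.
move=> mf f0 fi; apply/integrableP; split; first exact/measurable_EFinP.
by under eq_integral do rewrite /= ger0_norm//.
Qed.

Lemma intg_comp d' (T' : measurableType d') (X : {mfun T >-> T'}) (f : T' -> R) :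
  measurable_fun [set: T'] f -> intg (f \o X) ->
  (distribution P X).-integrable [set: T'] (EFin \o f).
Proof.
by move=> mf fi; apply: integrable_pushforward => //; exact/measurable_EFinP.
Qed.

Lemma mean_distribution d' (T' : measurableType d') (X : {mfun T >-> T'}) (f : T' -> R) :
  measurable_fun [set: T'] f -> intg (f \o X) ->
  \int[distribution P X]_y f y = \int[P]_x f (X x).
Proof.
move=> mf fi; congr fine; rewrite integral_distribution//; exact/measurable_EFinP.
Qed.

End real_expectation.

(** Tonelli's theorem covers the positive and the negative part separately; [fine] makes their
    difference total, so that the sections need not be integrable. *)
Lemma measurable_Rintegral_section d d' (T : measurableType d) (T' : measurableType d')
    (R : realType) (P : probability T' R) (F : T * T' -> R) :
  measurable_fun [set: T * T'] F -> measurable_fun [set: T] (fun x => \int[P]_y F (x, y)).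
Proof.
move=> mF; apply: (@measurableT_comp _ _ _ _ _ _ fine _
  (fun x => (\int[P]_y (F (x, y))%:E)%E)) => //.
have mF' : measurable_fun [set: T * T'] (EFin \o F) by exact/measurable_EFinP.
under eq_fun do rewrite integralE.
apply: emeasurable_funB.
- apply: (eq_measurable_fun (fun x => \int[P]_y ((EFin \o F)^\+ (x, y)))%E).
    by move=> x _; apply: eq_integral => y _; rewrite !funeposE.
  by apply: measurable_fun_fubini_tonelli_F; [exact: measurable_funepos|exact: funepos_ge0].
- apply: (eq_measurable_fun (fun x => \int[P]_y ((EFin \o F)^\- (x, y)))%E).
    by move=> x _; apply: eq_integral => y _; rewrite !funenegE.
  by apply: measurable_fun_fubini_tonelli_F; [exact: measurable_funeneg|exact: funeneg_ge0].
Qed.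

(** * Orthogonal matrices *)

Section orthogonal_families.
Variable R : realType.

(** For c^2 + s^2 = 1, a rotation in the plane of the first two coordinates. *)
Definition givens d (c s : R) : 'M[R]_(1 + (1 + d)) :=
  block_mx c%:M (row_mx s%:M 0) (col_mx (- s)%:M 0) (block_mx c%:M 0 0 1%:M).

Lemma givens_col d (c s : R) (a b : 'cV[R]_1) (w : 'cV[R]_d) :
  givens d c s *m col_mx a (col_mx b w) =
  col_mx (c *: a + s *: b) (col_mx (c *: b - s *: a) w).
Proof.
rewrite /givens mul_block_col mul_row_col mul0mx addr0 !mul_scalar_mx.
congr col_mx; rewrite (@mul_col_mx _ 1 d) (@mul_block_col _ 1 d 1 d).
rewrite !mul0mx !mul_scalar_mx addr0 add0r (@add_col_mx _ 1 d) add0r scale1r.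
by rewrite addrC scaleNr.
Qed.

(* Met both by orthogonality and by invariance of the standard Gaussian measure;
   [gram_eq_orthof], which only uses these closure properties, then transfers
   the invariance to every orthogonal matrix. *)
Record orthogonal_family (Q : forall d, 'M[R]_d -> Prop) : Prop := {
  orthof_orth : forall d (A : 'M[R]_d), Q d A -> A *m A^T = 1%:M;
  orthof1 : forall d, Q d 1%:M;
  orthofM : forall d (A B : 'M[R]_d), Q d A -> Q d B -> Q d (A *m B);
  orthofT : forall d (A : 'M[R]_d), Q d A -> Q d A^T;
  orthofN1 : Q 1 (- 1%:M);
  orthof_block : forall d (A : 'M[R]_d),
    Q d A -> Q (1 + d) (block_mx 1%:M 0 0 A);
  orthof_givens : forall d c s, c ^+ 2 + s ^+ 2 = 1 -> Q _ (givens d c s) }.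

Definition e0 d : 'cV[R]_(1 + d) := delta_mx 0 0.

Lemma e0E d : e0 d = col_mx 1%:M 0.
Proof.
apply/colP => i; rewrite !mxE; case: splitP => j ij; rewrite !mxE ?ord1.
  by rewrite (_ : i = 0) ?ord1 ?eqxx//; apply: val_inj; rewrite /= ij ord1.
by rewrite (_ : (i == 0) = false)//; apply/eqP => /(congr1 val)/= i0; rewrite i0 in ij.
Qed.

Lemma sqnorm_ge0 d (v : 'cV[R]_d) : 0 <= sqnorm v.
Proof. by apply: sumr_ge0 => i _; rewrite sqr_ge0. Qed.

Lemma sqnormE d (v : 'cV[R]_d) : sqnorm v = (v^T *m v) 0 0.
Proof. by rewrite mxE; apply: eq_bigr => i _; rewrite mxE expr2. Qed.

Lemma sqnorm_eq0 d (v : 'cV[R]_d) : sqnorm v = 0 -> v = 0.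
Proof.
move=> /eqP; rewrite psumr_eq0; last by move=> i _; rewrite sqr_ge0.
move=> /allP v0; apply/colP => i; rewrite mxE; apply/eqP.
by have := v0 i (mem_index_enum _); rewrite sqrf_eq0.
Qed.

Lemma sqnorm_col_mx d (a : 'cV[R]_1) (v : 'cV[R]_d) :
  sqnorm (col_mx a v) = a 0 0 ^+ 2 + sqnorm v.
Proof. by rewrite !sqnormE tr_col_mx mul_row_col mxE mxE big_ord1 !mxE expr2. Qed.

Lemma orth_trK d (O : 'M[R]_d) : O *m O^T = 1%:M -> O^T *m O = 1%:M.
Proof. exact: mulmx1C. Qed.

Lemma eq_mulmx_vsubmx m1 m2 n p (A : 'M[R]_(m1 + m2, p)) (B : 'M[R]_(m1 + m2, n)) W :
  usubmx A = usubmx B *m W -> dsubmx A = dsubmx B *m W -> A = B *m W.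
Proof. by move=> u l; rewrite -(vsubmxK A) -(vsubmxK B) mul_col_mx u l. Qed.

Lemma mul_row_block1 m d (A : 'M[R]_(m, 1 + d)) (W : 'M[R]_d) :
  A *m block_mx 1%:M 0 0 W = row_mx (lsubmx A) (rsubmx A *m W).
Proof.
by rewrite -{1}(hsubmxK A) mul_row_block !mulmx0 addr0 add0r mulmx1.
Qed.

Variable Q : forall d, 'M[R]_d -> Prop.
Arguments Q {d}.
Hypothesis QF : orthogonal_family (@Q).

(** The induction hypothesis aligns all coordinates but the first with the second axis; a Givens
    rotation then folds the second coordinate into the first. *)
Lemma orthof_to_e0 d (v : 'cV[R]_(1 + d)) :
  exists2 S, Q S & S *m v = Num.sqrt (sqnorm v) *: e0 d.
Proof.
elim: d v => [|d IH] v.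
  pose a := v 0 0.
  have va : v = a%:M by rewrite -mx11_scalar.
  have -> : sqnorm v = a ^+ 2 by rewrite /sqnorm big_ord1.
  have e1 : e0 0 = 1%:M by rewrite e0E; apply/matrixP => i j; rewrite !ord1 !mxE; case: splitP => // k _; rewrite mxE ord1.
  rewrite sqrtr_sqr e1 -[_ *: _]/(_ *: _ : 'M[R]_1) scalemx1; have [a0|a0] := leP 0 a.
    exists 1%:M; first exact: (orthof1 QF).
    by rewrite mul1mx ger0_norm.
  by exists (- 1%:M); [exact: (orthofN1 QF)|rewrite mulNmx mul1mx va ltr0_norm ?raddfN].
change ('cV[R]_(1 + (1 + d))) in v.
rewrite -(vsubmxK v); set a := usubmx v; set w := dsubmx v.
have [S QS Sw] := IH w; set r := Num.sqrt (sqnorm w) in Sw.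
have r2 : r ^+ 2 = sqnorm w by rewrite sqr_sqrtr// sqnorm_ge0.
set n := Num.sqrt (sqnorm _).
have n2 : n ^+ 2 = a 0 0 ^+ 2 + r ^+ 2.
  by rewrite sqr_sqrtr ?sqnorm_ge0// sqnorm_col_mx r2.
(* The cosine and sine below divide by n, so the zero vector is treated apart. *)
have [n0|n0] := eqVneq n 0.
  exists 1%:M; first exact: (orthof1 QF).
  rewrite n0 scale0r; have /eqP := n2; rewrite n0 expr0n/= eq_sym.
  rewrite r2 paddr_eq0 ?sqr_ge0 ?sqnorm_ge0// => /andP[/eqP a0 /eqP w0].
  by apply: (@sqnorm_eq0 (1 + (1 + d))); rewrite mul1mx sqnorm_col_mx a0 w0 addr0.
have cs : (a 0 0 / n) ^+ 2 + (r / n) ^+ 2 = 1.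
  by rewrite !expr_div_n -mulrDl -n2 divff// sqrf_eq0.
exists (givens d (a 0 0 / n) (r / n) *m block_mx 1%:M 0 0 S).
  by apply: (orthofM QF); [exact: (orthof_givens QF)|exact: (orthof_block QF)].
rewrite -mulmxA.
have -> : block_mx 1%:M 0 0 S *m col_mx a w = col_mx a (r *: e0 d).
  by rewrite mul_block_col mul1mx !mul0mx addr0 add0r Sw.
have er k : k *: e0 d = col_mx k%:M 0 by rewrite e0E scale_col_mx scaler0 scalemx1.
have -> : n *: e0 (1 + d) = col_mx n%:M (col_mx 0 0).
  by rewrite e0E scale_col_mx scaler0 scalemx1 col_mx0.
rewrite er givens_col; set t := a 0 0; rewrite (_ : a = t%:M); last exact: mx11_scalar.
rewrite !scale_scalar_mx -!raddfD/= -raddfB/=.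
have -> : t / n * t + r / n * r = n.
  by rewrite ![_ / _ * _]mulrAC -mulrDl -!expr2 -n2 expr2 mulfK.
by rewrite (_ : _ - _ = 0) ?raddf0//; field.
Qed.

(** Induction on the rows. The first rows have equal norms, so both can be moved to the same
    multiple of the first axis. The remaining rows then agree in their first column, and what is
    left of them has equal Gram matrices. *)
Lemma gram_eq_orthof m d (A B : 'M[R]_(m, d)) :
  A *m A^T = B *m B^T -> exists2 O, Q O & A = B *m O.
Proof.
elim: m d A B => [|m IH] d A B; first by exists 1%:M; [exact: (orthof1 QF)|rewrite !flatmx0].
case: d A B => [|d] A B AB; first by exists 1%:M; [exact: (orthof1 QF)|rewrite !thinmx0].
change ('M[R]_(1 + m, 1 + d)) in A; change ('M[R]_(1 + m, 1 + d)) in B.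
have rowto (v : 'rV[R]_(1 + d)) : exists2 S : 'M[R]_(1 + d), Q S &
    v = Num.sqrt (sqnorm v^T) *: (row_mx 1%:M 0 *m S).
  have [S QS Sv] := orthof_to_e0 v^T; exists S => //.
  move: (congr1 trmx Sv); rewrite trmx_mul trmxK linearZ/= e0E tr_col_mx trmx1 trmx0.
  move=> /(congr1 (fun w => w *m S)); rewrite -mulmxA orth_trK ?(orthof_orth QF)//.
  by rewrite mulmx1 -scalemxAl.
have [S1 QS1] := rowto (usubmx A); have [S2 QS2] := rowto (usubmx B).
have [S1o S2o] := (orthof_orth QF QS1, orthof_orth QF QS2).
have AAT : A *m A^T = block_mx (usubmx A *m (usubmx A)^T) (usubmx A *m (dsubmx A)^T)
   (dsubmx A *m (usubmx A)^T) (dsubmx A *m (dsubmx A)^T).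
  by rewrite -{1 2}(vsubmxK A) tr_col_mx mul_col_row.
have BBT : B *m B^T = block_mx (usubmx B *m (usubmx B)^T) (usubmx B *m (dsubmx B)^T)
   (dsubmx B *m (usubmx B)^T) (dsubmx B *m (dsubmx B)^T).
  by rewrite -{1 2}(vsubmxK B) tr_col_mx mul_col_row.
move: AB; rewrite AAT BBT => ABe; have [ab _ ab' AB'] := @eq_block_mx _ 1 m 1 m _ _ _ _ _ _ _ _ ABe.
have -> : sqnorm (usubmx B)^T = sqnorm (usubmx A)^T by rewrite !sqnormE !trmxK ab.
set r := Num.sqrt _ => eB eA.
(* If r = 0 both first rows vanish, and a factor for the remaining rows suffices. *)
have [r0|r0] := eqVneq r 0.
  have [W QW AO] := IH _ _ _ AB'; exists W => //.
  by apply: (@eq_mulmx_vsubmx 1 m) => //; rewrite eB eA r0 !scale0r mul0mx.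
pose A' := dsubmx A *m S1^T; pose B' := dsubmx B *m S2^T.
have eA' : dsubmx A = A' *m S1 by rewrite -mulmxA orth_trK// mulmx1.
have eB' : dsubmx B = B' *m S2 by rewrite -mulmxA orth_trK// mulmx1.
(* The first columns are the inner products with the first row, divided by r. *)
have lAB : lsubmx A' = lsubmx B'.
  have tr0 : (row_mx 1%:M 0 : 'rV[R]_(1 + d))^T = col_mx 1%:M 0.
    by rewrite tr_row_mx trmx1 trmx0.
  move: ab'; rewrite eB eA !linearZ/= !trmx_mul tr0 => /(scalerI r0).
  rewrite !mulmxA -/A' -/B' -(hsubmxK A') -(hsubmxK B') !mul_row_col.
  by rewrite !mulmx1 !mulmx0 !addr0 !row_mxKl.
have AB'' : A' *m A'^T = B' *m B'^T.
  move: AB'; rewrite eA' eB' !trmx_mul !mulmxA -(mulmxA A') -(mulmxA B').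
  by rewrite S1o S2o !mulmx1.
have rAB : rsubmx A' *m (rsubmx A')^T = rsubmx B' *m (rsubmx B')^T.
  move: AB''; rewrite -(hsubmxK A') -(hsubmxK B') !tr_row_mx !mul_row_col lAB.
  by move=> /addrI; rewrite !row_mxKr.
have [W QW AO] := IH _ _ _ rAB.
exists (S2^T *m (block_mx 1%:M 0 0 W *m S1)).
  apply: (orthofM QF); first exact: (orthofT QF).
  by apply: (orthofM QF) => //; exact: (orthof_block QF).
apply: (@eq_mulmx_vsubmx 1 m).
  rewrite eB eA -!scalemxAl; congr (_ *: _).
  rewrite -!mulmxA (mulmxA S2) S2o mul1mx mulmxA mul_row_block1.
  by rewrite row_mxKl row_mxKr mul0mx.
have -> : dsubmx A = B' *m block_mx 1%:M 0 0 W *m S1.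
  by rewrite mul_row_block1 -AO -lAB hsubmxK.
by rewrite /B' !mulmxA.
Qed.

End orthogonal_families.

(** * Symmetric matrices and their square roots *)

Section symmetric_matrices.
Import complex.
Variable R : realType.

(** Over the complex numbers the matrix is Hermitian and has a real eigenvalue. Being a root of the
    characteristic polynomial descends to R, where it yields a real eigenvector. *)
Lemma real_symmetric_eigen d (A : 'M[R]_d.+1) : A^T = A ->
  exists l (v : 'cV[R]_d.+1), v != 0 /\ A *m v = l *: v.
Proof.
move=> AT; pose C : numClosedFieldType := complex R.
pose f : {rmorphism R -> C} := real_complex R.
pose Ac : 'M[C]_d.+1 := map_mx f A.
have Areal : Ac \is a realmx.
  by apply/mxOverP => i j; rewrite mxE; apply/complex_realP; exists (A i j).
have Aherm : Ac \is hermsymmx.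
  by apply: realsym_hermsym => //; apply/is_hermitianmxP; rewrite expr0 scale1r map_mx_id// /Ac map_trmx AT.
have /mxOverP/(_ 0 0)/complex_realP[l la] := hermitian_spectral_diag_real Aherm.
have /hermitian_normalmx/orthomx_spectralP := Aherm.
set U := spectralmx Ac; set D := spectral_diag Ac => AE.
have eig : eigenvalue Ac (f l).
  apply/eigenvalueP; exists (row 0 U); last first.
    apply/negP => /eqP r0; have := spectral_unit Ac; rewrite -/U => Uu.
    have : row 0 U *m invmx U = row 0 1%:M by rewrite -row_mul mulmxV.
    by rewrite r0 mul0mx => /rowP/(_ 0); rewrite !mxE => /eqP; rewrite eq_sym oner_eq0.
  rewrite -row_mul {1}AE !mulmxA mulmxV ?spectral_unit// mul1mx.
  apply/rowP => j; rewrite !mxE (bigD1 0)//= big1 => [|k k0].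
    by rewrite addr0 mxE eqxx mulr1n -/f -la.
  by rewrite mxE eq_sym (negbTE k0) mulr0n mul0r.
move: eig; rewrite eigenvalue_root_char -map_char_poly fmorph_root -eigenvalue_root_char.
case/eigenvalueP => v vA v0; exists l, v^T; split.
  by apply: contra v0 => /eqP/(congr1 trmx); rewrite trmxK trmx0 => ->.
by rewrite -{1}AT -trmx_mul vA linearZ.
Qed.

Lemma orthogonal_orthof : orthogonal_family (fun d (A : 'M[R]_d) => A *m A^T = 1%:M).
Proof.
split=> //=.
- by move=> d; rewrite trmx1 mulmx1.
- by move=> d A B A1 B1; rewrite trmx_mul -mulmxA (mulmxA B) B1 mul1mx.
- by move=> d A /mulmx1C; rewrite trmxK.
- by rewrite linearN/= trmx1 mulNmx mulmxN opprK mulmx1.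
- move=> d A A1; rewrite tr_block_mx !trmx0 trmx1 mulmx_block.
  by rewrite !mulmx0 !mul0mx mulmx1 A1 !addr0 add0r -scalar_mx_block.
- move=> d c s cs.
  (* A matrix is determined by its action on columns, which [givens_col] computes. *)
  suff H (v : 'cV_(1 + (1 + d))) : givens d c s *m ((givens d c s)^T *m v) = v.
    apply/matrixP => i j; have /colP/(_ i) := H (delta_mx j 0).
    rewrite mulmxA -colE mxE [RHS]mxE eqxx andbT => ->; by rewrite mxE.
  have -> : (givens d c s)^T = givens d c (- s).
    rewrite /givens tr_block_mx (@tr_row_mx _ 1 1 d) (@tr_col_mx _ 1 d 1) (@tr_block_mx _ 1 d 1 d).
    by rewrite !trmx0 trmx1 !tr_scalar_mx opprK.
  rewrite -(vsubmxK v) -(vsubmxK (dsubmx v)) !givens_col; congr (col_mx _ (col_mx _ _)).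
    rewrite -[RHS]scale1r -cs; apply/matrixP => i j; rewrite !mxE; ring.
  by rewrite -[RHS]scale1r -cs; apply/matrixP => i j; rewrite !mxE; ring.
Qed.

Lemma block_diag_conj m d (U : 'M[R]_d) (l : R) (k : 'rV[R]_d) :
  block_mx (1%:M : 'M[R]_m) 0 0 U *m diag_mx (row_mx (const_mx l) k) *m
    (block_mx 1%:M 0 0 U)^T = block_mx l%:M 0 0 (U *m diag_mx k *m U^T).
Proof.
rewrite diag_mx_row diag_const_mx tr_block_mx !trmx0 trmx1 !mulmx_block.
by rewrite !(mulmx0, mul0mx, addr0, add0r, mul1mx, mulmx1).
Qed.

(** Deflation: an orthogonal S sends an eigenvector to the first axis, and S A S^t then splits into
    a 1 x 1 block and a smaller symmetric block. *)
Lemma real_spectral d (A : 'M[R]_d) : A^T = A ->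
  exists (U : 'M[R]_d) (l : 'rV[R]_d), U *m U^T = 1%:M /\ A = U *m diag_mx l *m U^T.
Proof.
elim: d A => [|d IH] A AT.
  by exists 1%:M, 0; split; rewrite ?[LHS]flatmx0 ?[RHS]flatmx0// [A]flatmx0 [RHS]flatmx0.
have [l [v [v0 Av]]] := real_symmetric_eigen AT.
have [S QS Sv] := orthof_to_e0 orthogonal_orthof (v : 'cV_(1 + d)).
set n := Num.sqrt _ in Sv.
have Sv' : S^T *m e0 R d = n^-1 *: v.
  have n0 : n != 0.
    apply: contra v0 => /eqP n0; rewrite -[v]mul1mx -(orth_trK QS) -mulmxA Sv n0.
    by rewrite scale0r mulmx0.
  apply: (scalerI n0); rewrite scalerA mulfV// scale1r scalemxAr -Sv mulmxA.
  by rewrite orth_trK// mul1mx.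
pose B := (S *m A *m S^T : 'M[R]_(1 + d)).
have Be : B *m e0 R d = l *: e0 R d.
  rewrite /B -!mulmxA Sv' -!scalemxAr Av -!scalemxAr scalerA mulrC -scalerA; congr (_ *: _).
  by rewrite scalemxAr -Sv' mulmxA QS mul1mx.
have BT : B^T = B by rewrite /B !trmx_mul trmxK AT !mulmxA.
have Bl : lsubmx B = col_mx l%:M 0.
  have : B *m e0 R d = lsubmx B.
    by rewrite e0E -{1}(hsubmxK B) mul_row_col mulmx1 mulmx0 addr0.
  by rewrite Be e0E scale_col_mx scaler0 scalemx1.
have BE : B = block_mx l%:M 0 0 (drsubmx B).
  rewrite -{1}(submxK B); congr block_mx.
  - by rewrite /ulsubmx; move: (congr1 usubmx Bl); rewrite col_mxKu => <-; rewrite [in RHS]/lsubmx; apply/matrixP => i j; rewrite !mxE.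
  - rewrite -[LHS]trmxK trmx_ursub BT; apply/eqP; rewrite trmx_eq0; apply/eqP.
    by move: (congr1 dsubmx Bl); rewrite col_mxKd => <-; apply/matrixP => i j; rewrite !mxE.
  - by move: (congr1 dsubmx Bl); rewrite col_mxKd => <-; apply/matrixP => i j; rewrite !mxE.
have [U [k [UU DE]]] := IH (drsubmx B) (etrans (trmx_drsub B) (congr1 drsubmx BT)).
pose W := (block_mx 1%:M 0 0 U : 'M[R]_(1 + d)).
have WW : W *m W^T = 1%:M by exact: (orthof_block orthogonal_orthof UU).
exists (S^T *m W), (row_mx (const_mx l) k : 'rV[R]_(1 + d)); split.
  rewrite trmx_mul trmxK -mulmxA (mulmxA W) WW mul1mx; exact: orth_trK.
have -> : A = S^T *m B *m S.
  by rewrite /B !mulmxA orth_trK// mul1mx -!mulmxA orth_trK// mulmx1.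
clearbody B.
rewrite trmx_mul trmxK !mulmxA; congr (_ *m S); rewrite -!mulmxA; congr (_ *m _).
by rewrite mulmxA BE DE; exact/esym/block_diag_conj.
Qed.

Lemma covariance_gram d m (A : 'M[R]_(d, m)) : covariance_matrix (A *m A^T).
Proof.
split; first by rewrite trmx_mul trmxK.
move=> x; rewrite /bform.
have -> : x^T *m (A *m A^T) *m x = (A^T *m x)^T *m (A^T *m x).
  by rewrite trmx_mul trmxK !mulmxA.
by rewrite -sqnormE sqnorm_ge0.
Qed.

Lemma diag_conj_gram d (U : 'M[R]_d) (l : 'rV[R]_d) : (forall i, 0 <= l 0 i) ->
  let B := U *m diag_mx (map_mx Num.sqrt l) in
  U *m diag_mx l *m U^T = B *m B^T.
Proof.
move=> l0 /=; rewrite trmx_mul tr_diag_mx mulmxA; congr (_ *m _).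
rewrite -mulmxA mulmx_diag; congr (_ *m diag_mx _).
by apply/rowP => i; rewrite !mxE -expr2 sqr_sqrtr.
Qed.

Lemma covariance_spectral d (A : 'M[R]_d) : covariance_matrix A ->
  exists (U : 'M[R]_d) (l : 'rV[R]_d),
   [/\ U *m U^T = 1%:M, forall i, 0 <= l 0 i & A = U *m diag_mx l *m U^T].
Proof.
move=> [AT A0]; have [U [l [UU AE]]] := real_spectral AT.
exists U, l; split => // i; have := A0 (col i U).
rewrite /bform AE !mulmxA tr_col -[_ *m U](row_mul i U^T U) orth_trK//.
by rewrite colE -[_ *m U^T *m _]mulmxA (mulmxA U^T) orth_trK// mul1mx row1 -rowE -colE !mxE eqxx.
Qed.

End symmetric_matrices.

Section matrix_square_root.
Variable R : realType.
Implicit Types d : nat.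

Lemma gram_entry m n (X : 'M[R]_(m, n)) i : (X *m X^T) i i = \sum_j X i j ^+ 2.
Proof. by rewrite mxE; apply: eq_bigr => j _; rewrite mxE expr2. Qed.

Lemma fro_ge0 m n (X : 'M[R]_(m, n)) : 0 <= \tr (X *m X^T).
Proof. by apply: sumr_ge0 => i _; rewrite gram_entry sumr_ge0// => j _; rewrite sqr_ge0. Qed.

Lemma fro_eq0 m n (X : 'M[R]_(m, n)) : \tr (X *m X^T) = 0 -> X = 0.
Proof.
move=> /eqP; rewrite /mxtrace psumr_eq0 => [|i _]; last first.
  by rewrite gram_entry sumr_ge0// => j _; rewrite sqr_ge0.
move=> /allP X0; apply/matrixP => i j; have := X0 i (mem_index_enum _).
rewrite gram_entry psumr_eq0 => [|k _]; last by rewrite sqr_ge0.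
by move=> /allP/(_ j (mem_index_enum _)); rewrite sqrf_eq0 mxE => /eqP.
Qed.

Lemma mxtraceT d (X : 'M[R]_d) : \tr X^T = \tr X.
Proof. by apply: eq_bigr => i _; rewrite mxE. Qed.

Lemma mxtraceB d (X Y : 'M[R]_d) : \tr (X - Y) = \tr X - \tr Y.
Proof. exact: linearB. Qed.

(** Expands |a X - Y|^2 >= 0 in the Frobenius norm. The free parameter a serves for Cauchy-Schwarz
    as well as for Young's inequality. *)
Lemma fro_mul_le m n (X Y : 'M[R]_(m, n)) a :
  2 * a * \tr (X *m Y^T) <= a ^+ 2 * \tr (X *m X^T) + \tr (Y *m Y^T).
Proof.
rewrite -subr_ge0 [X in _ <= X](_ : _ = \tr ((a *: X - Y) *m (a *: X - Y)^T)).
  exact: fro_ge0.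
rewrite [(_ - _)^T]linearB/= [(a *: X)^T]linearZ/= mulmxBl !mulmxBr -!scalemxAl -!scalemxAr.
rewrite scalerA !mxtraceB !mxtraceZ.
by rewrite -[\tr (Y *m X^T)]mxtraceT trmx_mul trmxK; ring.
Qed.

(** Cauchy-Schwarz for each entry of the product, summed over the entries. *)
Lemma fro_mulmx m n p (X : 'M[R]_(m, n)) (Y : 'M[R]_(n, p)) :
  \tr ((X *m Y) *m (X *m Y)^T) <= \tr (X *m X^T) * \tr (Y *m Y^T).
Proof.
rewrite /mxtrace mulr_suml ler_sum// => i _; rewrite !gram_entry.
rewrite [leRHS](_ : _ = \sum_k (\sum_j X i j ^+ 2) * (\sum_j Y j k ^+ 2)).
  apply: ler_sum => k _; rewrite mxE.
  have := fro_mul_le (row i X) (\row_j Y j k).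
  have -> : \tr (row i X *m (\row_j Y j k)^T) = \sum_j X i j * Y j k.
    by rewrite /mxtrace big_ord1 mxE; apply: eq_bigr => j _; rewrite !mxE.
  have -> : \tr (row i X *m (row i X)^T) = \sum_j X i j ^+ 2.
    by rewrite /mxtrace big_ord1 gram_entry; apply: eq_bigr => j _; rewrite !mxE.
  have -> : \tr ((\row_j Y j k) *m (\row_j Y j k)^T) = \sum_j Y j k ^+ 2.
    by rewrite /mxtrace big_ord1 gram_entry; apply: eq_bigr => j _; rewrite !mxE.
  set p' := \sum_j X i j * Y j k; set a := \sum_j _; set b := \sum_j _ => H.
  have a0 : 0 <= a by apply: sumr_ge0 => j _; rewrite sqr_ge0.
  have b0 : 0 <= b by apply: sumr_ge0 => j _; rewrite sqr_ge0.
  have [aE|an] := eqVneq a 0.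
    have [->|pn] := eqVneq p' 0; first by rewrite expr0n/= mulr_ge0.
    (* For a = 0 and p' nonzero, this choice of the parameter would give b + 1 <= b. *)
    have := H ((b + 1) / (2 * p')); rewrite aE mulr0 add0r.
    have -> : 2 * ((b + 1) / (2 * p')) * p' = b + 1 by field.
    lra.
  (* The optimal parameter in Cauchy-Schwarz. *)
  have := H (p' / a).
  have -> : 2 * (p' / a) * p' = 2 * (p' ^+ 2 / a) by field.
  have -> : (p' / a) ^+ 2 * a = p' ^+ 2 / a by field.
  by rewrite -lerBlDl mulr_natl mulr2n addrK ler_pdivrMr ?lt0r ?an// mulrC.
rewrite -mulr_sumr; congr (_ * _).
rewrite exchange_big/=; apply: eq_bigr => j _; exact: gram_entry.
Qed.

Lemma spectral_sqrt_exists d (A : 'M[R]_d) : covariance_matrix A ->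
  exists B, spectral_sqrt A B.
Proof.
move=> /covariance_spectral[U [l [UU l0 AE]]].
by exists (U *m diag_mx (map_mx Num.sqrt l) *m U^T), U, l.
Qed.

Lemma sqrtmP d (A : 'M[R]_d) : covariance_matrix A -> spectral_sqrt A (sqrtm A).
Proof. by move=> /spectral_sqrt_exists[B AB]; rewrite /sqrtm; apply: xgetPex; exists B. Qed.

Lemma spectral_sqrtK d (A B : 'M[R]_d) : spectral_sqrt A B -> B *m B = A.
Proof.
move=> [U [l [UU l0 -> ->]]].
rewrite -!mulmxA (mulmxA U^T) orth_trK// mul1mx (mulmxA (diag_mx _)) mulmx_diag !mulmxA.
congr (_ *m diag_mx _ *m _); apply/rowP => i; rewrite !mxE -expr2 sqr_sqrtr//.
Qed.

Lemma spectral_sqrt_cov d (A B : 'M[R]_d) : spectral_sqrt A B -> covariance_matrix B.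
Proof.
move=> [U [l [UU l0 _ ->]]]; rewrite diag_conj_gram => [|i]; first exact: covariance_gram.
by rewrite mxE sqrtr_ge0.
Qed.

Lemma sqrtm_cov d (A : 'M[R]_d) : covariance_matrix A -> covariance_matrix (sqrtm A).
Proof. by move=> /sqrtmP/spectral_sqrt_cov. Qed.

Lemma sqrtmK d (A : 'M[R]_d) : covariance_matrix A -> sqrtm A *m sqrtm A = A.
Proof. by move=> /sqrtmP/spectral_sqrtK. Qed.

Lemma sqrtm_sym d (A : 'M[R]_d) : covariance_matrix A -> (sqrtm A)^T = sqrtm A.
Proof. by move=> /sqrtm_cov[]. Qed.

Lemma sqrtm_gram d (A : 'M[R]_d) : covariance_matrix A -> sqrtm A *m (sqrtm A)^T = A.
Proof. by move=> hA; rewrite sqrtm_sym// sqrtmK. Qed.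

Lemma covariance_conj d m (A : 'M[R]_d) (X : 'M[R]_(m, d)) :
  covariance_matrix A -> covariance_matrix (X *m A *m X^T).
Proof.
move=> /sqrtm_gram <-.
rewrite (_ : _ *m X^T = (X *m sqrtm A) *m (X *m sqrtm A)^T); first exact: covariance_gram.
by rewrite trmx_mul !mulmxA.
Qed.

Lemma covariance_conj_fro d m (A : 'M[R]_d) (X : 'M[R]_(m, d)) : covariance_matrix A ->
  \tr (X *m A *m X^T) = \tr ((X *m sqrtm A) *m (X *m sqrtm A)^T).
Proof. by move=> hA; rewrite trmx_mul !mulmxA -(mulmxA X (sqrtm A)) sqrtm_gram. Qed.

Lemma covariance_conj_ge0 d m (A : 'M[R]_d) (X : 'M[R]_(m, d)) :
  covariance_matrix A -> 0 <= \tr (X *m A *m X^T).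
Proof. by move=> hA; rewrite covariance_conj_fro// fro_ge0. Qed.

Lemma covariance_conj_eq0 d m (A : 'M[R]_d) (X : 'M[R]_(m, d)) :
  covariance_matrix A -> \tr (X *m A *m X^T) = 0 -> X *m A = 0.
Proof.
move=> hA; rewrite covariance_conj_fro// => /fro_eq0 X0.
by rewrite -(sqrtmK hA) mulmxA X0 mul0mx.
Qed.

Lemma covarianceD d (A B : 'M[R]_d) : covariance_matrix A -> covariance_matrix B ->
  covariance_matrix (A + B).
Proof.
move=> [AT A0] [BT B0]; split; first by rewrite linearD/= AT BT.
by move=> x; rewrite /bform mulmxDr mulmxDl mxE addr_ge0//; [exact: A0|exact: B0].
Qed.

Lemma covarianceZ d a (A : 'M[R]_d) : 0 <= a -> covariance_matrix A ->
  covariance_matrix (a *: A).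
Proof.
move=> a0 [AT A0]; split; first by rewrite linearZ/= AT.
by move=> x; rewrite /bform -scalemxAr -scalemxAl mxE mulr_ge0//; exact: A0.
Qed.

Lemma covariance1 d : covariance_matrix (1%:M : 'M[R]_d).
Proof. by rewrite -[1%:M]mulmx1 -{2}trmx1; exact: covariance_gram. Qed.

Lemma covariance0 d : covariance_matrix (0 : 'M[R]_d).
Proof. by rewrite -[0](mulmx0 _ (0 : 'M[R]_d)) -{2}trmx0; exact: covariance_gram. Qed.

(* With D = A - B, the identity D A + B D = A^2 - B^2 is traced against D. *)
Lemma sqrt_difference_trace d (A B : 'M[R]_d) : A^T = A -> B^T = B ->
  let D := A - B in
  \tr (D *m A *m D^T) + \tr (D *m B *m D^T) = \tr (D *m (A *m A - B *m B)).
Proof.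
move=> AT BT D; have DT : D^T = D by rewrite /D linearB/= AT BT.
have -> : A *m A - B *m B = D *m A + B *m D.
  by rewrite /D mulmxBl mulmxBr addrA addrNK.
by clearbody D; rewrite mulmxDr mxtraceD DT [\tr (D *m A *m D)]mxtrace_mulC !mulmxA.
Qed.

(** With D = A - B, the nonnegative traces of D A D^t and D B D^t add up to 0. Hence D A = D B = 0,
    and |D|^2 = tr (D A - D B) = 0. *)
Lemma covariance_sqr_inj d (A B : 'M[R]_d) : covariance_matrix A ->
  covariance_matrix B -> A *m A = B *m B -> A = B.
Proof.
move=> hA hB AB; have := sqrt_difference_trace hA.1 hB.1.
rewrite /= AB subrr mulmx0 linear0 => /eqP.
rewrite paddr_eq0 ?covariance_conj_ge0// => /andP[/eqP/covariance_conj_eq0-/(_ hA) DA /eqP/covariance_conj_eq0-/(_ hB) DB].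
apply/eqP; rewrite -subr_eq0; apply/eqP; apply: fro_eq0.
by rewrite linearB/= hA.1 hB.1 mulmxBr DA DB subrr linear0.
Qed.

Lemma sqrtm_unique d (A B : 'M[R]_d) : covariance_matrix B -> B *m B = A -> sqrtm A = B.
Proof.
move=> hB BB; have hA : covariance_matrix A by rewrite -BB -{2}hB.1; exact: covariance_gram.
by apply: covariance_sqr_inj => //; [exact: sqrtm_cov|rewrite sqrtmK].
Qed.

Lemma sqrtm_unitmx d (A : 'M[R]_d) : covariance_matrix A -> A \in unitmx -> sqrtm A \in unitmx.
Proof. by move=> hA; rewrite -{1}(sqrtmK hA) unitmx_mul => /andP[]. Qed.

Lemma rank_unitmx d (A : 'M[R]_d) : \rank A = d -> A \in unitmx.
Proof. by move=> rA; rewrite -row_full_unit /row_full rA. Qed.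

Lemma covariance_inv d (A : 'M[R]_d) : covariance_matrix A -> A \in unitmx ->
  covariance_matrix (invmx A).
Proof.
move=> hA uA; have := covariance_conj (invmx A) hA.
by rewrite mulVmx// mul1mx trmx_inv hA.1.
Qed.

(** Write X = (X A^(1/2)) A^(-1/2) and use submultiplicativity. The constant is 1 / (1 + t) rather
    than 1 / t because t = 0 in dimension 0. *)
Lemma covariance_coercive d (A : 'M[R]_d) : covariance_matrix A -> A \in unitmx ->
  exists2 c, 0 < c & forall m (X : 'M[R]_(m, d)),
    c * \tr (X *m X^T) <= \tr (X *m A *m X^T).
Proof.
move=> hA uA; set t := \tr (invmx (sqrtm A) *m (invmx (sqrtm A))^T).
have t0 : 0 <= t by exact: fro_ge0.
exists (1 + t)^-1 => [|m X]; first by rewrite invr_gt0; lra.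
rewrite covariance_conj_fro//; set Y := X *m sqrtm A.
have -> : X = Y *m invmx (sqrtm A) by rewrite mulmxK// sqrtm_unitmx.
rewrite ler_pdivrMl; last lra.
apply: (le_trans (fro_mulmx _ _)); rewrite -/t mulrC ler_wpM2r ?fro_ge0//; lra.
Qed.

(** A^2 - B^2 - (A - B)^2 = (A - B) B + B (A - B), and multiplied by the inverse of B this has trace
    2 tr (A - B). The expansion of the trace of a square root is thus exact, with an explicit
    quadratic remainder. *)
Lemma mxtrace_sqrt_expansion d (A B : 'M[R]_d) : B^T = B -> B \in unitmx ->
  \tr (A - B) = 2^-1 * \tr (invmx B *m (A *m A - B *m B))
     - 2^-1 * \tr (invmx B *m ((A - B) *m (A - B))).
Proof.
move=> BT uB; rewrite -mulrBr -mxtraceB -mulmxBr.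
have -> : A *m A - B *m B - (A - B) *m (A - B) = (A - B) *m B + B *m (A - B).
  by rewrite !mulmxBl !mulmxBr; apply/matrixP => i j; rewrite !mxE; ring.
move: (A - B) => D.
rewrite mulmxDr mulmxA mxtraceD mxtrace_mulC !mulmxA mulmxV// mulVmx// !mul1mx.
by field.
Qed.

End matrix_square_root.

(** * Gaussian measures *)

Section lebesgue_invariance.
Context {R : realType}.
Local Notation mu := (@lebesgue_measure R).
Local Open Scope ereal_scope.

(** Translations preserve the length of intervals, which characterizes the measure. *)
Lemma lebesgue_measure_shift a (A : set (measurableTypeR R)) : measurable A ->
  mu ((fun x => (x + a)%R) @^-1` A) = mu A.
Proof.
have mf : measurable_fun [set: measurableTypeR R]
    (fun x : measurableTypeR R => (x + a)%R : measurableTypeR R).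
  exact: measurable_funD.
move=> mA; apply/esym.
apply: (@lebesgue_measure_unique _ (pushforward mu (fun x => (x + a)%R : measurableTypeR R))) => //.
move=> _ [[x y] _ <-]; rewrite /pushforward.
rewrite [X in _ = mu X](_ : _ = `]x - a, y - a]%classic)%R; last first.
  by apply/seteqP; split => z /=; rewrite !in_itv/= ltrBlDr lerBrDr.
rewrite !lebesgue_measure_itv/= !lte_fin ltrD2r; case: ifP => // _.
by rewrite -!EFinB; congr EFin; ring.
Qed.

Lemma lebesgue_measure_opp (A : set (measurableTypeR R)) : measurable A ->
  mu ((fun x => (- x)%R) @^-1` A) = mu A.
Proof.
have mf : measurable_fun [set: measurableTypeR R]
    (fun x : measurableTypeR R => (- x)%R : measurableTypeR R).
  exact: measurable_funN.
move=> mA; apply/esym.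
apply: (@lebesgue_measure_unique _ (pushforward mu (fun x => (- x)%R : measurableTypeR R))) => //.
move=> _ [[x y] _ <-]; rewrite /pushforward.
rewrite [X in _ = mu X](_ : _ = `[- y, - x[%classic)%R; last first.
  by apply/seteqP; split => z /=; rewrite !in_itv/= ltrNr lerNl andbC.
rewrite !lebesgue_measure_itv/= !lte_fin ltrN2; case: ifP => // _.
by rewrite -!EFinB; congr EFin; ring.
Qed.

Lemma ge0_integral_lebesgue_shift a (f : R -> \bar R) :
  measurable_fun [set: measurableTypeR R] f -> (forall x, 0 <= f x) ->
  \int[mu]_x f (x + a)%R = \int[mu]_x f x.
Proof.
have mg : measurable_fun [set: measurableTypeR R]
    (fun x : measurableTypeR R => (x + a)%R : measurableTypeR R).
  exact: measurable_funD.
move=> mf f0.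
rewrite -[RHS](@eq_measure_integral _ _ _ _ _ (pushforward mu (fun x => (x + a)%R : measurableTypeR R))).
  by rewrite ge0_integral_pushforward.
by move=> A mA _; exact: lebesgue_measure_shift.
Qed.

Lemma ge0_integral_lebesgue_opp (f : R -> \bar R) :
  measurable_fun [set: measurableTypeR R] f -> (forall x, 0 <= f x) ->
  \int[mu]_x f (- x)%R = \int[mu]_x f x.
Proof.
have mg : measurable_fun [set: measurableTypeR R]
    (fun x : measurableTypeR R => (- x)%R : measurableTypeR R).
  exact: measurable_funN.
move=> mf f0.
rewrite -[RHS](@eq_measure_integral _ _ _ _ _ (pushforward mu (fun x => (- x)%R : measurableTypeR R))).
  by rewrite ge0_integral_pushforward.
by move=> A mA _; exact: lebesgue_measure_opp.
Qed.

(** The change of variables brings in the Radon-Nikodym derivative; it is almost everywhere the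
    density because both have the same integral over every measurable set. *)
Lemma ge0_integral_normal_prob m s (f : R -> \bar R) :
  measurable_fun [set: measurableTypeR R] f -> (forall x, 0 <= f x) ->
  \int[normal_prob m s]_x f x = \int[mu]_x (f x * (normal_pdf m s x)%:E).
Proof.
move=> mf f0.
have dom := normal_prob_dominates m s.
rewrite -(Radon_Nikodym_SigmaFinite.change_of_variables dom)//.
have mpdf : measurable_fun [set: measurableTypeR R] (fun x => (normal_pdf m s x)%:E).
  by apply/measurable_EFinP; exact: measurable_normal_pdf.
have RNi := Radon_Nikodym_SigmaFinite.f_integrable dom.
apply: ae_eq_integral => //.
- by apply: emeasurable_funM => //; exact: measurable_int RNi.
- exact: emeasurable_funM.
- apply: ae_eqe_mul2l; apply: integral_ae_eq => //.
  by move=> E _ mE; rewrite -Radon_Nikodym_SigmaFinite.f_integral.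
Qed.

End lebesgue_invariance.

(** * Rotation invariance of the Gaussian measure in the plane *)

Section normal_rotation.
Context {R : realType}.
Local Notation mu := (@lebesgue_measure R).
Local Notation RR := (measurableTypeR R * measurableTypeR R)%type.
Local Open Scope ereal_scope.

Let shear1 (t : R) (z : RR) : RR := (z.1 + t * z.2, z.2)%R.
Let shear2 (t : R) (z : RR) : RR := (z.1, z.2 + t * z.1)%R.

Let measurable_shear1 t : measurable_fun [set: RR] (shear1 t).
Proof.
apply/measurable_fun_pair; last exact: measurable_snd.
apply: measurable_funD; first exact: measurable_fst.
by apply: measurable_funM => //; exact: measurable_snd.
Qed.

Let measurable_shear2 t : measurable_fun [set: RR] (shear2 t).
Proof.
apply/measurable_fun_pair; first exact: measurable_fst.
apply: measurable_funD; first exact: measurable_snd.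
by apply: measurable_funM => //; exact: measurable_fst.
Qed.

(** Plane integrals are kept iterated: a shear is then a translation of the inner variable, possibly
    after exchanging the order of integration. *)
Let I2 (H : RR -> \bar R) := \int[mu]_x \int[mu]_y H (x, y).

Let I2_shear2 t H : measurable_fun [set: RR] H -> (forall z, 0 <= H z) ->
  I2 (H \o shear2 t) = I2 H.
Proof.
move=> mH H0; apply: eq_integral => x _ /=.
rewrite /shear2/= (@ge0_integral_lebesgue_shift R (t * x)%R (fun y => H (x, y)))//.
exact: measurableT_comp.
Qed.

Let I2_shear1 t H : measurable_fun [set: RR] H -> (forall z, 0 <= H z) ->
  I2 (H \o shear1 t) = I2 H.
Proof.
move=> mH H0.
have mH1 : measurable_fun [set: RR] (H \o shear1 t).
  by apply: measurableT_comp => //; exact: measurable_shear1.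
have H01 z : 0 <= (H \o shear1 t) z by exact: H0.
have F1 := @sfinite_Fubini _ _ _ _ _ mu mu _ H01 mH1.
have F2 := @sfinite_Fubini _ _ _ _ _ mu mu _ H0 mH.
transitivity (\int[mu]_y \int[mu]_x (H \o shear1 t) (x, y)); first exact: F1.
transitivity (\int[mu]_y \int[mu]_x H (x, y)); last exact/esym.
apply: eq_integral => y _ /=.
rewrite /shear1/= (@ge0_integral_lebesgue_shift R (t * y)%R (fun x => H (x, y)))//.
exact: measurableT_comp.
Qed.

Let I2_opp H : measurable_fun [set: RR] H -> (forall z, 0 <= H z) ->
  I2 (fun z => H (- z.1, - z.2)%R) = I2 H.
Proof.
move=> mH H0.
have mU := @measurable_fun_fubini_tonelli_F _ _ _ _ _ mu H mH H0.
have U0 x : 0 <= \int[mu]_y H (x, y) by exact: integral_ge0.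
apply: etrans _ (ge0_integral_lebesgue_opp mU U0); apply: eq_integral => x _ /=.
rewrite (@ge0_integral_lebesgue_opp R (fun y => H (- x, y)%R))//.
exact: measurableT_comp.
Qed.

Definition rotation2 (c s : R) (z : RR) : RR := (c * z.1 + s * z.2, c * z.2 - s * z.1)%R.

Lemma measurable_rotation2 c s : measurable_fun [set: RR] (rotation2 c s).
Proof.
apply/measurable_fun_pair; [apply: measurable_funD|apply: measurable_funB];
  apply: measurable_funM => //; solve [exact: measurable_fst|exact: measurable_snd].
Qed.

(* A rotation of angle other than pi is a product of three shears. *)
Let I2_rotation c s H : (c ^+ 2 + s ^+ 2 = 1)%R -> measurable_fun [set: RR] H ->
  (forall z, 0 <= H z) -> I2 (H \o rotation2 c s) = I2 H.
Proof.
(* The half turn has no such decomposition; it is the reflection in both coordinates. *)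
move=> cs mH H0; have [c1|c1] := eqVneq c (-1)%R.
  have s0 : s = 0%R.
    by apply/eqP; rewrite -(sqrf_eq0 s) -[(s ^+ 2)%R](addKr (c ^+ 2)%R) cs c1 sqrrN expr1n addrC subrr.
  apply: etrans _ (I2_opp mH H0); congr I2; apply/funext => -[x y].
  by rewrite /rotation2/= c1 s0 !mul0r !mulN1r addr0 subr0.
have c10 : (1 + c != 0)%R by rewrite addrC addr_eq0.
(* The tangent of half the angle. *)
pose t := (s / (1 + c))%R.
have tsE : (1 - t * s = c)%R.
  have -> : (t * s = s ^+ 2 / (1 + c))%R by rewrite /t; field.
  rewrite (_ : s ^+ 2 = (1 + c) * (1 - c))%R; first by field.
  by have -> : (s ^+ 2 = 1 - c ^+ 2)%R; [rewrite -cs; ring|ring].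
have -> : H \o rotation2 c s = ((H \o shear1 t) \o shear2 (- s)) \o shear1 t.
  apply/funext => -[x y]; rewrite /rotation2 /shear1 /shear2/=; congr (H (_, _)).
    transitivity ((1 - t * s) * x + (t + t * (1 - t * s)) * y)%R; last by ring.
    by rewrite tsE; congr (_ + _ * _)%R; rewrite /t; field.
  by rewrite -tsE; ring.
have m1 : measurable_fun [set: RR] (H \o shear1 t).
  by apply: measurableT_comp => //; exact: measurable_shear1.
have m2 : measurable_fun [set: RR] ((H \o shear1 t) \o shear2 (- s)).
  by apply: measurableT_comp => //; exact: measurable_shear2.
have p1 z : 0 <= (H \o shear1 t) z by exact: H0.
have p2 z : 0 <= ((H \o shear1 t) \o shear2 (- s)) z by exact: H0.
exact: etrans (I2_shear1 t m2 p2) (etrans (I2_shear2 (- s) m1 p1) (I2_shear1 t mH H0)).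
Qed.

Local Notation N := (@normal_prob R 0 1).
Local Notation p := (@normal_pdf R 0 1).

Let pp_rotation c s x y : (c ^+ 2 + s ^+ 2 = 1)%R ->
  (p (c * x + s * y) * p (c * y - s * x) = p x * p y)%R.
Proof.
move=> cs; rewrite !normal_pdfE ?oner_eq0// /normal_fun !subr0.
rewrite [LHS]mulrACA [RHS]mulrACA -!expRD; congr (_ * expR _)%R.
rewrite -!mulrDl; congr (_ / _)%R.
transitivity (- ((c ^+ 2 + s ^+ 2) * (x ^+ 2 + y ^+ 2)))%R; first by ring.
by rewrite cs; ring.
Qed.

Let normal2E F : measurable_fun [set: RR] F -> (forall z, 0 <= F z) ->
  \int[N]_x \int[N]_y F (x, y) = I2 (fun z => F z * (p z.1 * p z.2)%:E).
Proof.
move=> mF F0; rewrite ge0_integral_normal_prob; last 2 first.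
- exact: (@measurable_fun_fubini_tonelli_F _ _ _ _ _ N F).
- by move=> x; apply: integral_ge0.
have mp : measurable_fun [set: measurableTypeR R] (fun x => (p x)%:E).
  by apply/measurable_EFinP; exact: measurable_normal_pdf.
apply: eq_integral => x _; have mFx : measurable_fun [set: measurableTypeR R] (fun y => F (x, y)).
  exact: measurableT_comp.
rewrite ge0_integral_normal_prob//.
rewrite -ge0_integralZr//.
- apply: eq_integral => y _; rewrite /= -muleA -EFinM; congr (_ * (_)%:E); exact: mulrC.
- exact: emeasurable_funM.
- by move=> y _; rewrite mule_ge0// lee_fin normal_pdf_ge0.
- by rewrite lee_fin normal_pdf_ge0.
Qed.

(** A rotation preserves plane Lebesgue measure, and also the product density, which is a function
    of x^2 + y^2. *)
Lemma ge0_normal_rotation c s F : (c ^+ 2 + s ^+ 2 = 1)%R ->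
  measurable_fun [set: RR] F -> (forall z, 0 <= F z) ->
  \int[N]_x \int[N]_y F (rotation2 c s (x, y)) = \int[N]_x \int[N]_y F (x, y).
Proof.
move=> cs mF F0.
have mFr : measurable_fun [set: RR] (F \o rotation2 c s).
  by apply: measurableT_comp => //; exact: measurable_rotation2.
have F0r z : 0 <= (F \o rotation2 c s) z by exact: F0.
pose H (z : RR) := F z * (p z.1 * p z.2)%:E.
have mH : measurable_fun [set: RR] H.
  apply: emeasurable_funM => //; apply/measurable_EFinP/measurable_funM.
    by apply: measurableT_comp; [exact: measurable_normal_pdf|exact: measurable_fst].
  by apply: measurableT_comp; [exact: measurable_normal_pdf|exact: measurable_snd].
have H0 z : 0 <= H z by rewrite mule_ge0// lee_fin mulr_ge0 ?normal_pdf_ge0.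
apply: etrans (normal2E mFr F0r) _; apply: etrans _ (esym (normal2E mF F0)).
apply: etrans _ (I2_rotation cs mH H0).
by congr I2; apply/funext => -[x y]; rewrite /H /= pp_rotation.
Qed.

Lemma ge0_normal_opp (f : R -> \bar R) : measurable_fun [set: measurableTypeR R] f ->
  (forall x, 0 <= f x) -> \int[N]_x f (- x)%R = \int[N]_x f x.
Proof.
have mo : measurable_fun [set: measurableTypeR R]
    (fun x : measurableTypeR R => (- x)%R : measurableTypeR R).
  exact: measurable_funN.
move=> mf f0; have mp : measurable_fun [set: measurableTypeR R] (fun x => (p x)%:E).
  by apply/measurable_EFinP; exact: measurable_normal_pdf.
rewrite !ge0_integral_normal_prob//; last exact: measurableT_comp.
rewrite -[RHS]ge0_integral_lebesgue_opp.
- apply: eq_integral => x _; congr (_ * (_)%:E).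
  by rewrite !normal_pdfE ?oner_eq0// /normal_fun !subr0 sqrrN.
- exact: emeasurable_funM.
- by move=> x; rewrite mule_ge0// lee_fin normal_pdf_ge0.
Qed.

End normal_rotation.

(** * Orthogonal invariance of the standard Gaussian measure *)

Section std_gaussian_invariance.
Context {R : realType}.
Local Notation N := (@normal_prob R 0 1).
Local Notation gam := (@std_gaussian R).
Local Open Scope ereal_scope.

Lemma ge0_integral_std_gaussianS d (f : 'cV[R]_d.+1 -> \bar R) :
  measurable_fun [set: 'cV[R]_d.+1] f -> (forall v, 0 <= f v) ->
  \int[gam d.+1]_v f v = \int[N]_x \int[gam d]_w f (consv (x, w)).
Proof.
move=> mf f0; rewrite ge0_integral_distribution//.
rewrite (@fubini_tonelli1 _ _ _ _ _ N (gam d) (f \o @consv R d))//.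
  exact: measurableT_comp.
by move=> z; exact: f0.
Qed.

Lemma measurable_mulmx m n p (A : 'M[R]_(m, n)) :
  measurable_fun [set: 'M[R]_(n, p)] (fun v : 'M[R]_(n, p) => A *m v).
Proof.
apply: measurable_fun_matrix => i j; under eq_fun do rewrite mxE.
apply: measurable_sum => k; apply: measurable_funM => //.
exact: measurable_entry.
Qed.

Definition gauss_orth d (A : 'M[R]_d) : Prop :=
  (A *m A^T = 1%:M)%R /\
  forall f : 'cV[R]_d -> \bar R, measurable_fun [set: 'cV[R]_d] f ->
    (forall v, 0 <= f v) -> \int[gam d]_v f (A *m v)%R = \int[gam d]_v f v.

Let measurable_comp_mulmx d (A : 'M[R]_d) (f : 'cV[R]_d -> \bar R) :
  measurable_fun [set: 'cV[R]_d] f -> measurable_fun [set: 'cV[R]_d] (fun v => f (A *m v)%R).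
Proof. by move=> mf; apply: measurableT_comp => //; exact: measurable_mulmx. Qed.

Let RR := (measurableTypeR R * measurableTypeR R)%type.

Let measurable_cons2 d :
  measurable_fun [set: RR * 'cV[R]_d] (fun z => consv (z.1.1, consv (z.1.2, z.2))).
Proof.
apply: measurableT_comp => //; apply/measurable_fun_pair.
  by apply: measurableT_comp; [exact: measurable_fst|exact: measurable_fst].
apply: measurableT_comp => //; apply/measurable_fun_pair.
  by apply: measurableT_comp; [exact: measurable_snd|exact: measurable_fst].
exact: measurable_snd.
Qed.

(** Only the sign change in dimension 1 and the Givens rotations depend on the Gaussian density. The
    block case acts on the inner integral after the first coordinate is split off. *)
Lemma gauss_orth_family : orthogonal_family gauss_orth.
Proof.
have OF := orthogonal_orthof R.
split.
- by move=> d A [].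
- move=> d; split; first exact: (orthof1 OF).
  by move=> f mf f0; apply: eq_integral => v _; rewrite mul1mx.
- move=> d A B [A1 QA] [B1 QB]; split; first exact: (orthofM OF).
  move=> f mf f0; rewrite -(QA f)// -(QB (fun v => f (A *m v)%R))//.
    by apply: eq_integral => v _; rewrite mulmxA.
  exact: measurable_comp_mulmx.
- move=> d A [A1 QA]; split; first exact: (orthofT OF).
  move=> f mf f0; rewrite -(QA (fun v => f (A^T *m v)%R))//; last exact: measurable_comp_mulmx.
  by apply: eq_integral => v _; rewrite mulmxA orth_trK// mul1mx.
- split; first exact: (orthofN1 OF).
  move=> f mf f0.
  have E1 := @ge0_integral_std_gaussianS 0 _ (measurable_comp_mulmx (- 1%:M) mf) (fun v => f0 _).
  have E2 := @ge0_integral_std_gaussianS 0 _ mf f0.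
  apply: etrans E1 _; apply: etrans _ (esym E2).
  rewrite -[RHS]ge0_normal_opp; last 2 first.
  + apply: (@measurable_fun_fubini_tonelli_F _ _ _ _ _ (gam 0) (f \o @consv R 0)) => [|z].
      exact: measurableT_comp.
    exact: f0.
  + by move=> x; apply: integral_ge0.
  apply: eq_integral => x _; apply: eq_integral => w _; congr (f _).
  transitivity (col_mx (- (x%:M : 'M[R]_1)) (- w)).
    by rewrite mulNmx mul1mx /consv/= (@opp_col_mx _ 1 0).
  rewrite /consv/= (_ : - w = w)%R; last by rewrite [LHS]flatmx0 [RHS]flatmx0.
  by apply/matrixP => i j; rewrite !mxE; case: splitP => k _; rewrite ?mxE ?mulNrn.
- move=> d A [A1 QA]; split; first exact: (orthof_block OF).
  move=> f mf f0.
  have E1 := @ge0_integral_std_gaussianS d _ (measurable_comp_mulmx (block_mx 1%:M 0 0 A) mf) (fun v => f0 _).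
  have E2 := @ge0_integral_std_gaussianS d _ mf f0.
  apply: etrans E1 _; apply: etrans _ (esym E2).
  apply: eq_integral => x _; rewrite -[RHS]QA//; last first.
    by apply: measurableT_comp => //; exact: measurableT_comp.
  apply: eq_integral => w _; congr (f _).
  by rewrite /consv/= (@mul_block_col _ 1 d 1 d) !mul0mx addr0 add0r mul1mx.
- move=> d c s cs; split; first exact: (orthof_givens OF).
  move=> f mf f0.
  (* Two coordinates are split off, so that the rotation acts on the two outer integrals. *)
  have E g : measurable_fun [set: 'cV[R]_(1 + (1 + d))] g -> (forall v, 0 <= g v) ->
      \int[gam (1 + (1 + d))]_v g v = \int[N]_x \int[N]_y \int[gam d]_w g (consv (x, consv (y, w))).
    move=> mg g0; rewrite ge0_integral_std_gaussianS//; apply: eq_integral => x _.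
    rewrite (@ge0_integral_std_gaussianS d (fun v => g (consv (x, v))))//.
    by apply: measurableT_comp => //; exact: measurableT_comp.
  pose G v := f (givens d c s *m v)%R.
  have mG : measurable_fun [set: 'cV[R]_(1 + (1 + d))] G by exact: measurable_comp_mulmx.
  have G0 v : 0 <= G v by exact: f0.
  transitivity (\int[N]_x \int[N]_y \int[gam d]_w G (consv (x, consv (y, w)))).
    exact: E.
  transitivity (\int[N]_x \int[N]_y \int[gam d]_w f (consv (x, consv (y, w)))); last first.
    exact/esym/E.
  pose F (z : RR) := \int[gam d]_w f (consv (z.1, consv (z.2, w))).
  have mF : measurable_fun [set: RR] F.
    apply: (@measurable_fun_fubini_tonelli_F _ _ _ _ _ (gam d)
      (fun z : RR * 'cV[R]_d => f (consv (z.1.1, consv (z.1.2, z.2))))) => [|z].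
      by apply: measurableT_comp => //; exact: measurable_cons2.
    exact: f0.
  have F0 z : 0 <= F z by apply: integral_ge0.
  transitivity (\int[N]_x \int[N]_y F (rotation2 c s (x, y))); last exact: ge0_normal_rotation.
  apply: eq_integral => x _; apply: eq_integral => y _; apply: eq_integral => w _.
  rewrite /G; congr (f _); rewrite /consv/= [LHS]givens_col !scale_scalar_mx -!raddfD/=.
  by rewrite -raddfB.
Qed.

(** A and the square root of A A^t have the same Gram matrix, so they differ by an orthogonal factor
    that leaves the law of Z unchanged. The optimal coupling below uses an A which need not be
    symmetric. *)
Lemma gaussian_gram d (m : 'cV[R]_d) (A : 'M[R]_d) (B : set 'cV[R]_d) : measurable B ->
  gaussian m (A *m A^T)%R B = gam d ((fun v => m + A *m v)%R @^-1` B).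
Proof.
move=> mB; set S := (A *m A^T)%R.
have maf (C : 'M[R]_d) : measurable_fun [set: 'cV[R]_d] (fun v : 'cV[R]_d => m + C *m v)%R.
  apply: measurable_fun_matrix => i j; under eq_fun do rewrite mxE.
  apply: measurable_funD => //; under eq_fun do rewrite mxE.
  by apply: measurable_sum => k; apply: measurable_funM => //; exact: measurable_entry.
have SE : (A *m A^T = sqrtm S *m (sqrtm S)^T)%R.
  by rewrite sqrtm_gram//; exact: covariance_gram.
have [W [_ QW] AE] := gram_eq_orthof gauss_orth_family SE.
have iE (C : 'M[R]_d) : gam d ((fun v => m + C *m v)%R @^-1` B) =
    \int[gam d]_v (\1_B (m + C *m v)%R)%:E.
  transitivity (\int[gam d]_v (\1_((fun v => m + C *m v)%R @^-1` B) v)%:E); last first.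
    by apply: eq_integral => v _; rewrite !indicE.
  rewrite integral_indic ?setIT//.
  by rewrite -[X in measurable X]setTI; exact: maf.
rewrite [LHS]iE iE AE -QW.
- by apply: eq_integral => v _; rewrite mulmxA.
- by apply/measurable_EFinP; apply: measurableT_comp => //; exact: maf.
- by move=> v; rewrite lee_fin.
Qed.

End std_gaussian_invariance.

(** * Moments of N(0, 1) *)

Section normal_moments.
Context {R : realType}.
Local Notation N := (@normal_prob R 0 1).
Local Notation TR := (measurableTypeR R).

Lemma measurable_poly_weight p : measurable_fun [set: TR] (fun x : R => (1 + x ^+ 2) ^+ p).
Proof. by apply: measurable_funX; apply: measurable_funD => //; exact: measurable_funX. Qed.

(** The inequality 1 + y <= exp y at y = x^2 / (4 k), raised to the power k = p + 1; the factor 4 k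
    undoes the scaling of x^2. *)
Lemma poly_weight_le p (x : R) :
  (1 + x ^+ 2) ^+ p.+1 <= (4 * p.+1%:R) ^+ p.+1 * expR (x ^+ 2 / 4).
Proof.
set k := p.+1%:R : R.
have k1 : 1 <= k by rewrite ler1n.
have kn0 : k != 0 by rewrite gt_eqF//; lra.
have -> : x ^+ 2 / 4 = k * (x ^+ 2 / (4 * k)) by field.
rewrite expRM_natl -exprMn; apply: lerXn2r; rewrite ?nnegrE.
- by nra.
- by rewrite mulr_ge0 ?expR_ge0//; lra.
- have := expR_ge1Dx (x ^+ 2 / (4 * k)).
  set e := expR _ => H.
  have k0 : 0 < 4 * k by lra.
  apply: (@le_trans _ _ (4 * k * (1 + x ^+ 2 / (4 * k)))); last by rewrite ler_pM2l.
  rewrite mulrDr mulr1 [4 * k * _]mulrCA mulfV ?mulr1; last by rewrite gt_eqF.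
  by rewrite lerD2r; lra.
Qed.

(** By [poly_weight_le] the weight costs a factor exp (x^2 / 4), which turns the density of N(0, 1)
    into a multiple of the density of N(0, 2). *)
Lemma integrable_normal_weight p : N.-integrable [set: TR] (fun x => ((1 + x ^+ 2) ^+ p)%:E).
Proof.
apply/integrableP; split; first by apply/measurable_EFinP; exact: measurable_poly_weight.
have w0 q (x : R) : 0 <= (1 + x ^+ 2) ^+ q by apply: exprn_ge0; nra.
have mS q : measurable_fun [set: TR] (fun x : R => ((1 + x ^+ 2) ^+ q)%:E).
  by apply/measurable_EFinP; exact: measurable_poly_weight.
under eq_integral do rewrite /= ger0_norm ?w0//.
(* The larger exponent p + 1 is the positive one that [poly_weight_le] requires. *)
apply: (@le_lt_trans _ _ (\int[N]_x ((1 + x ^+ 2) ^+ p.+1)%:E)%E).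
  apply: ge0_le_integral => //=.
  - by move=> x _; rewrite lee_fin.
  - by move=> x _; rewrite lee_fin; apply: ler_weXn2l => //; nra.
rewrite ge0_integral_normal_prob//; last by move=> x; rewrite lee_fin.
set s : R := Num.sqrt 2.
have s2 : s ^+ 2 = 2 by rewrite sqr_sqrtr.
have s0 : s != 0 by rewrite gt_eqF// sqrtr_gt0.
pose C : R := (4 * p.+1%:R) ^+ p.+1 * (normal_peak 1 / normal_peak s).
have C0 : 0 <= C.
  by apply: mulr_ge0; [apply/exprn_ge0/mulr_ge0|apply: divr_ge0; exact: normal_peak_ge0].
apply: (@le_lt_trans _ _ (\int[lebesgue_measure]_x (C%:E * (normal_pdf 0 s x)%:E))%E).
  apply: ge0_le_integral => //=.
  - by move=> x _; rewrite lee_fin mulr_ge0 ?normal_pdf_ge0.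
  - apply: emeasurable_funM => //.
    by apply/measurable_EFinP; exact: measurable_normal_pdf.
  - apply: emeasurable_funM => //.
    by apply/measurable_EFinP; exact: measurable_normal_pdf.
  - move=> x _; rewrite lee_fin !normal_pdfE// /normal_fun !subr0 s2 expr1n.
    rewrite /C.
    have -> : - x ^+ 2 / (1 *+ 2) = - x ^+ 2 / (2 *+ 2) + - x ^+ 2 / (2 *+ 2).
      by field.
    rewrite expRD.
    have pk := normal_peak_gt0 s0; have pk1 := @normal_peak_ge0 R 1.
    have := poly_weight_le p x.
    have -> : - x ^+ 2 / (2 *+ 2) = - (x ^+ 2 / 4) by field.
    rewrite expRN; have := expR_gt0 (x ^+ 2 / 4); set e := expR _ => e0 H.
    rewrite [leLHS](_ : _ = (1 + x ^+ 2) ^+ p.+1 / e * (normal_peak 1 / e)); last by ring.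
    rewrite [leRHS](_ : _ = (4 * p.+1%:R) ^+ p.+1 * (normal_peak 1 / e)); last first.
      by field; rewrite !gt_eqF.
    rewrite ler_wpM2r ?divr_ge0 ?(ltW e0)//.
    by rewrite ler_pdivrMr.
rewrite ge0_integralZl//.
- by rewrite integral_normal_pdf mule1 ltry.
- by apply/measurable_EFinP; exact: measurable_normal_pdf.
- by move=> x _; rewrite lee_fin normal_pdf_ge0.
Qed.

Lemma integrable_normal_bounded p C (f : R -> R) : measurable_fun [set: TR] f ->
  (forall x, `|f x| <= C * (1 + x ^+ 2) ^+ p) -> N.-integrable [set: TR] (EFin \o f).
Proof.
move=> mf fC; apply: (@le_integrable _ _ _ N setT _ _ (fun x => C%:E * ((1 + x ^+ 2) ^+ p)%:E)%E) => //.
- exact/measurable_EFinP.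
- by move=> x _; rewrite /= lee_fin; apply: (le_trans (fC x)); exact: ler_norm.
- by apply: integrableZl => //; exact: integrable_normal_weight.
Qed.

Lemma integrable_normal_exp k : N.-integrable [set: TR] (fun x => (x ^+ k)%:E).
Proof.
apply: (@integrable_normal_bounded k 1).
  exact: measurable_funX.
move=> x; rewrite mul1r normrX; apply: lerXn2r; rewrite ?nnegrE//; first by nra.
by rewrite -ler_sqr ?nnegrE//; [rewrite real_normK ?num_real//; nra|nra].
Qed.

Lemma normal_integral_opp (f : R -> R) : N.-integrable [set: TR] (EFin \o f) ->
  \int[N]_x f (- x) = \int[N]_x f x.
Proof.
move=> fi; have mf := measurable_int _ fi; congr fine.
have mn : measurable_fun [set: TR] (fun x : TR => - x : TR) by exact: measurable_funN.
rewrite integralE [RHS]integralE; congr (_ - _)%E.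
- transitivity (\int[N]_x ((EFin \o f)^\+ (- x)%R))%E.
    by apply: eq_integral => x _; rewrite !funeposE.
  by apply: ge0_normal_opp => //; exact: measurable_funepos.
- transitivity (\int[N]_x ((EFin \o f)^\- (- x)%R))%E.
    by apply: eq_integral => x _; rewrite !funenegE.
  by apply: ge0_normal_opp => //; exact: measurable_funeneg.
Qed.

Definition normal_moment k : R := \int[N]_x (x ^+ k).

Lemma normal_moment0 : normal_moment 0 = 1.
Proof.
rewrite /normal_moment; under eq_Rintegral do rewrite expr0.
by rewrite Rintegral_cst//= probability_setT mulr1.
Qed.

Lemma normal_moment_odd k : odd k -> normal_moment k = 0.
Proof.
move=> ok; have := normal_integral_opp (integrable_normal_exp k).
under eq_Rintegral do rewrite exprNn -signr_odd ok expr1 mulN1r -mulN1r.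
rewrite RintegralZl//; last exact: integrable_normal_exp.
by rewrite -/(normal_moment k); lra.
Qed.

(** The product with the density of N(0, 1) is 1 / r times the density with standard deviation 1 /
    r. *)
Let normal_gauss_transform r : 1 <= r ->
  (\int[N]_x (expR (- (r ^+ 2 - 1) * (x ^+ 2 / 2)))%:E = (r^-1)%:E)%E.
Proof.
move=> r1; have r0 : 0 < r by lra.
have rn : r != 0 by rewrite gt_eqF.
have me : measurable_fun [set: TR] (fun x : R => expR (- (r ^+ 2 - 1) * (x ^+ 2 / 2))).
  apply: measurableT_comp => //; apply: measurable_funM => //.
  by apply: measurable_funM => //; exact: measurable_funX.
rewrite ge0_integral_normal_prob; last 2 first.
- exact/measurable_EFinP.
- by move=> x; rewrite lee_fin expR_ge0.
have sn : r^-1 != 0 by rewrite invr_eq0.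
transitivity (\int[lebesgue_measure]_x ((r^-1)%:E * (normal_pdf 0 r^-1 x)%:E))%E.
  apply: eq_integral => x _; rewrite -!EFinM; congr EFin.
  rewrite !normal_pdfE ?oner_eq0// /normal_fun !subr0 mulrCA -expRD.
  rewrite [RHS]mulrA; congr (_ * expR _); last by rewrite expr1n; field.
  rewrite /normal_peak expr1n mul1r -mulrnAr sqrtrM ?sqr_ge0//.
  by rewrite sqrtr_sqr gtr0_norm ?invr_gt0// invfM invrK mulKf.
rewrite ge0_integralZl//.
- by rewrite integral_normal_pdf mule1.
- by apply/measurable_EFinP; exact: measurable_normal_pdf.
- by move=> x _; rewrite lee_fin normal_pdf_ge0.
- by rewrite lee_fin invr_ge0 ltW.
Qed.

(* E[exp (- h X^2 / 2)] = (1 + h)^(-1/2) by the normalization of the density;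
   the second moment is read off as h goes to 0. *)
Lemma normal_moment2 : normal_moment 2 = 1.
Proof.
set m2 := normal_moment 2; set m4 := normal_moment 4.
have i2 := integrable_normal_exp 2; have i4 := integrable_normal_exp 4.
(* With h = r^2 - 1, integrate u - u^2 <= 1 - exp (- u) <= u at u = h x^2 / 2 and divide by h; note
   that (1 - 1 / r) / h = 1 / (r (r + 1)). *)
have key r : 1 < r ->
    m2 / 2 - (r ^+ 2 - 1) * m4 / 4 <= (r * (r + 1))^-1 <= m2 / 2.
  move=> r1; set h := r ^+ 2 - 1; have h0 : 0 < h by rewrite /h; nra.
  have ie : N.-integrable [set: TR] (EFin \o (fun x => expR (- h * (x ^+ 2 / 2)))).
    apply: (@integrable_normal_bounded 0 1).
      apply: measurableT_comp => //; apply: measurable_funM => //.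
      by apply: measurable_funM => //; exact: measurable_funX.
    move=> x; rewrite expr0 mulr1 ger0_norm ?expR_ge0// -[leRHS]expR0 ler_expR.
    by nra.
  have Ee : \int[N]_x (1 - expR (- h * (x ^+ 2 / 2))) = 1 - r^-1.
    rewrite meanB//; last exact: intg_cst.
    rewrite mean_cst; congr (_ - _).
    by rewrite /Rintegral normal_gauss_transform// ltW.
  have iL : intg N (fun x => h / 2 * x ^+ 2) by exact: intgZ.
  have iL4 : intg N (fun x => h ^+ 2 / 4 * x ^+ 4) by exact: intgZ.
  have i1e : intg N (fun x => 1 - expR (- h * (x ^+ 2 / 2))).
    by apply: intgB => //; exact: intg_cst.
  have up : 1 - r^-1 <= h / 2 * m2.
    rewrite -Ee -meanZ//; apply: le_mean => // x.
    have := expR_ge1Dx (- h * (x ^+ 2 / 2)); lra.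
  have lo : h / 2 * m2 - h ^+ 2 / 4 * m4 <= 1 - r^-1.
    rewrite -Ee -!meanZ// -meanB//; apply: le_mean => //; first exact: intgB.
    move=> x; set u := h * (x ^+ 2 / 2).
    have u0 : 0 <= u by rewrite /u; nra.
    rewrite mulNr expRN -/u.
    have -> : h / 2 * x ^+ 2 = u by rewrite /u; ring.
    have -> : h ^+ 2 / 4 * x ^+ 4 = u ^+ 2 by rewrite /u; field.
    have eu := expR_ge1Dx u; have e0 := expR_gt0 u.
    rewrite lerBrDl -lerBrDr -[leLHS]mul1r ler_pdivrMr//.
    suff : 1 <= (1 - (u - u ^+ 2)) * expR u by lra.
    have : (1 - (u - u ^+ 2)) * (1 + u) <= (1 - (u - u ^+ 2)) * expR u.
      by rewrite ler_wpM2l//; nra.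
    have : 0 <= u ^+ 3 by rewrite exprn_ge0.
    lra.
  have rE : (r * (r + 1))^-1 = (1 - r^-1) / h.
    by rewrite /h; field; apply/and3P; split; apply/eqP; nra.
  rewrite rE; apply/andP; split.
    rewrite ler_pdivlMr//; move: lo; set z := 1 - r^-1; lra.
  by rewrite ler_pdivrMr//; move: up; set z := 1 - r^-1; lra.
suff : `|m2 - 1| <= 0 by rewrite normr_le0 subr_eq0 => /eqP.
apply/ler_addgt0Pl => e e0; rewrite addr0.
have m40 : 0 <= m4 by apply: mean_ge0 => x; rewrite exprn_even_ge0.
(* With r = 1 + t, [key] puts m2 within 2 t (1 + m4) of 1. *)
pose t := Num.min 1 (e / (4 * (1 + m4))).
have t1 : t <= 1 by rewrite ge_min lexx.
have t0 : 0 < t by rewrite lt_min ltr01 divr_gt0//; lra.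
have te : t * (4 * (1 + m4)) <= e by rewrite -ler_pdivlMr; [rewrite ge_min lexx orbT|lra].
have /andP[] := key (1 + t) (ltac:(lra)).
set q := ((1 + t) * (1 + t + 1))^-1 => k1 k2.
have qE : q * ((1 + t) * (1 + t + 1)) = 1 by rewrite /q mulVf// gt_eqF//; nra.
have q0 : 0 < q by rewrite invr_gt0; nra.
have tq : 0 <= t * q by nra.
have ttq : 0 <= t * (t * q) by nra.
have q1 : q <= 1 / 2 by nra.
have t2q : t * q <= t / 2 by nra.
have ttq2 : t * (t * q) <= t * q by nra.
have q2 : 1 / 2 - t <= q by nra.
have tm : 0 <= t * m4 by nra.
have ttm : t * (t * m4) <= t * m4 by nra.
rewrite ler_norml; apply/andP; split; first lra.
have : ((1 + t) ^+ 2 - 1) * m4 / 4 = (2 * (t * m4) + t * (t * m4)) / 4 by field.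
lra.
Qed.


End normal_moments.

(** * Moments in dimension d *)

Section gaussian_moments.
Context {R : realType}.
Local Notation N := (@normal_prob R 0 1).
Local Notation TR := (measurableTypeR R).
Local Notation gam := (@std_gaussian R).

(** Integrands in a single coordinate are brought to this form, so that their means are read off
    from the coefficients. *)
Definition quartic (a : 'I_5 -> R) (x : R) : R := \sum_(i < 5) a i * x ^+ i.

Lemma intg_quartic a : intg N (quartic a).
Proof. by apply: intg_sum => i; apply: intgZ; exact: integrable_normal_exp. Qed.

Lemma E_quartic_moments a : \int[N]_x quartic a x = \sum_(i < 5) a i * @normal_moment R i.
Proof.
rewrite mean_sum => [|i]; last by apply: intgZ; exact: integrable_normal_exp.
by apply: eq_bigr => i _; rewrite meanZ//; exact: integrable_normal_exp.
Qed.

Definition coef5 (a0 a1 a2 a3 a4 : R) (i : 'I_5) : R := nth 0 [:: a0; a1; a2; a3; a4] i.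

Lemma quarticE a0 a1 a2 a3 a4 x :
  quartic (coef5 a0 a1 a2 a3 a4) x = a0 + a1 * x + a2 * x ^+ 2 + a3 * x ^+ 3 + a4 * x ^+ 4.
Proof. by rewrite /quartic !big_ord_recl big_ord0 /coef5/=; ring. Qed.

(** Rotation by 45 degrees: (X + Y) / sqrt 2 has the law of X, and comparing fourth moments gives (2
    m4 + 6) / 4 = m4. *)
Lemma normal_moment4 : @normal_moment R 4 = 3.
Proof.
set m4 := normal_moment 4.
have E5 a0 a1 a2 a3 a4 : \int[N]_x quartic (coef5 a0 a1 a2 a3 a4) x = a0 + a2 + a4 * m4.
  rewrite E_quartic_moments !big_ord_recl big_ord0 /coef5/= /bump/= !add1n.
  by rewrite normal_moment0 normal_moment2 (@normal_moment_odd _ 1)// (@normal_moment_odd _ 3)// -/m4; ring.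
set c : R := Num.sqrt (2^-1).
have c2 : c ^+ 2 = 2^-1 by rewrite sqr_sqrtr.
have c4 : c ^+ 4 = 4^-1 by rewrite (_ : c ^+ 4 = (c ^+ 2) ^+ 2); [rewrite c2; field|ring].
have cs : c ^+ 2 + c ^+ 2 = 1 by rewrite c2; field.
pose F (z : TR * TR) := ((z.1 ^+ 4)%:E : \bar R).
have mF : measurable_fun [set: TR * TR] F.
  by apply/measurable_EFinP; apply: measurable_funX; exact: measurable_fst.
have F0 z : (0 <= F z)%E by rewrite lee_fin exprn_even_ge0.
have := ge0_normal_rotation cs mF F0.
rewrite /F /rotation2/=.
have -> : (\int[N]_x \int[N]_y (x ^+ 4)%:E = m4%:E)%E.
  rewrite -EFin_mean; last exact: integrable_normal_exp.
  by apply: eq_integral => x _; rewrite integral_cst//= probability_setT mule1.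
have -> : (\int[N]_x \int[N]_y ((c * x + c * y) ^+ 4)%:E =
    \int[N]_x (quartic (coef5 (m4 / 4) 0 (6 / 4) 0 4^-1) x)%:E)%E.
  apply: eq_integral => x _.
  rewrite (_ : (\int[N]_y ((c * x + c * y) ^+ 4)%:E =
      \int[N]_y (quartic (coef5 (x ^+ 4 / 4) (x ^+ 3) (6 / 4 * x ^+ 2) x (4^-1)) y)%:E)%E).
    by rewrite EFin_mean ?E5; [congr EFin; rewrite quarticE; field|exact: intg_quartic].
  apply: eq_integral => y _; congr EFin; rewrite quarticE.
  transitivity (c ^+ 4 * (x + y) ^+ 4); first by ring.
  by rewrite c4; field.
rewrite EFin_mean ?E5; last exact: intg_quartic.
by move=> [] H; lra.
Qed.

Lemma E_quartic a0 a1 a2 a3 a4 :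
  \int[N]_x quartic (coef5 a0 a1 a2 a3 a4) x = a0 + a2 + 3 * a4.
Proof.
rewrite E_quartic_moments !big_ord_recl big_ord0 /coef5/= /bump/= !add1n.
by rewrite normal_moment0 normal_moment2 normal_moment4 (@normal_moment_odd _ 1)// (@normal_moment_odd _ 3)//; ring.
Qed.

Lemma measurable_sqnorm d : measurable_fun [set: 'cV[R]_d] (@sqnorm R d).
Proof. by apply: measurable_sum => i; apply: measurable_funX; exact: measurable_entry. Qed.

Lemma measurable_weight d p : measurable_fun [set: 'cV[R]_d] (fun v => (1 + sqnorm v) ^+ p).
Proof.
by apply: measurable_funX; apply: measurable_funD => //; exact: measurable_sqnorm.
Qed.

Lemma weight_ge0 d p (v : 'cV[R]_d) : 0 <= (1 + sqnorm v) ^+ p.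
Proof. by rewrite exprn_ge0// addr_ge0// sqnorm_ge0. Qed.

Lemma sqnorm_consv d x (w : 'cV[R]_d) : sqnorm (consv (x, w)) = x ^+ 2 + sqnorm w.
Proof. by rewrite /consv sqnorm_col_mx mxE eqxx. Qed.

Lemma consv0 d x (w : 'cV[R]_d) j : consv (x, w) ord0 j = x.
Proof.
transitivity ((col_mx (x%:M : 'M[R]_1) w) (lshift d 0) j).
  by rewrite /consv/=; congr (fun_of_matrix _ _ _); exact/val_inj.
by rewrite (@col_mxEu _ 1 d) ord1 mxE eqxx.
Qed.

Lemma consvS d x (w : 'cV[R]_d) k j : consv (x, w) (lift ord0 k) j = w k j.
Proof.
transitivity ((col_mx (x%:M : 'M[R]_1) w) (rshift 1 k) j).
  by rewrite /consv/=; congr (fun_of_matrix _ _ _); exact/val_inj.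
by rewrite (@col_mxEd _ 1 d).
Qed.

(** Since 1 + x^2 + |w|^2 <= (1 + x^2) (1 + |w|^2), the weight is dominated by a product of a
    one-dimensional factor and one covered by induction. *)
Lemma intg_weight d p : intg (gam d) (fun v => (1 + sqnorm v) ^+ p).
Proof.
elim: d => [|d IH].
  apply: (@intg_bounded _ _ _ (gam 0) _ 1); first exact: measurable_weight.
  by move=> v; rewrite /sqnorm big_ord0 addr0 expr1n normr1.
apply: ge0_intg; [exact: measurable_weight|by move=> v; exact: weight_ge0|].
rewrite ge0_integral_std_gaussianS; last 2 first.
- by apply/measurable_EFinP; exact: measurable_weight.
- by move=> v; rewrite lee_fin weight_ge0.
pose K := \int[gam d]_w (1 + sqnorm w) ^+ p.
have K0 : 0 <= K by apply: mean_ge0 => w; exact: weight_ge0.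
apply: (@le_lt_trans _ _ (\int[N]_x ((1 + x ^+ 2) ^+ p * K)%:E)%E).
  apply: ge0_le_integral => //=.
  - by move=> x _; apply: integral_ge0 => w _; rewrite lee_fin weight_ge0.
  - apply: (@measurable_fun_fubini_tonelli_F _ _ _ _ _ (gam d)
      (fun z : TR * 'cV[R]_d => ((1 + sqnorm (consv z)) ^+ p)%:E)) => [|z].
      apply/measurable_EFinP.
      by apply: (@measurableT_comp _ _ _ _ _ _ (fun v : 'cV[R]_d.+1 => (1 + sqnorm v) ^+ p) _ (@consv R d)) => //;
        exact: measurable_weight.
    by rewrite lee_fin weight_ge0.
  - apply/measurable_EFinP; apply: measurable_funM => //.
    exact: measurable_poly_weight.
  - move=> x _; rewrite -meanZ//.
    have x2 : 0 <= x ^+ 2 by rewrite sqr_ge0.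
    rewrite -EFin_mean; last exact: intgZ.
    apply: ge0_le_integral => //=.
    + by move=> w _; rewrite lee_fin weight_ge0.
    + apply/measurable_EFinP.
      apply: (@measurableT_comp _ _ _ _ _ _ (fun v : 'cV[R]_d.+1 => (1 + sqnorm v) ^+ p) _
        (fun w : 'cV[R]_d => consv (x, w))); first exact: measurable_weight.
      exact: measurableT_comp.
    + apply/measurable_EFinP; apply: measurable_funM => //; exact: measurable_weight.
    + move=> w _; rewrite lee_fin -exprMn sqnorm_consv.
      have w0 := sqnorm_ge0 w.
      by apply: lerXn2r; rewrite ?nnegrE; nra.
rewrite EFin_mean ?ltry//.
have := intgZ K (@integrable_normal_weight R p).
by congr (integrable _ _ _); apply/funext => x /=; rewrite mulrC.
Qed.

Lemma intg_std_bounded d p C (f : 'cV[R]_d -> R) : measurable_fun [set: 'cV[R]_d] f ->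
  (forall v, `|f v| <= C * (1 + sqnorm v) ^+ p) -> intg (gam d) f.
Proof. by move=> mf fC; apply: (intg_le mf fC); apply: intgZ; exact: intg_weight. Qed.

Lemma E_std_gaussianS d (f : 'cV[R]_d.+1 -> R) : intg (gam d.+1) f ->
  (forall x, intg (gam d) (fun w => f (consv (x, w)))) ->
  \int[gam d.+1]_v f v = \int[N]_x \int[gam d]_w f (consv (x, w)).
Proof.
move=> fi fxi; have mf := intg_meas fi.
have fi' : (N \x gam d)%E.-integrable [set: TR * 'cV[R]_d] (EFin \o (f \o @consv R d)).
  apply/integrableP; split.
    by apply/measurable_EFinP; apply: measurableT_comp => //.
  have := fi => /integrableP[_].
  rewrite (@ge0_integral_distribution _ _ _ _ _ _ (@consv R d) (fun v => `|(f v)%:E|%E))//.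
  by apply: measurableT_comp => //; exact/measurable_EFinP.
rewrite /Rintegral (@integral_distribution _ _ _ _ _ _ (@consv R d) (fun v => (f v)%:E))//; last first.
  exact/measurable_EFinP.
rewrite -(@integral12_prod_meas1 _ _ _ _ _ _ _ (EFin \o (f \o @consv R d)) fi').
by congr fine; apply: eq_integral => x _; rewrite -EFin_mean//; exact: fxi.
Qed.

(** A combination of Hermite polynomials of degrees 1 and 2 in the separate coordinates. A quadratic
    function takes this form in an eigenbasis of its matrix. *)
Definition chaos d (c g : 'I_d -> R) (w : 'cV[R]_d) : R :=
  \sum_k (c k * w k 0 + g k * (w k 0 ^+ 2 - 1)).

Lemma measurable_chaos d (c g : 'I_d -> R) : measurable_fun [set: 'cV[R]_d] (chaos c g).
Proof.
apply: measurable_sum => k; apply: measurable_funD; apply: measurable_funM => //.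
  exact: measurable_entry.
by apply: measurable_funB => //; apply: measurable_funX; exact: measurable_entry.
Qed.

Lemma sqr_entry_le d (w : 'cV[R]_d) k : w k 0 ^+ 2 <= sqnorm w.
Proof.
rewrite /sqnorm (bigD1 k)//= lerDl sumr_ge0// => i _; exact: sqr_ge0.
Qed.

Lemma chaos_le d (c g : 'I_d -> R) : exists2 C, 0 <= C & forall w, `|chaos c g w| <= C * (1 + sqnorm w).
Proof.
exists (\sum_k (`|c k| + `|g k|)); first by apply: sumr_ge0 => k _; rewrite addr_ge0.
move=> w; rewrite mulr_suml; apply: (le_trans (ler_norm_sum _ _ _)); apply: ler_sum => k _.
apply: (le_trans (ler_normD _ _)); rewrite !normrM mulrDl.
have := sqr_entry_le w k; set y := w k 0; set s := sqnorm w => ys.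
have y2 : 0 <= y ^+ 2 by rewrite sqr_ge0.
apply: lerD; apply: ler_wpM2l => //.
  rewrite ler_norml; apply/andP; split; nra.
by rewrite ler_norml; apply/andP; split; lra.
Qed.

Lemma intg_chaos_exp d (c g : 'I_d -> R) p : intg (gam d) (fun w => chaos c g w ^+ p).
Proof.
have [C C0 HC] := chaos_le c g.
apply: (@intg_std_bounded d p (C ^+ p)); first by apply: measurable_funX; exact: measurable_chaos.
move=> w; rewrite normrX -exprMn; apply: lerXn2r; rewrite ?nnegrE//.
by rewrite mulr_ge0// addr_ge0// sqnorm_ge0.
Qed.

Lemma chaosS d (c g : 'I_d.+1 -> R) x w : chaos c g (consv (x, w)) =
  quartic (coef5 (- g ord0) (c ord0) (g ord0) 0 0) x +
  chaos (c \o lift ord0) (g \o lift ord0) w.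
Proof.
rewrite /chaos big_ord_recl !consv0 quarticE; congr (_ + _); first by ring.
by apply: eq_bigr => k _; rewrite !consvS.
Qed.

(** The coordinates are independent and their contributions centered, so variances add up; the
    factor 2 is E (x^2 - 1)^2 = 3 - 2 + 1. *)
Lemma E_chaos_moments d (c g : 'I_d -> R) :
  \int[gam d]_w chaos c g w = 0 /\
  \int[gam d]_w (chaos c g w ^+ 2) = \sum_k (c k ^+ 2 + 2 * g k ^+ 2).
Proof.
elim: d c g => [|d IH] c g.
  rewrite big_ord0; split.
    under eq_Rintegral do rewrite /chaos big_ord0; exact: mean_cst.
  under eq_Rintegral do rewrite /chaos big_ord0 expr0n; exact: mean_cst.
have [IH1 IH2] := IH (c \o lift ord0) (g \o lift ord0).
set ch := chaos _ _ in IH1 IH2.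
have i1 : intg (gam d) ch by have := intg_chaos_exp (c \o lift ord0) (g \o lift ord0) 1.
have i2 : intg (gam d) (fun w => ch w ^+ 2) by exact: intg_chaos_exp.
split.
  rewrite E_std_gaussianS.
  - under eq_Rintegral => x _.
      under eq_Rintegral do rewrite chaosS.
      rewrite meanD ?mean_cst -/ch ?IH1 ?addr0//; last exact: intg_cst.
      over.
    by rewrite E_quartic; ring.
  - by have := intg_chaos_exp c g 1.
  - move=> x; under eq_fun do rewrite chaosS.
    by apply: intgD => //; exact: intg_cst.
rewrite E_std_gaussianS; last 2 first.
- exact: intg_chaos_exp.
- move=> x; under eq_fun do rewrite chaosS sqrrD -mulr_natl mulrA.
  by apply: intgD => //; apply: intgD; [exact: intg_cst|exact: intgZ].
rewrite big_ord_recl -IH2.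
under eq_Rintegral => x _.
  under eq_Rintegral do rewrite chaosS sqrrD -mulr_natl mulrA.
  rewrite meanD//; last by apply: intgD; [exact: intg_cst|exact: intgZ].
  rewrite meanD ?mean_cst; [|exact: intg_cst|exact: intgZ].
  rewrite meanZ// -/ch IH1 mulr0 addr0.
  rewrite (_ : _ ^+ 2 = quartic (coef5 (g ord0 ^+ 2) (- 2 * c ord0 * g ord0)
     (c ord0 ^+ 2 - 2 * g ord0 ^+ 2) (2 * c ord0 * g ord0) (g ord0 ^+ 2)) x); last first.
    by rewrite !quarticE; ring.
  over.
rewrite meanD; [|exact: intg_quartic|exact: intg_cst].
by rewrite E_quartic mean_cst; congr (_ + _); ring.
Qed.

End gaussian_moments.

(** * Quadratic functions of a Gaussian vector *)

Section gaussian_quadratic.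
Context {R : realType}.
Local Notation gam := (@std_gaussian R).

(** O and the identity have the same Gram matrix, so the invariant factor relating them is O
    itself. *)
Lemma orth_gauss_orth d (O : 'M[R]_d) : O *m O^T = 1%:M -> gauss_orth O.
Proof.
move=> OO; have [W QW ->] : exists2 W, gauss_orth W & O = 1%:M *m W.
  by apply: (gram_eq_orthof gauss_orth_family); rewrite trmx1 mulmx1.
by rewrite mul1mx.
Qed.

Lemma E_std_gaussian_orth d (O : 'M[R]_d) (f : 'cV[R]_d -> R) : O *m O^T = 1%:M ->
  measurable_fun [set: 'cV[R]_d] f ->
  \int[gam d]_v f (O *m v) = \int[gam d]_v f v.
Proof.
move=> /orth_gauss_orth[_ QO] mf; congr fine.
have mE : measurable_fun [set: 'cV[R]_d] (EFin \o f) by exact/measurable_EFinP.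
rewrite integralE [RHS]integralE; congr (_ - _)%E.
- rewrite -[RHS]QO => [|//|v]; [|exact: measurable_funepos|by rewrite funeposE le_max lexx orbT].
  by apply: eq_integral => x _; rewrite !funeposE.
- rewrite -[RHS]QO => [|//|v]; [|exact: measurable_funeneg|by rewrite funenegE le_max lexx orbT].
  by apply: eq_integral => x _; rewrite !funenegE.
Qed.

Lemma measurable_bform d (B : 'M[R]_d) : measurable_fun [set: 'cV[R]_d] (fun z => bform z B z).
Proof.
have -> : (fun z => bform z B z) = (fun z => \sum_i (\sum_j z j 0 * B j i) * z i 0).
  apply/funext => z; rewrite /bform mxE; apply: eq_bigr => i _; congr (_ * _).
  by rewrite mxE; apply: eq_bigr => j _; rewrite mxE.
apply: measurable_sum => i; apply: measurable_funM; last exact: measurable_entry.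
by apply: measurable_sum => j; apply: measurable_funM => //; exact: measurable_entry.
Qed.

Lemma measurable_dot d (c : 'cV[R]_d) : measurable_fun [set: 'cV[R]_d] (fun z => (c^T *m z) 0 0).
Proof.
under eq_fun do rewrite mxE.
by apply: measurable_sum => i; apply: measurable_funM => //; exact: measurable_entry.
Qed.

Definition quadratic d (c : 'cV[R]_d) (B : 'M[R]_d) (z : 'cV[R]_d) : R :=
  (c^T *m z) 0 0 + bform z B z.

Lemma measurable_quadratic d (c : 'cV[R]_d) B : measurable_fun [set: 'cV[R]_d] (quadratic c B).
Proof. by apply: measurable_funD; [exact: measurable_dot|exact: measurable_bform]. Qed.

Lemma quadratic_chaos d (c : 'cV[R]_d) (U : 'M[R]_d) (g : 'rV[R]_d) z : U *m U^T = 1%:M ->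
  let B := U *m diag_mx g *m U^T in
  quadratic c B z - \tr B = chaos (fun k => (U^T *m c) k 0) (fun k => g 0 k) (U^T *m z).
Proof.
move=> UU /=; set w := U^T *m z.
have -> : quadratic c (U *m diag_mx g *m U^T) z =
    ((U^T *m c)^T *m w) 0 0 + (w^T *m diag_mx g *m w) 0 0.
  rewrite /quadratic /bform /w !trmx_mul !trmxK !mulmxA.
  by rewrite -(mulmxA c^T) UU mulmx1.
have -> : \tr (U *m diag_mx g *m U^T) = \sum_k g 0 k.
  by rewrite mxtrace_mulC mulmxA orth_trK// mul1mx mxtrace_diag.
set x := U^T *m c.
have -> : (x^T *m w) 0 0 = \sum_k x k 0 * w k 0.
  by rewrite mxE; apply: eq_bigr => k _; rewrite mxE.
have -> : (w^T *m diag_mx g *m w) 0 0 = \sum_k w k 0 * g 0 k * w k 0.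
  by rewrite mul_mx_diag mxE; apply: eq_bigr => k _; rewrite !mxE.
by rewrite -big_split -sumrB; apply: eq_bigr => k _ /=; ring.
Qed.

Lemma quadratic_le d (c : 'cV[R]_d) B : exists2 C, 0 <= C &
  forall z, `|quadratic c B z| <= C * (1 + sqnorm z).
Proof.
have bd (x y s : R) : 0 <= s -> x ^+ 2 <= s -> y ^+ 2 <= s -> `|x * y| <= s.
  by move=> s0 xs ys; rewrite ler_norml; apply/andP; split; nra.
exists (\sum_i `|c i 0| + \sum_i \sum_j `|B j i|).
  by rewrite addr_ge0// sumr_ge0// => i _; rewrite sumr_ge0.
move=> z; rewrite /quadratic; apply: (le_trans (ler_normD _ _)); rewrite mulrDl.
have s0 := sqnorm_ge0 z; apply: lerD.
  rewrite mxE mulr_suml; apply: (le_trans (ler_norm_sum _ _ _)); apply: ler_sum => i _.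
  rewrite mxE normrM ler_wpM2l//; have := sqr_entry_le z i => zi.
  by rewrite ler_norml; apply/andP; split; nra.
rewrite /bform mxE mulr_suml; apply: (le_trans (ler_norm_sum _ _ _)); apply: ler_sum => i _.
rewrite mxE !mulr_suml; apply: (le_trans (ler_norm_sum _ _ _)); apply: ler_sum => j _.
rewrite mxE mulrAC normrM mulrC ler_wpM2l//.
apply: (le_trans (bd _ _ _ s0 (sqr_entry_le z j) (sqr_entry_le z i))); lra.
Qed.

Lemma intg_quadratic_exp d (c : 'cV[R]_d) B t p :
  intg (gam d) (fun z => (quadratic c B z - t) ^+ p).
Proof.
have [C C0 HC] := quadratic_le c B.
apply: (@intg_std_bounded _ d p ((C + `|t|) ^+ p)).
  by apply: measurable_funX; apply: measurable_funB => //; exact: measurable_quadratic.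
move=> w; rewrite normrX -exprMn; have s0 := sqnorm_ge0 w; have := HC w => Hw.
have t0 := normr_ge0 t.
apply: lerXn2r; rewrite ?nnegrE//; first by nra.
by apply: (le_trans (ler_normB _ _)); nra.
Qed.

(** By orthogonal invariance the vector may be rotated to an eigenbasis of B. *)
Lemma E_quadratic_moments d (c : 'cV[R]_d) B : B^T = B ->
  \int[gam d]_z (quadratic c B z - \tr B) = 0 /\
  \int[gam d]_z ((quadratic c B z - \tr B) ^+ 2) = sqnorm c + 2 * \tr (B *m B).
Proof.
move=> /real_spectral[U [g [UU ->]]].
have UTU : U^T *m U^T^T = 1%:M by rewrite trmxK orth_trK.
have [E1 E2] := E_chaos_moments (fun k => (U^T *m c) k 0) (fun k => g 0 k).
split.
  under eq_Rintegral do rewrite quadratic_chaos//.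
  by rewrite (@E_std_gaussian_orth d U^T _ UTU (@measurable_chaos R d _ _)).
under eq_Rintegral do rewrite quadratic_chaos//.
rewrite (@E_std_gaussian_orth d U^T (fun w => chaos _ _ w ^+ 2) UTU) ?E2; last first.
  by apply: measurable_funX; exact: measurable_chaos.
rewrite big_split/= -mulr_sumr; congr (_ + 2 * _).
  have -> : sqnorm c = ((U^T *m c)^T *m (U^T *m c)) 0 0.
    by rewrite sqnormE trmx_mul trmxK mulmxA -(mulmxA c^T) UU mulmx1.
  by rewrite -sqnormE.
rewrite -!mulmxA mxtrace_mulC (mulmxA U^T U) orth_trK// mul1mx.
rewrite -!mulmxA orth_trK// mulmx1.
rewrite mulmx_diag mxtrace_diag; apply: eq_bigr => k _.
by rewrite mxE expr2.
Qed.

Lemma gaussian_intg d (m : 'cV[R]_d) S (f : 'cV[R]_d -> R) : measurable_fun [set: 'cV[R]_d] f ->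
  intg (gam d) (fun z => f (m + sqrtm S *m z)) -> intg (gaussian m S) f.
Proof. by move=> mf fi; apply: intg_comp. Qed.

Lemma gaussian_E d (m : 'cV[R]_d) S (f : 'cV[R]_d -> R) : measurable_fun [set: 'cV[R]_d] f ->
  intg (gam d) (fun z => f (m + sqrtm S *m z)) ->
  \int[gaussian m S]_x f x = \int[gam d]_z f (m + sqrtm S *m z).
Proof. by move=> mf fi; rewrite mean_distribution. Qed.

(** Used twice: as the summand of the central limit theorem, and, for other matrices, as the
    potentials in the duality bound for the distance. *)
Definition centered_quadratic d (m : 'cV[R]_d) (S : 'M[R]_d) (c : 'cV[R]_d) (G : 'M[R]_d)
  (x : 'cV[R]_d) : R := quadratic c G (x - m) - \tr (G *m S).

Lemma measurable_centered_quadratic d (m : 'cV[R]_d) S c G :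
  measurable_fun [set: 'cV[R]_d] (centered_quadratic m S c G).
Proof.
apply: measurable_funB => //.
apply: (@measurableT_comp _ _ _ _ _ _ (quadratic c G) _ (fun x : 'cV[R]_d => x - m : 'cV[R]_d)).
  exact: measurable_quadratic.
apply: measurable_fun_matrix => i j; under eq_fun do rewrite mxE.
by apply: measurable_funD => //; exact: measurable_entry.
Qed.

Lemma centered_quadratic_affine d (m : 'cV[R]_d) S c G z : covariance_matrix S ->
  let A := sqrtm S in
  centered_quadratic m S c G (m + A *m z) = quadratic (A *m c) (A *m G *m A) z - \tr (A *m G *m A).
Proof.
move=> hS /=; set A := sqrtm S; have AT : A^T = A by exact: sqrtm_sym.
rewrite /centered_quadratic [m + _]addrC addrK; congr (_ - _).
  by rewrite /quadratic /bform !trmx_mul AT !mulmxA.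
by rewrite [RHS]mxtrace_mulC mulmxA sqrtmK// mxtrace_mulC.
Qed.

Lemma E_centered_quadratic d (m : 'cV[R]_d) S c G : covariance_matrix S -> G^T = G ->
  let f := centered_quadratic m S c G in
  [/\ forall p, intg (gaussian m S) (fun x => f x ^+ p),
   \int[gaussian m S]_x f x = 0 &
   \int[gaussian m S]_x (f x ^+ 2) = bform c S c + 2 * \tr (G *m S *m G *m S)].
Proof.
move=> hS GT f; set A := sqrtm S; have AT : A^T = A by exact: sqrtm_sym.
have BT : (A *m G *m A)^T = A *m G *m A by rewrite !trmx_mul AT GT mulmxA.
have mf p : measurable_fun [set: 'cV[R]_d] (fun x => f x ^+ p).
  by apply: measurable_funX; exact: measurable_centered_quadratic.
have fi p : intg (gam d) (fun z => f (m + A *m z) ^+ p).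
  under eq_fun do rewrite /f centered_quadratic_affine//.
  exact: intg_quadratic_exp.
have [E1 E2] := E_quadratic_moments (A *m c) BT.
split.
- by move=> p; apply: gaussian_intg => //; exact: fi.
- rewrite gaussian_E; [|exact: (mf 1)|exact: (fi 1)].
  by under eq_Rintegral do rewrite /f centered_quadratic_affine//.
- rewrite (@gaussian_E _ _ _ (fun x => f x ^+ 2)); [|exact: mf|exact: fi].
  under eq_Rintegral do rewrite /f centered_quadratic_affine//.
  rewrite E2; congr (_ + 2 * _).
    by rewrite sqnormE trmx_mul AT mulmxA -(mulmxA c^T) sqrtmK.
  rewrite -!mulmxA mxtrace_mulC !mulmxA -(mulmxA _ A A) -/A sqrtmK//.
  by rewrite -[X in \tr X = _]mulmxA sqrtmK.
Qed.

End gaussian_quadratic.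

(** * The Wasserstein distance between Gaussians *)

Section gelbrich.
Context {R : realType}.
Local Notation gam := (@std_gaussian R).

Lemma trace_cov_mul_ge0 d (P Q : 'M[R]_d) : covariance_matrix P -> covariance_matrix Q ->
  0 <= \tr (P *m Q).
Proof.
move=> hP hQ; rewrite -(sqrtmK hP) -mulmxA mxtrace_mulC -{2}(sqrtm_sym hP).
exact: covariance_conj_ge0.
Qed.

Lemma covariance_add_scalar_unit d (P : 'M[R]_d) e : covariance_matrix P -> 0 < e ->
  P + e%:M \in unitmx.
Proof.
move=> hP e0; rewrite -row_free_unit -kermx_eq0; apply/eqP.
set K := kermx _; have := mulmx_ker (P + e%:M); rewrite -/K => KP.
have : \tr (K *m P *m K^T) + e * \tr (K *m K^T) = 0.
  rewrite -mxtraceZ -mxtraceD scalemxAl -mul_mx_scalar -mulmxDl -mulmxDr KP.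
  by rewrite mul0mx linear0.
move=> /eqP; rewrite paddr_eq0 ?covariance_conj_ge0//; last by rewrite mulr_ge0 ?fro_ge0 ?ltW.
by move=> /andP[_]; rewrite mulf_eq0 gt_eqF//= => /eqP/fro_eq0.
Qed.

(** The form of the inverse of K is nonnegative at x - K y. This makes the quadratic potentials
    admissible in the duality. *)
Lemma young_quadratic d (K : 'M[R]_d) (x y : 'cV[R]_d) : covariance_matrix K ->
  K \in unitmx -> 2 * (x^T *m y) 0 0 <= bform x (invmx K) x + bform y K y.
Proof.
move=> hK uK; have [_ /(_ (x - K *m y))] := covariance_inv hK uK.
have -> : bform (x - K *m y) (invmx K) (x - K *m y) =
    (x^T *m invmx K *m x - x^T *m y - y^T *m x + y^T *m K *m y) 0 0.
  rewrite /bform [(x - _)^T]linearB/= trmx_mul hK.1 !mulmxBl !mulmxBr.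
  rewrite !mulmxA -[x^T *m invmx K *m K]mulmxA mulVmx// mulmx1.
  by rewrite -[y^T *m K *m invmx K]mulmxA mulmxV// mulmx1 opprB addrA addrAC.
have -> : y^T *m x = (x^T *m y)^T by rewrite trmx_mul trmxK.
rewrite /bform; move: (x^T *m _ *m x) (y^T *m _ *m y) (x^T *m y) => p q z.
rewrite !mxE; lra.
Qed.

Lemma gaussian_coupling_marginals d (P Q : probability 'cV[R]_d R)
    (pi : probability ('cV[R]_d * 'cV[R]_d)%type R) (a b : 'cV[R]_d -> R) :
  coupling P Q pi -> intg P a -> intg Q b ->
  intg pi (fun z => a z.1 + b z.2) /\
  \int[pi]_z (a z.1 + b z.2) = \int[P]_x a x + \int[Q]_y b y.
Proof.
move=> cpi ai bi; have ma := intg_meas ai; have mb := intg_meas bi.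
pose p1 := mfun_of (@measurable_fst _ _ 'cV[R]_d 'cV[R]_d).
pose p2 := mfun_of (@measurable_snd _ _ 'cV[R]_d 'cV[R]_d).
have e1 A : measurable A -> A `<=` setT -> distribution pi p1 A = P A.
  move=> mA _; rewrite -(cpi A mA).1 /distribution /pushforward; congr (pi _).
  by apply/seteqP; split => z //= [].
have e2 A : measurable A -> A `<=` setT -> distribution pi p2 A = Q A.
  move=> mA _; rewrite -(cpi A mA).2 /distribution /pushforward; congr (pi _).
  by apply/seteqP; split => z //= [].
have i1 : intg pi (fun z => a z.1).
  apply/integrableP; split; first by apply/measurable_EFinP; apply: measurableT_comp.
  have /integrableP[_] := ai.
  rewrite -(eq_measure_integral _ e1) ge0_integral_distribution//.
  by apply: measurableT_comp => //; exact/measurable_EFinP.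
have i2 : intg pi (fun z => b z.2).
  apply/integrableP; split; first by apply/measurable_EFinP; apply: measurableT_comp.
  have /integrableP[_] := bi.
  rewrite -(eq_measure_integral _ e2) ge0_integral_distribution//.
  by apply: measurableT_comp => //; exact/measurable_EFinP.
split; first exact: intgD.
rewrite meanD//; congr (_ + _).
  by rewrite -(@mean_distribution _ _ _ pi _ _ p1)// /Rintegral (eq_measure_integral _ e1).
by rewrite -(@mean_distribution _ _ _ pi _ _ p2)// /Rintegral (eq_measure_integral _ e2).
Qed.


Lemma covariance_mul_self d (Q : 'M[R]_d) : Q^T = Q -> covariance_matrix (Q *m Q).
Proof. by move=> QT; rewrite -{2}QT; exact: covariance_gram. Qed.

Section formula.
Context {d : nat} (m nu : 'cV[R]_d) (S Xi : 'M[R]_d).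
Hypotheses (hS : covariance_matrix S) (hXi : covariance_matrix Xi) (uXi : Xi \in unitmx).

Let X2 := sqrtm Xi.
Let Y := invmx X2.
Let M := X2 *m S *m X2.
Let N := sqrtm M.
(** Going from N(nu, Xi) to N(m, S) inverts only the square root of Xi, so that S may be singular,
    as the empirical covariance can be. *)
Let T := Y *m N *m Y.

Let uX2 : X2 \in unitmx. Proof. exact: sqrtm_unitmx. Qed.
Let X2T : X2^T = X2. Proof. exact: sqrtm_sym. Qed.
Let X2K : X2 *m X2 = Xi. Proof. exact: sqrtmK. Qed.
Let YT : Y^T = Y. Proof. by rewrite /Y trmx_inv X2T. Qed.

Let hM : covariance_matrix M.
Proof. by rewrite /M -{2}X2T; exact: covariance_conj. Qed.

Let hN : covariance_matrix N. Proof. exact: sqrtm_cov. Qed.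

Let hT : covariance_matrix T.
Proof. by rewrite /T -{2}YT; exact: covariance_conj. Qed.

Let TXiT : T *m Xi *m T = S.
Proof.
rewrite /T -X2K !mulmxA mulmxKV// -(mulmxA _ X2 Y) mulmxV// mulmx1.
rewrite -(mulmxA Y) sqrtmK// /M !mulmxA mulVmx// mul1mx -mulmxA mulmxV// mulmx1.
by [].
Qed.

Let trTXi : \tr (T *m Xi) = \tr N.
Proof.
rewrite /T -X2K !mulmxA mulmxKV// mxtrace_mulC !mulmxA mulmxV// mul1mx.
by [].
Qed.

Definition gelbrich_value : R :=
  sqnorm (m - nu) + \tr S + \tr Xi - 2 * \tr N.

Lemma dotZ k (v w : 'cV[R]_d) : ((k *: v)^T *m w) 0 0 = k * (v^T *m w) 0 0.
Proof. by rewrite linearZ/= -scalemxAl mxE. Qed.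

Lemma sqnormD (x y : 'cV[R]_d) : sqnorm (x + y) = sqnorm x + 2 * (x^T *m y) 0 0 + sqnorm y.
Proof.
rewrite !mxE mulr_sumr -!big_split; apply: eq_bigr => i _ /=.
by rewrite !mxE; ring.
Qed.

Let cost := fun z : 'cV[R]_d * 'cV[R]_d => sqnorm (z.1 - z.2).

Let mcost : measurable_fun [set: 'cV[R]_d * 'cV[R]_d] cost.
Proof.
apply: (@measurableT_comp _ _ _ _ _ _ (@sqnorm R d) _ (fun z : 'cV[R]_d * 'cV[R]_d => z.1 - z.2 : 'cV[R]_d)).
  exact: measurable_sqnorm.
apply: measurable_fun_matrix => i j; under eq_fun do rewrite !mxE.
apply: measurable_funB.
  by apply: (measurableT_comp (measurable_entry i j)); exact: measurable_fst.
by apply: (measurableT_comp (measurable_entry i j)); exact: measurable_snd.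
Qed.

(** The coupling drives both marginals by the same Z. Since A = T X2, its first component is the
    image of the second under the affine transport map. A need not be symmetric, but A A^t = S is
    all that its law depends on. *)
Let gelbrich_ub : (wasserstein2sq (gaussian m S) (gaussian nu Xi) <= gelbrich_value%:E)%E.
Proof.
pose A := Y *m N.
have AAT : A *m A^T = S.
  rewrite /A trmx_mul YT hN.1 mulmxA -(mulmxA Y) sqrtmK// /M !mulmxA.
  by rewrite mulVmx// mul1mx -mulmxA mulmxV// mulmx1.
pose f (z : 'cV[R]_d) : 'cV[R]_d * 'cV[R]_d := (m + A *m z, nu + X2 *m z).
have maf (c : 'cV[R]_d) (C : 'M[R]_d) : measurable_fun [set: 'cV[R]_d] (fun v : 'cV[R]_d => c + C *m v).
  apply: measurable_fun_matrix => i j; under eq_fun do rewrite mxE.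
  apply: measurable_funD => //; under eq_fun do rewrite mxE.
  by apply: measurable_sum => k; apply: measurable_funM => //; exact: measurable_entry.
have mf : measurable_fun [set: 'cV[R]_d] f by apply/measurable_fun_pair; exact: maf.
pose pi : probability ('cV[R]_d * 'cV[R]_d)%type R := distribution (gam d) (mfun_of mf).
apply: ereal_inf_le; exists (\int[pi]_z (cost z)%:E)%E.
  exists pi => // B mB; split.
    rewrite -[in RHS]AAT gaussian_gram// /pi /= /pushforward; congr (gam d _).
    by apply/seteqP; split => z //= [].
  rewrite /pi /= /distribution /pushforward; congr (gam d _).
  by apply/seteqP; split => z //= [].
(* Along the coupling the cost is a quadratic function of Z, with mean |m - nu|^2 + tr B. *)
pose B := (A - X2)^T *m (A - X2); pose c := 2 *: ((A - X2)^T *m (m - nu)).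
have BT : B^T = B by rewrite /B trmx_mul trmxK.
have costE z : cost (f z) = (quadratic c B z - \tr B) + (sqnorm (m - nu) + \tr B).
  rewrite /cost /f/= (_ : _ - _ = (m - nu) + (A - X2) *m z); last first.
    by rewrite mulmxBl opprD addrACA.
  rewrite sqnormD /quadratic /c /bform /B.
  rewrite (sqnormE (_ *m z)) [((A - X2) *m z)^T]trmx_mul !mulmxA.
  rewrite dotZ trmx_mul trmxK.
  by ring.
have [E1 _] := E_quadratic_moments c BT.
have i1 := intg_quadratic_exp c B (\tr B) 1.
rewrite /pi (@ge0_integral_distribution _ _ _ _ _ _ (mfun_of mf) (fun z => (cost z)%:E)); last 2 first.
- exact/measurable_EFinP.
- by move=> z; rewrite lee_fin sqnorm_ge0.
rewrite /= (_ : (\int[gam d]_z (cost (f z))%:E = (sqnorm (m - nu) + \tr B)%:E)%E); last first.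
  under eq_integral do rewrite costE.
  rewrite EFin_mean; last by apply: intgD; [exact: i1|exact: intg_cst].
  by rewrite meanD ?E1 ?mean_cst ?add0r//; exact: intg_cst.
rewrite lee_fin /gelbrich_value.
rewrite /B mxtrace_mulC [(A - X2)^T]linearB/= X2T mulmxBl !mulmxBr AAT X2K !mxtraceB.
have -> : \tr (A *m X2) = \tr N.
  by rewrite /A mxtrace_mulC mulmxA mulmxV// mul1mx.
have -> : \tr (X2 *m A^T) = \tr N.
  by rewrite /A trmx_mul YT hN.1 mxtrace_mulC -mulmxA mulVmx// mulmx1.
lra.
Qed.

(* Weak Kantorovich duality with the quadratic potentials of the transport map
   [T] from N(nu, Xi) to N(m, S); [T] is singular when [S] is, whence [T + e]. *)
Let gelbrich_lb_eps e pi : 0 < e -> coupling (gaussian m S) (gaussian nu Xi) pi ->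
  ((gelbrich_value - e * \tr Xi)%:E <= \int[pi]_z (cost z)%:E)%E.
Proof.
move=> e0 cpi; pose K := T + e%:M.
have hK : covariance_matrix K.
  by apply: covarianceD => //; rewrite -scalemx1; apply: covarianceZ; [exact: ltW|exact: covariance1].
have uK : K \in unitmx by exact: covariance_add_scalar_unit.
pose L := invmx K; have hL : covariance_matrix L by exact: covariance_inv.
pose c : 'cV[R]_d := 2 *: (m - nu).
pose a x := centered_quadratic m S c (1%:M - L) x + (\tr ((1%:M - L) *m S) + sqnorm (m - nu)).
pose b y := centered_quadratic nu Xi (- c) (1%:M - K) y + \tr ((1%:M - K) *m Xi).
have symL : (1%:M - L)^T = 1%:M - L by rewrite linearB/= trmx1 hL.1.
have symK : (1%:M - K)^T = 1%:M - K by rewrite linearB/= trmx1 hK.1.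
have [ia Ea _] := E_centered_quadratic m c hS symL.
have [ib Eb _] := E_centered_quadratic nu (- c) hXi symK.
have ia1 := ia 1; have ib1 := ib 1.
have iaa : intg (gaussian m S) a by apply: intgD; [exact: ia1|exact: intg_cst].
have ibb : intg (gaussian nu Xi) b by apply: intgD; [exact: ib1|exact: intg_cst].
have [iab Eab] := gaussian_coupling_marginals cpi iaa ibb.
have Eaa : \int[gaussian m S]_x a x = \tr ((1%:M - L) *m S) + sqnorm (m - nu).
  by rewrite meanD ?Ea ?mean_cst ?add0r//; exact: intg_cst.
have Ebb : \int[gaussian nu Xi]_y b y = \tr ((1%:M - K) *m Xi).
  by rewrite meanD ?Eb ?mean_cst ?add0r//; exact: intg_cst.
(* After the terms linear in x' and y' cancel, this is Young's inequality for K and its inverse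
   L. *)
have pw z : a z.1 + b z.2 <= cost z.
  case: z => x y /=; rewrite /a /b /cost /centered_quadratic /quadratic.
  set x' := x - m; set y' := y - nu.
  have -> : x - y = (m - nu) + (x' - y').
    by apply/colP => i; rewrite !mxE; ring.
  rewrite (sqnormD (m - nu)) (sqnormD x').
  have -> : sqnorm (- y') = sqnorm y' by apply: eq_bigr => i _; rewrite mxE sqrrN.
  have bf (z : 'cV[R]_d) (Q : 'M[R]_d) : bform z (1%:M - Q) z = sqnorm z - bform z Q z.
    by rewrite /bform mulmxBr mulmxBl mulmx1 !mxE sqnormE mxE.
  rewrite !bf; have := young_quadratic x' y' hK uK; rewrite -/L.
  have -> : (x'^T *m - y') 0 0 = - (x'^T *m y') 0 0 by rewrite mulmxN mxE.
  have -> : ((m - nu)^T *m (x' - y')) 0 0 = ((m - nu)^T *m x') 0 0 - ((m - nu)^T *m y') 0 0.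
    by rewrite mulmxBr !mxE.
  have -> : (c^T *m x') 0 0 = 2 * ((m - nu)^T *m x') 0 0.
    exact: dotZ.
  have -> : ((- c)^T *m y') 0 0 = - (2 * ((m - nu)^T *m y') 0 0).
    by rewrite /c -scaleNr dotZ mulNr.
  lra.
have key : gelbrich_value - e * \tr Xi <= \int[gaussian m S]_x a x + \int[gaussian nu Xi]_y b y.
  rewrite Eaa Ebb !mulmxBl !mul1mx !mxtraceB /gelbrich_value /K mulmxDl mxtraceD trTXi.
  rewrite mul_scalar_mx mxtraceZ.
  suff : \tr (L *m S) <= \tr N by lra.
  rewrite -trTXi -subr_ge0.
  have LK : L *m K = 1%:M by rewrite /L mulVmx.
  have KL : K *m L = 1%:M by rewrite /L mulmxV.
  have LT : L *m T = 1%:M - e *: L.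
    by rewrite -LK /K mulmxDr mul_mx_scalar addrK.
  have TL : T *m L = 1%:M - e *: L.
    by rewrite -KL /K mulmxDl mul_scalar_mx addrK.
  have -> : \tr (L *m S) = \tr (T *m L *m T *m Xi).
    by rewrite -[in LHS]TXiT mulmxA mxtrace_mulC !mulmxA.
  rewrite -mxtraceB -mulmxBl.
  (* Because L T = T L = 1 - e L, the gap between T and T L T is e times a conjugate of T^2 + e T,
     hence nonnegative definite. *)
  have -> : T - T *m L *m T = e *: (L *m (T *m T + e *: T) *m L).
    have -> : L *m (T *m T + e *: T) *m L = L *m T.
      have -> : T *m T + e *: T = T *m K by rewrite /K mulmxDr mul_mx_scalar.
      by rewrite -(mulmxA L) -(mulmxA T) KL mulmx1.
    by rewrite TL mulmxBl mul1mx -scalemxAl opprB addrC subrK.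
  apply: trace_cov_mul_ge0 => //; apply: covarianceZ; first exact: ltW.
  rewrite -{2}hL.1; apply: covariance_conj; apply: covarianceD.
    by apply: covariance_mul_self; exact: hT.1.
  by apply: covarianceZ; [exact: ltW|].
(* A coupling of infinite cost satisfies the bound trivially; otherwise the pointwise inequality can
   be integrated. *)
have [coo|cfin] := ltP (\int[pi]_z (cost z)%:E)%E +oo%E; last first.
  by apply: le_trans cfin; rewrite leey.
have ic : intg pi cost by apply: ge0_intg => // z; exact: sqnorm_ge0.
rewrite EFin_mean// lee_fin; apply: (le_trans key); rewrite -Eab; exact: le_mean.
Qed.

Theorem gelbrich_formula :
  wasserstein2sq (gaussian m S) (gaussian nu Xi) = gelbrich_value%:E.
Proof.
apply/le_anti/andP; split; first exact: gelbrich_ub.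
apply: le_ereal_inf_tmp => _ [pi cpi <-].
have t0 : 0 <= \tr Xi.
  by rewrite -[Xi]mul1mx; apply: trace_cov_mul_ge0 => //; exact: covariance1.
apply/lee_addgt0Pr => e e0.
(* The regularization costs its parameter times tr Xi, which is at most e for this choice. *)
have e1 : 0 < e / (1 + \tr Xi) by rewrite divr_gt0//; lra.
rewrite -leeBlDr//; apply: le_trans (gelbrich_lb_eps e1 cpi); rewrite -EFinB lee_fin.
rewrite lerD2l lerN2 mulrAC ler_pdivrMr; last lra.
by rewrite mulrDr mulr1 lerDr ltW.
Qed.

End formula.

End gelbrich.

(** * Measurability of the square root *)

Section sqrt_iteration.
Context {R : realType}.

(** The classical polynomial iteration, started at 0, which increases to the square root of a for a
    in [0, 1]. *)
Fixpoint sqrt_iter (a : R) (k : nat) : R :=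
  if k is k'.+1 then sqrt_iter a k' + 2^-1 * (a - sqrt_iter a k' ^+ 2) else 0.

(** The error obeys e' = e (1 - (s + y) / 2) <= e (1 - e / 2), whence the decay 2 / (k + 1), uniform
    in s. The bound by s keeps the iterates nonnegative. *)
Lemma sqrt_iter_bound (s : R) k : 0 <= s <= 1 ->
  0 <= s - sqrt_iter (s ^+ 2) k <= Num.min s (2 / k.+1%:R).
Proof.
move=> /andP[s0 s1]; elim: k => [|k /=].
  by rewrite /= subr0 s0 le_min lexx/= divr1; lra.
set y := sqrt_iter _ _; set n := k.+1%:R : R => /andP[e0]; rewrite !le_min => /andP[e1 e2].
have n1 : 1 <= n by rewrite ler1n.
have -> : k.+2%:R = n + 1 :> R by rewrite /n -natr1.
set e := s - y in e0 e1 e2.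
have -> : s - (y + 2^-1 * (s ^+ 2 - y ^+ 2)) = e * (1 - (s + y) / 2) by rewrite /e; field.
have y0 : 0 <= y by rewrite /e in e1; lra.
have ys : y <= s by rewrite /e in e0; lra.
have f0 : 0 <= 1 - (s + y) / 2 by lra.
apply/andP; split; first by rewrite mulr_ge0.
apply/andP; split; first by nra.
have esy : e <= s + y by rewrite /e; lra.
have e3 : e * (1 - (s + y) / 2) <= e * (1 - e / 2) by rewrite ler_wpM2l//; lra.
apply: (le_trans e3).
rewrite ler_pdivlMr; last lra.
have en : e * n <= 2 by rewrite -ler_pdivlMr//; lra.
have : 0 <= (2 - e * n) ^+ 2 by rewrite sqr_ge0.
nra.
Qed.

(* Polynomials in [A] converging to its square root: they make the trace of the
   square root a pointwise limit of measurable functions. *)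
Fixpoint mx_sqrt_iter d (A : 'M[R]_d) (k : nat) : 'M[R]_d :=
  if k is k'.+1 then mx_sqrt_iter A k' + 2^-1 *: (A - mx_sqrt_iter A k' *m mx_sqrt_iter A k') else 0.

Lemma mx_sqrt_iter_diag d (U : 'M[R]_d) (a : 'rV[R]_d) k : U *m U^T = 1%:M ->
  mx_sqrt_iter (U *m diag_mx a *m U^T) k =
  U *m diag_mx (\row_i sqrt_iter (a 0 i) k) *m U^T.
Proof.
move=> UU; elim: k => [|k /= ->].
  rewrite (_ : \row_i _ = 0) ?linear0 ?mulmx0 ?mul0mx//.
  by apply/rowP => i; rewrite !mxE.
set b := \row_i sqrt_iter _ k.
have -> : U *m diag_mx b *m U^T *m (U *m diag_mx b *m U^T) =
    U *m diag_mx (\row_i (b 0 i ^+ 2)) *m U^T.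
  rewrite -!mulmxA (mulmxA U^T) orth_trK// mul1mx (mulmxA (diag_mx b)) mulmx_diag.
  by rewrite (_ : \row_i (b 0 i * b 0 i) = \row_i (b 0 i ^+ 2))//; apply/rowP => i; rewrite !mxE expr2.
rewrite -mulmxBl -mulmxBr scalemxAl scalemxAr -mulmxDl -mulmxDr.
congr (_ *m _ *m _); apply/matrixP => i j; rewrite !mxE.
by case: (i == j) => /=; rewrite ?mulr1n// !mulr0n subr0 mulr0 addr0.
Qed.

Lemma sqrtm_diag d (U : 'M[R]_d) (a : 'rV[R]_d) : U *m U^T = 1%:M ->
  (forall i, 0 <= a 0 i) ->
  sqrtm (U *m diag_mx a *m U^T) = U *m diag_mx (map_mx Num.sqrt a) *m U^T.
Proof.
move=> UU a0.
have ss : spectral_sqrt (U *m diag_mx a *m U^T) (U *m diag_mx (map_mx Num.sqrt a) *m U^T).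
  by exists U, a.
by apply: sqrtm_unique; [exact: spectral_sqrt_cov ss|exact: spectral_sqrtK].
Qed.

Lemma trace_diag_conj d (U : 'M[R]_d) (a : 'rV[R]_d) : U *m U^T = 1%:M ->
  \tr (U *m diag_mx a *m U^T) = \sum_i a 0 i.
Proof. by move=> UU; rewrite mxtrace_mulC mulmxA orth_trK// mul1mx mxtrace_diag. Qed.

(** Trace at most 1 forces every eigenvalue into [0, 1], where the scalar iteration converges. *)
Lemma cvg_trace_sqrt_iter d (A : 'M[R]_d) : covariance_matrix A -> \tr A <= 1 ->
  (fun k => \tr (mx_sqrt_iter A k)) @ \oo --> \tr (sqrtm A).
Proof.
move=> /covariance_spectral[U [a [UU a0 ->]]]; rewrite trace_diag_conj// => a1.
rewrite sqrtm_diag// trace_diag_conj//.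
under eq_fun do rewrite mx_sqrt_iter_diag// trace_diag_conj//.
apply: (@squeeze_cvgr _ _ _ _ (fun k => \sum_i map_mx Num.sqrt a 0 i - d%:R * (2 / k.+1%:R)) (fun=> \sum_i map_mx Num.sqrt a 0 i)).
- near=> k.
  have H i : 0 <= Num.sqrt (a 0 i) - sqrt_iter (a 0 i) k <= 2 / k.+1%:R.
    have ai1 : a 0 i <= 1.
      apply: le_trans a1; rewrite (bigD1 i)//= lerDl sumr_ge0// => j _; exact: a0.
    have s01 : 0 <= Num.sqrt (a 0 i) <= 1.
      by rewrite sqrtr_ge0 -[leRHS]sqrtr1 ler_wsqrtr.
    have := sqrt_iter_bound k s01; rewrite sqr_sqrtr// le_min => /andP[-> /andP[_ ->]].
    by [].
  apply/andP; split; last first.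
    by apply: ler_sum => i _; rewrite !mxE; have /andP[] := H i; lra.
  have -> : d%:R * (2 / k.+1%:R) = \sum_(i < d) (2 / k.+1%:R) :> R.
    by rewrite sumr_const card_ord mulr_natl.
  rewrite -sumrB; apply: ler_sum => i _; rewrite !mxE; have /andP[_] := H i.
  by rewrite !lerBlDr addrC.
- rewrite -[X in _ --> X]subr0; apply: cvgB; first exact: cvg_cst.
  rewrite -(mulr0 d%:R) -(mulr0 2); apply: cvgM; first exact: cvg_cst.
  by apply: cvgM; [exact: cvg_cst|exact: cvg_harmonic].
- exact: cvg_cst.
Unshelve. all: by end_near. Qed.

Lemma sqrtmZ d (A : 'M[R]_d) c : covariance_matrix A -> 0 <= c ->
  sqrtm (c *: A) = Num.sqrt c *: sqrtm A.
Proof.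
move=> hA c0; apply: sqrtm_unique.
  by apply: covarianceZ; [exact: sqrtr_ge0|exact: sqrtm_cov].
by rewrite -scalemxAl -scalemxAr scalerA -expr2 sqr_sqrtr// sqrtmK.
Qed.

Lemma measurable_inv_pos disp (T : measurableType disp) (f : T -> R) :
  measurable_fun [set: T] f -> (forall t, 0 < f t) ->
  measurable_fun [set: T] (fun t => (f t)^-1).
Proof.
move=> mf f0; have -> : (fun t => (f t)^-1) = (fun t => expR (- ln (f t))).
  by apply/funext => t; rewrite expRN lnK// posrE.
apply: measurableT_comp => //; apply: measurableT_comp => //.
by apply: measurableT_comp => //; exact: measurable_ln.
Qed.

(** Dividing M by 1 + tr M brings its trace below 1, where the iteration converges; homogeneity of
    the square root undoes the scaling. *)
Lemma measurable_trace_sqrtm disp (T : measurableType disp) d (M : T -> 'M[R]_d) :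
  (forall i j, measurable_fun [set: T] (fun t => M t i j)) ->
  (forall t, covariance_matrix (M t)) ->
  measurable_fun [set: T] (fun t => \tr (sqrtm (M t))).
Proof.
move=> mM hM; pose c t := (1 + \tr (M t))^-1.
have tr0 t : 0 <= \tr (M t).
  rewrite -[M t]mulmx1 -[X in X *m _]mul1mx -{2}trmx1; exact: covariance_conj_ge0.
have c0 t : 0 < c t by rewrite invr_gt0 ltr_pwDl.
have mtr (N : T -> 'M[R]_d) : (forall i j, measurable_fun [set: T] (fun t => N t i j)) ->
    measurable_fun [set: T] (fun t => \tr (N t)).
  by move=> mN; apply: measurable_sum => i; exact: mN.
have mc : measurable_fun [set: T] c.
  apply: measurable_inv_pos => [|t]; first by apply: measurable_funD => //; exact: mtr.
  by rewrite ltr_pwDl.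
have mI k i j : measurable_fun [set: T] (fun t => mx_sqrt_iter (c t *: M t) k i j).
  elim: k i j => [|k IH] i j /=; first by under eq_fun do rewrite mxE; exact: measurable_cst.
  under eq_fun do rewrite !mxE.
  apply: measurable_funD => //; apply: measurable_funM => //.
  apply: measurable_funB; first exact: measurable_funM.
  by apply: measurable_sum => l; exact: measurable_funM.
have -> : (fun t => \tr (sqrtm (M t))) =
    (fun t => (Num.sqrt (c t))^-1 * \tr (sqrtm (c t *: M t))).
  apply/funext => t; rewrite sqrtmZ ?(ltW (c0 t))// mxtraceZ mulKf//.
  by rewrite gt_eqF// sqrtr_gt0.
apply: measurable_funM.
  apply: measurable_inv_pos => [|t]; last by rewrite sqrtr_gt0.
  apply: measurableT_comp => //; apply: continuous_measurable_fun.
  exact: sqrt_continuous.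
apply: (@measurable_fun_cvg _ _ _ _ (fun k t => \tr (mx_sqrt_iter (c t *: M t) k))).
  by move=> k; apply: mtr => i j; exact: mI.
move=> t _; apply: cvg_trace_sqrt_iter; first by apply: covarianceZ => //; exact: ltW.
by rewrite mxtraceZ /c mulrC ler_pdivrMr ?mul1r ?ltr_pwDl// lerDr.
Qed.

End sqrt_iteration.

(** * A central limit theorem *)

Section test_functions.
Context {R : realType}.
Local Notation N := (@normal_prob R 0 1).
Local Notation TR := (measurableTypeR R).

(* [g1] and [g2] play the part of the first two derivatives of [g]; only the
   uniform third order remainder is needed. *)
Record taylor2 (B C : R) (g g1 g2 : TR -> R) : Prop := {
  taylor2_mg : measurable_fun [set: TR] g;
  taylor2_mg1 : measurable_fun [set: TR] g1;
  taylor2_mg2 : measurable_fun [set: TR] g2;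
  taylor2_bg : forall x, `|g x| <= B;
  taylor2_bg1 : forall x, `|g1 x| <= B;
  taylor2_bg2 : forall x, `|g2 x| <= B;
  taylor2_rem : forall x y : R,
    `|g (x + y) - (g x + g1 x * y + g2 x / 2 * y ^+ 2)| <= C * `|y| ^+ 3 }.

(** The first order term has mean 0 and the second depends only on the variance, so two centered
    laws of the same variance share this expansion. *)
Lemma taylor2_expectation B C g g1 g2 d (T : measurableType d) (P : probability T R)
    (xi : T -> R) (h x v : R) : taylor2 B C g g1 g2 -> 0 <= h ->
  measurable_fun [set: T] xi -> (forall p, intg P (fun t => xi t ^+ p)) ->
  intg P (fun t => `|xi t| ^+ 3) ->
  \int[P]_t xi t = 0 -> \int[P]_t (xi t ^+ 2) = v ->
  `|\int[P]_t g (x + h * xi t) - (g x + g2 x / 2 * (h ^+ 2 * v))| <=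
    C * (h ^+ 3 * \int[P]_t (`|xi t| ^+ 3)).
Proof.
move=> tg h0 mxi ixi i3 E1 E2.
have i1 : intg P xi by have := ixi 1.
have i2 := ixi 2.
have mgx : measurable_fun [set: T] (fun t => g (x + h * xi t)).
  apply: (@measurableT_comp _ _ _ _ _ _ g _ (fun t => x + h * xi t : TR)); first exact: taylor2_mg tg.
  by apply: measurable_funD => //; exact: measurable_funM.
have ig : intg P (fun t => g (x + h * xi t)).
  by apply: (intg_bounded P mgx) => t; exact: taylor2_bg tg _.
have -> : g x + g2 x / 2 * (h ^+ 2 * v) =
    \int[P]_t (g x + (g1 x * h * xi t + g2 x / 2 * h ^+ 2 * xi t ^+ 2)).
  rewrite meanD; [|exact: intg_cst|by apply: intgD; exact: intgZ].
  by rewrite meanD ?meanZ ?E1 ?E2 ?mean_cst//; [ring|exact: intgZ|exact: intgZ].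
rewrite -meanB//; last first.
  by apply: intgD; [exact: intg_cst|apply: intgD; exact: intgZ].
rewrite mulrA -meanZ//; apply: norm_mean_le.
- apply: intgB => //.
  by apply: intgD; [exact: intg_cst|apply: intgD; exact: intgZ].
- exact: intgZ.
- move=> t; have := taylor2_rem tg x (h * xi t).
  rewrite normrM (ger0_norm h0) exprMn mulrA.
  by congr (`| _ - _| <= _); ring.
Qed.

Definition gauss_smooth (s : R) (g : TR -> R) (x : TR) : R := \int[N]_z g (x + s * z).

Lemma measurable_shift_scale (s x : R) (g : TR -> R) : measurable_fun [set: TR] g ->
  measurable_fun [set: TR] (fun z : TR => g (x + s * z)).
Proof.
move=> mg; apply: (@measurableT_comp _ _ _ _ _ _ g _ (fun z : TR => x + s * z : TR)) => //.
by apply: measurable_funD => //; exact: measurable_funM.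
Qed.

Lemma intg_shift_scale (s x B : R) (g : TR -> R) : measurable_fun [set: TR] g ->
  (forall y, `|g y| <= B) -> intg N (fun z : TR => g (x + s * z)).
Proof.
move=> mg gB; apply: (@intg_bounded _ _ _ N _ B); last by move=> z; exact: gB.
exact: measurable_shift_scale.
Qed.

Lemma gauss_smooth_bounded (s B : R) (g : TR -> R) : measurable_fun [set: TR] g -> (forall y, `|g y| <= B) ->
  forall x, `|gauss_smooth s g x| <= B.
Proof.
move=> mg gB x; rewrite /gauss_smooth -[leRHS](@mean_cst _ _ _ N).
apply: norm_mean_le => //; [exact: intg_shift_scale gB|exact: intg_cst].
Qed.

Lemma measurable_gauss_smooth (s : R) (g : TR -> R) : measurable_fun [set: TR] g ->
  measurable_fun [set: TR] (gauss_smooth s g).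
Proof.
move=> mg; apply: (measurable_Rintegral_section N (F := fun z : TR * TR => g (z.1 + s * z.2))).
apply: (@measurableT_comp _ _ _ _ _ _ g _ (fun z : TR * TR => z.1 + s * z.2 : TR)) => //.
apply: measurable_funD; first exact: measurable_fst.
by apply: measurable_funM => //; exact: measurable_snd.
Qed.

(** Smoothing averages translates of g, so B and C are inherited without change; the swapping needs
    them uniform over all its steps. *)
Lemma taylor2_gauss_smooth s B C g g1 g2 : taylor2 B C g g1 g2 ->
  taylor2 B C (gauss_smooth s g) (gauss_smooth s g1) (gauss_smooth s g2).
Proof.
move=> tg; have [mg mg1 mg2 bg bg1 bg2 rem] := tg; split.
- exact: measurable_gauss_smooth.
- exact: measurable_gauss_smooth.
- exact: measurable_gauss_smooth.
- exact: gauss_smooth_bounded.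
- exact: gauss_smooth_bounded.
- exact: gauss_smooth_bounded.
move=> x y; rewrite /gauss_smooth.
have i0 := intg_shift_scale s (x + y) mg bg; have ix := intg_shift_scale s x mg bg.
have i1 := intg_shift_scale s x mg1 bg1; have i2 := intg_shift_scale s x mg2 bg2.
have ->: \int[N]_z g (x + y + s * z) - (\int[N]_z g (x + s * z) +
    \int[N]_z g1 (x + s * z) * y + \int[N]_z g2 (x + s * z) / 2 * y ^+ 2) =
  \int[N]_z (g (x + y + s * z) - (g (x + s * z) + (y * g1 (x + s * z) + (y ^+ 2 / 2) * g2 (x + s * z)))).
  rewrite meanB//; last by apply: intgD => //; apply: intgD; exact: intgZ.
  rewrite meanD//; last by apply: intgD; exact: intgZ.
  rewrite meanD ?meanZ//; [|exact: intgZ|exact: intgZ].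
  by congr (_ - _); ring.
rewrite -[leRHS](@mean_cst _ _ _ N); apply: norm_mean_le; [|exact: intg_cst|].
  apply: intgB => //; apply: intgD => //; apply: intgD; exact: intgZ.
move=> z; have := rem (x + s * z) y; rewrite (_ : x + s * z + y = x + y + s * z); last by ring.
by congr (`| _ - _| <= _); ring.
Qed.

(** The plane rotation with cosine s / r and sine t / r turns r z into s z + t w. Adding B makes the
    integrand nonnegative, as the rotation lemma requires. *)
Lemma gauss_smooth_comp (B s t r : R) (g : TR -> R) : measurable_fun [set: TR] g -> (forall y, `|g y| <= B) ->
  0 < r -> s ^+ 2 + t ^+ 2 = r ^+ 2 ->
  gauss_smooth s (gauss_smooth t g) = gauss_smooth r g.
Proof.
move=> mg gB r0 str; apply/funext => x.
have rn : r != 0 by rewrite gt_eqF.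
have cs : (s / r) ^+ 2 + (t / r) ^+ 2 = 1 by rewrite !expr_div_n -mulrDl str divff// sqrf_eq0.
pose F (z : TR * TR) := ((g (x + r * z.1) + B)%:E : \bar R).
have mF : measurable_fun [set: TR * TR] F.
  apply/measurable_EFinP; apply: measurable_funD => //.
  apply: (@measurableT_comp _ _ _ _ _ _ g _ (fun z : TR * TR => x + r * z.1 : TR)) => //.
  apply: measurable_funD => //.
  by apply: measurable_funM => //; exact: measurable_fst.
have F0 z : (0 <= F z)%E.
  by rewrite lee_fin; have := gB (x + r * z.1); rewrite ler_norml => /andP[H _]; lra.
have ix := intg_shift_scale r x mg gB.
have mU := measurable_gauss_smooth t mg; have bU := gauss_smooth_bounded t mg gB.
have := ge0_normal_rotation cs mF F0.
rewrite /F /rotation2/=.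
have -> : (\int[N]_x0 \int[N]_y (g (x + r * x0) + B)%:E = (gauss_smooth r g x + B)%:E)%E.
  under eq_integral do rewrite integral_cst//= probability_setT mule1.
  by rewrite EFin_mean ?meanD ?mean_cst//; [exact: intg_cst|apply: intgD => //; exact: intg_cst].
have -> : (\int[N]_x0 \int[N]_y (g (x + r * (s / r * x0 + t / r * y)) + B)%:E =
    (gauss_smooth s (gauss_smooth t g) x + B)%:E)%E.
  rewrite -(@mean_cst _ _ _ N B) -meanD; [|exact: intg_shift_scale bU|exact: intg_cst].
  rewrite -EFin_mean; last by apply: intgD; [exact: intg_shift_scale bU|exact: intg_cst].
  apply: eq_integral => z _.
  have iz := intg_shift_scale t (x + s * z) mg gB.
  rewrite -{2}(@mean_cst _ _ _ N B) -meanD//; last exact: intg_cst.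
  rewrite -EFin_mean; last by apply: intgD => //; exact: intg_cst.
  apply: eq_integral => w _; congr (g _ + _)%:E; last by rewrite mean_cst.
  by field.
by move=> [] /addIr.
Qed.

(** Substitution x = s z in the density, applied to f + B, which is nonnegative. *)
Lemma normal_prob_scale (s B : R) (f : TR -> R) : 0 < s -> continuous (f : R -> R) ->
  (forall y, `|f y| <= B) -> \int[normal_prob 0 s]_x f x = gauss_smooth s f 0.
Proof.
move=> s0 cf fB.
have mf : measurable_fun [set: TR] f by exact: continuous_measurable_fun.
have ix := intg_shift_scale s 0 mf fB.
have ins : intg (normal_prob 0 s) f by apply: (intg_bounded _ mf fB).
suff : (\int[normal_prob 0 s]_x (f x + B)%:E = \int[N]_z (f (0 + s * z) + B)%:E)%E.
  have e1 : \int[normal_prob 0 s]_x (f x + B) = \int[normal_prob 0 s]_x f x + B.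
    by rewrite (meanD ins (intg_cst _ B)) mean_cst.
  have e2 : \int[N]_z (f (0 + s * z) + B) = gauss_smooth s f 0 + B.
    by apply: etrans (meanD ix (intg_cst _ B)) _; congr (_ + _); exact: mean_cst.
  move=> E; apply: (@addIr _ B).
  exact: etrans (esym e1) (etrans (congr1 fine E) e2).
have fB0 x : 0 <= f x + B by have := fB x; rewrite ler_norml => /andP[H _]; lra.
have mfB : measurable_fun [set: TR] (fun x => (f x + B)%:E).
  by apply/measurable_EFinP; exact: measurable_funD.
have mfB' : measurable_fun [set: TR] (fun z : TR => (f (0 + s * z) + B)%:E).
  by apply/measurable_EFinP; apply: measurable_funD => //; exact: measurable_shift_scale.
have fBE x : (0 <= (f x + B)%:E)%E by rewrite lee_fin fB0.
apply: etrans (ge0_integral_normal_prob 0 s mfB fBE) _.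
apply: etrans _ (esym (ge0_integral_normal_prob 0 1 mfB' (fun z => fBE _))).
pose G (x : R) := (f x + B) * normal_pdf 0 s x.
pose F (z : R^o) : R^o := s * z.
have sn : s != 0 by rewrite gt_eqF.
have F'E : F^`()%classic = cst s.
  apply/funext => z; rewrite /F derive1E deriveM// derive_cst derive_id.
  by rewrite scaler0 addr0 /GRing.scale/= mulr1.
transitivity (\int[lebesgue_measure]_x (((G \o F) * F^`()%classic) x)%:E)%E.
  rewrite -increasing_ge0_integration_by_substitutionT//.
  - by move=> x y xy; rewrite /F ltr_pM2l.
  - by rewrite F'E => ?; exact: cvg_cst.
  - by rewrite F'E; exact: is_cvg_cst.
  - by rewrite F'E; exact: is_cvg_cst.
  - by apply: gt0_cvgMrNy => //; exact: cvg_id.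
  - by apply: gt0_cvgMry => //; exact: cvg_id.
  - move=> x; apply: cvgM; last exact: continuous_normal_pdf.
    by apply: cvgD; [exact: cf|exact: cvg_cst].
  - by move=> x; rewrite /G mulr_ge0 ?normal_pdf_ge0.
apply: eq_integral => z _; rewrite -EFinM; congr EFin.
rewrite F'E add0r; transitivity ((f (s * z) + B) * (normal_pdf 0 s (s * z) * s)).
  by rewrite mulrA.
congr (_ * _).
rewrite !normal_pdfE ?oner_eq0// /normal_fun !subr0 mulrAC; congr (_ * expR _); last by field.
rewrite /normal_peak expr1n mul1r -mulrnAr sqrtrM ?sqr_ge0//.
by rewrite sqrtr_sqr gtr0_norm// invfM mulrAC mulVf// mul1r.
Qed.

End test_functions.

(** * Independence of the past and the next observation *)

Section independence.
Context {d0 : measure_display} {T : measurableType d0} {R : realType} (P : probability T R).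
Context {d1 : measure_display} {T' : measurableType d1}.
Variables (X : nat -> {RV P >-> T'}) (L : probability T' R).
Hypothesis hX : iid X L.

(* The pi-system of cylinders generating the past of X k. *)
Let cyl (k : nat) : set (set T) := [set E | exists A : nat -> set T',
  (forall i, measurable (A i)) /\ E = \bigcap_(i in [set` iota 0 k]) (X i @^-1` A i)].

Let iotaE n (i : nat) : [set` iota 0 n] i <-> (i < n)%N.
Proof. by rewrite -[X in X <-> _]/(is_true (i \in iota 0 n)) mem_iota. Qed.

Let mXpre i B : measurable B -> measurable (X i @^-1` B).
Proof. by move=> mB; rewrite -[X in measurable X]setTI; exact: measurable_funP. Qed.

Let cyl_measurable k : cyl k `<=` measurable.
Proof.
move=> _ [A [mA ->]]; rewrite bigcap_seq; apply: bigsetI_measurable => i _; exact: mXpre.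
Qed.

Let cyl_setI k : setI_closed (cyl k).
Proof.
move=> _ _ [A [mA ->]] [B [mB ->]]; exists (fun i => A i `&` B i); split.
  by move=> i; exact: measurableI.
rewrite -bigcapI; apply: eq_bigcapr => i _; by rewrite preimage_setI.
Qed.

Let cylT k : cyl k setT.
Proof.
exists (fun=> setT); split=> //.
by apply/seteqP; split => // t _ i _.
Qed.

(** For fixed B both sides are finite measures in E, and they agree on the cylinders, a
    pi-system. *)
Let past_indep k E B : <<s cyl k >> E -> measurable B ->
  P (E `&` X k @^-1` B) = (P E * P (X k @^-1` B))%E.
Proof.
move=> sE mB; have mC := mXpre k mB.
have pB : P (X k @^-1` B) \is a fin_num by exact: fin_num_measure.
pose c := NngNum (fine_ge0 (measure_ge0 P (X k @^-1` B))).
have -> : (P E * P (X k @^-1` B) = mscale c P E)%E.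
  by rewrite /mscale/= fineK// muleC.
rewrite -[LHS]/(mrestr P mC E).
apply: (g_sigma_algebra_measure_unique (cyl k) (@cyl_measurable k) (fun=> setT)) => //.
- by apply/seteqP; split => // t _; exists 0%N.
- move=> _ [A [mA ->]].
  rewrite -[LHS]/(P (_ `&` X k @^-1` B)) -[RHS]/((c%:num)%:E * P _)%E /= fineK//.
  (* Adding the constraint on X k turns a cylinder over k indices into one over k + 1, to which
     mutual independence applies. *)
  pose A' i := if i == k then B else A i.
  have mA' i : measurable (A' i) by rewrite /A'; case: ifP.
  have e1 : \bigcap_(i in [set` iota 0 k]) (X i @^-1` A i) =
      \bigcap_(i in [set` iota 0 k]) (X i @^-1` A' i).
    by apply: eq_bigcapr => i /iotaE ik; rewrite /A' ltn_eqF.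
  have e2 : \bigcap_(i in [set` iota 0 k]) (X i @^-1` A i) `&` X k @^-1` B =
      \bigcap_(i in [set` iota 0 k.+1]) (X i @^-1` A' i).
    rewrite e1; apply/seteqP; split => [t [H1 H2] i|t H].
      move=> /iotaE; rewrite ltnS leq_eqVlt => /orP[/eqP ->|ik].
        by rewrite /A' /= eqxx.
      by apply: H1; exact/iotaE.
    split=> [i /iotaE ik|].
      by apply: H; apply/iotaE; rewrite ltnS ltnW.
    have Hk : [set` iota 0 k.+1] k by exact/iotaE.
    by have := H k Hk; rewrite /A' /= eqxx.
  rewrite e2 e1 (hX.1 _ _ (iota_uniq _ _) mA') (hX.1 _ _ (iota_uniq _ _) mA').
  by rewrite -(addn1 k) iotaD big_cat/= big_seq1 add0n muleC /A' eqxx.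
- move=> _; rewrite -[X in (X < _)%E]/(P (setT `&` X k @^-1` B)) setTI.
  by rewrite (le_lt_trans (probability_le1 P mC))// ltry.
Qed.

Variable xi : T' -> R.
Hypothesis mxi : measurable_fun [set: T'] xi.

Definition partial_sum (k : nat) (t : T) : R := \sum_(i < k) xi (X i t).

Lemma measurable_partial_sum k : measurable_fun [set: T] (partial_sum k).
Proof. by apply: measurable_sum => i; exact: measurableT_comp. Qed.

(** [GT] is T with the sigma-algebra of the past. Each X i with i < k is measurable for it, through
    cylinders with one nontrivial side. *)
Let past_partial_sum k B : measurable B -> <<s cyl k >> (partial_sum k @^-1` B).
Proof.
move=> mB; pose GT := g_sigma_algebraType (cyl k).
have mX i : (i < k)%N -> measurable_fun [set: GT] (X i : GT -> T').
  move=> ik _ Y mY; rewrite setTI; apply: sub_sigma_algebra.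
  exists (fun j => if j == i then Y else setT); split.
    by move=> j; case: ifP.
  apply/seteqP; split => t /=.
    by move=> XY j _; rewrite /=; case: eqP => // ->.
  by move=> /(_ i); rewrite /= eqxx mem_iota add0n ik; exact.
have mS : measurable_fun [set: GT] (partial_sum k : GT -> R).
  apply: measurable_sum => i.
  by apply: (measurableT_comp mxi); exact: mX.
by have := mS measurableT B mB; rewrite setTI.
Qed.

(** The partial sum and X k have the product of their laws as joint law, so Tonelli integrates X k
    out with the partial sum frozen. *)
Lemma ge0_joint_partial_sum k (F : measurableTypeR R * T' -> \bar R) :
  measurable_fun [set: measurableTypeR R * T'] F -> (forall z, 0 <= F z)%E ->
  (\int[P]_t F (partial_sum k t, X k t) = \int[P]_t \int[L]_y F (partial_sum k t, y))%E.
Proof.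
move=> mF F0.
have mS : measurable_fun [set: T] (partial_sum k : T -> measurableTypeR R).
  exact: measurable_partial_sum.
have mJ : measurable_fun [set: T] (fun t => (partial_sum k t : measurableTypeR R, X k t)).
  by apply/measurable_fun_pair => //; exact: measurable_funP.
have Je A : measurable A ->
    (distribution P (mfun_of mS) \x L)%E A = distribution P (mfun_of mJ) A.
  apply: product_measure_unique => B C mB mC.
  rewrite /distribution /pushforward/=.
  transitivity (P (partial_sum k @^-1` B `&` X k @^-1` C)).
    by congr (P _); apply/seteqP; split => t.
  rewrite past_indep//; last exact: past_partial_sum.
  by congr (_ * _)%E; rewrite -(hX.2 k C mC).
transitivity (\int[distribution P (mfun_of mJ)]_z F z)%E.
  by rewrite ge0_integral_distribution.
transitivity (\int[(distribution P (mfun_of mS) \x L)%E]_z F z)%E.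
  by apply: eq_measure_integral => A mA _; rewrite [LHS]/= -Je.
rewrite fubini_tonelli1// ge0_integral_distribution//.
- exact: measurable_fun_fubini_tonelli_F.
- by move=> x; apply: integral_ge0.
Qed.

Lemma measurable_E_joint k (F : measurableTypeR R * T' -> R) :
  measurable_fun [set: measurableTypeR R * T'] F ->
  measurable_fun [set: T] (fun t => \int[L]_y F (partial_sum k t, y)).
Proof.
move=> mF; have mU := measurable_Rintegral_section L mF.
apply: (@measurableT_comp _ _ _ _ _ _ (fun x : measurableTypeR R => \int[L]_y F (x, y)) _ (partial_sum k : T -> measurableTypeR R)) => //.
exact: measurable_partial_sum.
Qed.

Lemma E_joint_partial_sum k (F : measurableTypeR R * T' -> R) B :
  measurable_fun [set: measurableTypeR R * T'] F -> (forall z, `|F z| <= B) ->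
  \int[P]_t F (partial_sum k t, X k t) = \int[P]_t \int[L]_y F (partial_sum k t, y).
Proof.
move=> mF FB.
have mFx x : measurable_fun [set: T'] (fun y => F (x, y)) by exact: measurableT_comp.
have iFx x : intg L (fun y => F (x, y)).
  by apply: (intg_bounded L (mFx x)) => y; exact: FB.
have FB0 z : 0 <= F z + B by have := FB z; rewrite ler_norml => /andP[H _]; lra.
have mFB : measurable_fun [set: measurableTypeR R * T'] (fun z => (F z + B)%:E).
  by apply/measurable_EFinP; exact: measurable_funD.
have H := @ge0_joint_partial_sum k (fun z => (F z + B)%:E) mFB FB0.
have mS : measurable_fun [set: T] (partial_sum k : T -> measurableTypeR R).
  exact: measurable_partial_sum.
have mJ : measurable_fun [set: T] (fun t => F (partial_sum k t, X k t)).
  apply: (@measurableT_comp _ _ _ _ _ _ F _ (fun t => (partial_sum k t : measurableTypeR R, X k t))) => //.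
  by apply/measurable_fun_pair => //; exact: measurable_funP.
have iJ : intg P (fun t => F (partial_sum k t, X k t)).
  by apply: (intg_bounded P mJ) => t; exact: FB.
have UE x : (\int[L]_y (F (x, y) + B)%:E = (\int[L]_y F (x, y) + B)%:E)%E.
  rewrite (EFin_mean (intgD (iFx x) (intg_cst _ B))); congr EFin.
  by apply: etrans (meanD (iFx x) (intg_cst _ B)) _; congr (_ + _); exact: mean_cst.
have UB x : `|\int[L]_y F (x, y)| <= B.
  rewrite -[leRHS](@mean_cst _ _ _ L); apply: norm_mean_le => //; exact: intg_cst.
have mU' := measurable_E_joint k mF.
have iU : intg P (fun t => \int[L]_y F (partial_sum k t, y)).
  by apply: (intg_bounded P mU') => t; exact: UB.
apply: (@addIr _ B).
apply: etrans (_ : _ = \int[P]_t (F (partial_sum k t, X k t) + B)) _.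
  by apply/esym; apply: etrans (meanD iJ (intg_cst _ B)) _; congr (_ + _); exact: mean_cst.
apply: etrans (_ : _ = \int[P]_t (\int[L]_y F (partial_sum k t, y) + B)) _; last first.
  by apply: etrans (meanD iU (intg_cst _ B)) _; congr (_ + _); exact: mean_cst.
congr fine; rewrite H; apply: eq_integral => t _; exact: UE.
Qed.

Hypothesis ixi2 : forall p, intg L (fun y => xi y ^+ p).
Hypothesis Exi : \int[L]_y xi y = 0.

(** Cross terms vanish because xi is centered. The induction runs on integrals of nonnegative
    functions, so integrability is a conclusion rather than a premise. *)
Lemma E_sqr_partial_sum k :
  intg P (fun t => partial_sum k t ^+ 2) /\
  \int[P]_t (partial_sum k t ^+ 2) = k%:R * \int[L]_y (xi y ^+ 2).
Proof.
set v := \int[L]_y (xi y ^+ 2).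
have ix1 : intg L xi by have := ixi2 1.
have ix2 := ixi2 2.
suff H : (\int[P]_t (partial_sum k t ^+ 2)%:E = (k%:R * v)%:E)%E.
  have ik : intg P (fun t => partial_sum k t ^+ 2).
    apply: ge0_intg; first by apply: measurable_funX; exact: measurable_partial_sum.
      by move=> t; exact: sqr_ge0.
    by rewrite H ltry.
  by split => //; rewrite /Rintegral H.
have v0 : 0 <= v by apply: mean_ge0 => y; exact: sqr_ge0.
elim: k => [|k IH].
  under eq_integral do rewrite /partial_sum big_ord0 expr0n/=.
  by rewrite integral0 mul0r.
under eq_integral do rewrite /partial_sum big_ord_recr/=.
have mF : measurable_fun [set: measurableTypeR R * T'] (fun z => ((z.1 + xi z.2) ^+ 2)%:E).
  apply/measurable_EFinP; apply: measurable_funX; apply: measurable_funD.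
    exact: measurable_fst.
  by apply: measurableT_comp => //; exact: measurable_snd.
rewrite (@ge0_joint_partial_sum k (fun z => ((z.1 + xi z.2) ^+ 2)%:E))//=; last first.
  by move=> z; rewrite lee_fin sqr_ge0.
transitivity (\int[P]_t ((partial_sum k t ^+ 2)%:E + v%:E))%E.
  apply: eq_integral => t _; set s := partial_sum k t.
  have e : (fun y => (s + xi y) ^+ 2) = (fun y => s ^+ 2 + (2 * s * xi y + xi y ^+ 2)).
    by apply/funext => y; ring.
  have ii : intg L (fun y => s ^+ 2 + (2 * s * xi y + xi y ^+ 2)).
    by apply: intgD; [exact: intg_cst|apply: intgD => //; exact: intgZ].
  rewrite -EFinD (_ : s ^+ 2 + v = \int[L]_y (s ^+ 2 + (2 * s * xi y + xi y ^+ 2))).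
    by rewrite -EFin_mean//; apply: eq_integral => y _; congr EFin; ring.
  rewrite meanD; [|exact: intg_cst|by apply: intgD => //; exact: intgZ].
  by rewrite mean_cst meanD ?meanZ ?Exi ?mulr0 ?add0r//; exact: intgZ.
rewrite ge0_integralD//.
- by rewrite IH integral_cst//= probability_setT mule1 -EFinD -natr1 mulrDl mul1r.
- by move=> t _; rewrite lee_fin sqr_ge0.
- by apply/measurable_EFinP; apply: measurable_funX; exact: measurable_partial_sum.
Qed.

End independence.

(** * Lindeberg's swapping argument *)

Section lindeberg.
Context {d0 : measure_display} {T : measurableType d0} {R : realType} (P : probability T R).
Context {d1 : measure_display} {T' : measurableType d1}.
Variables (X : nat -> {RV P >-> T'}) (L : probability T' R).
Hypothesis hX : iid X L.
Variable xi : T' -> R.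
Hypothesis mxi : measurable_fun [set: T'] xi.
Hypothesis ixi : forall p, intg L (fun y => xi y ^+ p).
Hypothesis Exi : \int[L]_y xi y = 0.
Local Notation N := (@normal_prob R 0 1).
Local Notation TR := (measurableTypeR R).

(** Follows from |x|^3 <= 1 + x^4. *)
Lemma intg_norm3 d (U : measurableType d) (Q : probability U R) (f : U -> R) :
  measurable_fun [set: U] f -> (forall p, intg Q (fun y => f y ^+ p)) ->
  intg Q (fun y => `|f y| ^+ 3).
Proof.
move=> mf fi; apply: (@intg_le _ _ _ Q _ (fun y => 1 + f y ^+ 4)).
- by apply: measurable_funX; exact: measurableT_comp.
- move=> y; rewrite ger0_norm ?exprn_ge0//.
  have -> : f y ^+ 4 = `|f y| ^+ 4 by rewrite -normrX ger0_norm// exprn_even_ge0.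
  have := normr_ge0 (f y); set a := `|f y| => a0.
  have [a1|a1] := leP a 1.
    have : a ^+ 3 <= 1 by apply: exprn_ile1.
    have : 0 <= a ^+ 4 by exact: exprn_ge0.
    lra.
  have : a ^+ 3 <= a ^+ 4 by rewrite ler_weXn2l// ltW.
  lra.
- by apply: intgD => //; exact: intg_cst.
Qed.

Let v := \int[L]_y (xi y ^+ 2).
Hypothesis v0 : 0 < v.

Section fixed_test.
Variables (B C : R) (g g1 g2 : TR -> R).
Hypothesis tg : taylor2 B C g g1 g2.

Let K1 := \int[L]_y (`|xi y| ^+ 3).
Let K2 := \int[N]_z (`|z| ^+ 3).
Let s := Num.sqrt v.

Let s0 : 0 < s. Proof. by rewrite sqrtr_gt0. Qed.
Let s2 : s ^+ 2 = v. Proof. by rewrite sqr_sqrtr// ltW. Qed.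

(** The summand h xi and the Gaussian s h z both have mean 0 and variance h^2 v, so both
    expectations are within third order of the same expansion p. *)
Let lindeberg_step (h t x : R) : 0 < h ->
  `|\int[L]_y gauss_smooth t g (x + h * xi y) - gauss_smooth (s * h) (gauss_smooth t g) x| <=
  h ^+ 3 * (C * (K1 + s ^+ 3 * K2)).
Proof.
move=> h0; have tu := taylor2_gauss_smooth t tg; set u := gauss_smooth t g.
have iN p : intg N (fun z : TR => (z : R) ^+ p) by exact: integrable_normal_exp.
have mid : measurable_fun [set: TR] (id : TR -> R) by [].
have i3 := intg_norm3 mid iN.
have E1 : \int[N]_z (z : R) = 0 by have := @normal_moment_odd R 1 erefl.
have E2 : \int[N]_z ((z : R) ^+ 2) = 1 by exact: normal_moment2.
have sh0 : 0 <= s * h by rewrite mulr_ge0 ?ltW.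
have A1 := taylor2_expectation x tu (ltW h0) mxi ixi (intg_norm3 mxi ixi) Exi erefl.
have A2 := taylor2_expectation x tu sh0 mid iN i3 E1 E2.
rewrite -/v -/K1 in A1; rewrite -/K2 exprMn s2 mulr1 in A2.
rewrite [v * _]mulrC in A2; move: A1 A2; set p := (X in `|_ - X| <= _ -> _) => A1 A2.
rewrite -[X in `|X - _|](subrK p) -addrA.
apply: (le_trans (ler_normD _ _)).
rewrite [`|p - _|]distrC.
apply: (le_trans (lerD A1 A2)).
by rewrite exprMn le_eqVlt; apply/orP; left; apply/eqP; ring.
Qed.

(* Lindeberg's swapping: the summands are replaced one at a time by independent
   N(0, v / n) variables, whose effect on [g] is a Gaussian smoothing. *)
Theorem lindeberg_bound n : (0 < n)%N ->
  `|\int[P]_t g ((Num.sqrt n%:R)^-1 * partial_sum X xi n t) - gauss_smooth s g 0| <=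
  (Num.sqrt n%:R)^-1 * (C * (K1 + s ^+ 3 * K2)).
Proof.
move=> n0; set h := (Num.sqrt n%:R)^-1; set c := C * _.
have rn0 : 0 < Num.sqrt n%:R :> R by rewrite sqrtr_gt0 ltr0n.
have h0 : 0 < h by rewrite invr_gt0.
have hn : h ^+ 2 * n%:R = 1.
  by rewrite /h exprVn sqr_sqrtr ?ler0n// mulVf// pnatr_eq0 -lt0n.
(* j Gaussian summands of standard deviation s h, integrated out of g. *)
pose u j := gauss_smooth (s * h * Num.sqrt j%:R) g.
(* The first k summands are the given ones and the other n - k Gaussian: a interpolates from the
   Gaussian value at 0 to the sought expectation at n. *)
pose a k := \int[P]_t u (n - k)%N (h * partial_sum X xi k t).
have bg := taylor2_bg tg; have mg := taylor2_mg tg.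
have mu j : measurable_fun [set: TR] (u j) by exact: measurable_gauss_smooth.
have bu j x : `|u j x| <= B by exact: gauss_smooth_bounded.
have uS j : u j.+1 = gauss_smooth (s * h) (u j).
  rewrite /u (gauss_smooth_comp (r := s * h * Num.sqrt j.+1%:R) mg bg)//.
    by rewrite !mulr_gt0// sqrtr_gt0 ltr0n.
  have e k : Num.sqrt k%:R ^+ 2 = k%:R :> R by rewrite sqr_sqrtr ?ler0n.
  by rewrite !(exprMn _ (s * h)) !e -natr1 mulrDr mulr1 addrC.
have mS k : measurable_fun [set: T] (fun t => h * partial_sum X xi k t : TR).
  by apply: measurable_funM => //; exact: measurable_partial_sum.
have a0 : a 0%N = gauss_smooth s g 0.
  rewrite /a subn0 -[RHS](@mean_cst _ _ _ P); apply: eq_Rintegral => t _.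
  have e : s * h * Num.sqrt n%:R = s by rewrite -mulrA /h mulVf ?mulr1// gt_eqF.
  by rewrite /u e {1}/partial_sum big_ord0 mulr0.
have an : a n = \int[P]_t g (h * partial_sum X xi n t).
  rewrite /a subnn; apply: eq_Rintegral => t _.
  rewrite /u sqrtr0 mulr0 /gauss_smooth -[RHS](@mean_cst _ _ _ N); apply: eq_Rintegral => z _.
  by rewrite mul0r addr0.
have step k : (k < n)%N -> `|a k.+1 - a k| <= h ^+ 3 * c.
  move=> kn; set j := (n - k.+1)%N.
  have kj : (n - k = j.+1)%N by rewrite /j subnSK.
  pose F (z : TR * T') := u j (h * z.1 + h * xi z.2).
  have mF : measurable_fun [set: TR * T'] F.
    apply: (@measurableT_comp _ _ _ _ _ _ (u j) _ (fun z : TR * T' => h * z.1 + h * xi z.2 : TR)) => //.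
    apply: measurable_funD; (apply: measurable_funM; first exact: measurable_cst).
      exact: measurable_fst.
    by apply: measurableT_comp => //; exact: measurable_snd.
  have FB z : `|F z| <= B by exact: bu.
  have aS : a k.+1 = \int[P]_t \int[L]_y F (partial_sum X xi k t, y).
    rewrite -(E_joint_partial_sum hX mxi k mF FB) /a.
    by apply: eq_Rintegral => t _; rewrite /F/= -mulrDr /partial_sum big_ord_recr.
  rewrite aS /a kj uS.
  have mgs := measurable_gauss_smooth (s * h) (mu j).
  have bgs := gauss_smooth_bounded (s * h) (mu j) (bu j).
  have mG : measurable_fun [set: T] (fun t => gauss_smooth (s * h) (u j) (h * partial_sum X xi k t)).
    exact: measurableT_comp mgs (mS k).
  have iG : intg P (fun t => gauss_smooth (s * h) (u j) (h * partial_sum X xi k t)).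
    by apply: (intg_bounded P mG) => t; exact: bgs.
  have iF : intg P (fun t => \int[L]_y F (partial_sum X xi k t, y)).
    apply: (intg_bounded P (C := B)); last first.
      move=> t; rewrite -[leRHS](@mean_cst _ _ _ L); apply: norm_mean_le => //; last exact: intg_cst.
      apply: (@intg_bounded _ _ _ L _ B) => //.
      have mFx (x : TR) : measurable_fun [set: T'] (fun y => F (x, y)).
        exact: measurableT_comp mF (pair1_measurable x).
      exact: mFx.
    exact: measurable_E_joint mF.
  rewrite -meanB// -[leRHS](@mean_cst _ _ _ P); apply: norm_mean_le; [exact: intgB|exact: intg_cst|].
  by move=> t; have := lindeberg_step (s * h * Num.sqrt j%:R) (h * partial_sum X xi k t) h0.
(* n steps of order h^3 add up to order h, since n h^2 = 1. *)
rewrite -an -a0 -(telescope_sumr a (leq0n n)).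
apply: (le_trans (ler_norm_sum _ _ _)).
apply: (@le_trans _ _ (\sum_(0 <= k < n) h ^+ 3 * c)).
  by apply: ler_sum_nat => k /andP[_ kn]; exact: step.
rewrite sumr_const_nat subn0 -mulr_natl.
have -> : n%:R * (h ^+ 3 * c) = (h ^+ 2 * n%:R) * (h * c) by ring.
by rewrite hn mul1r.
Qed.

End fixed_test.

End lindeberg.

(** * Smoothness of Gaussian convolutions *)

Section gaussian_weight.
Context {R : realType}.
Local Notation N := (@normal_prob R 0 1).
Local Notation TR := (measurableTypeR R).

Lemma mvt_at0 (f f' : R -> R) (u : R) : (forall x : R, is_derive x 1 f (f' x)) ->
  exists2 c, `|c| <= `|u| & f u - f 0 = f' c * u.
Proof.
move=> df.
have cf : continuous f by move=> x; apply: differentiable_continuous; apply/derivable1_diffP; have := df x; case.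
have [u0|u0] := leP 0 u.
  have [] := @MVT_segment R f f' 0 u u0 (fun x _ => df x) (continuous_subspaceT cf).
  move=> c; rewrite in_itv/= => /andP[c0 cu] E; exists c.
    by rewrite !ger0_norm.
  by rewrite E subr0.
have [] := @MVT_segment R f f' u 0 (ltW u0) (fun x _ => df x) (continuous_subspaceT cf).
move=> c; rewrite in_itv/= => /andP[cu c0] E; exists c.
  by rewrite !ler0_norm ?lerN2// ltW.
by rewrite -opprB E sub0r mulrN opprK.
Qed.

(** Three nested applications of the mean value theorem; the factor 1/6 is given up. *)
Lemma expR_taylor2 (u : R) : `|expR u - (1 + u + u ^+ 2 / 2)| <= `|u| ^+ 3 * expR `|u|.
Proof.
have e0 x : is_derive (x : R) 1 expR (expR x) by exact: is_derive_expR.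
have e1 x : is_derive (x : R) 1 (fun y : R => expR y - (1 + y)) (expR x - 1).
  by apply: is_derive_eq; rewrite add0r.
have e2 x : is_derive (x : R) 1 (fun y : R => expR y - (1 + y + y ^+ 2 / 2)) (expR x - (1 + x)).
  by apply: is_derive_eq; rewrite /GRing.scale/=; field.
have [c cu E] := mvt_at0 u e2; have [b bc E1] := mvt_at0 c e1; have [a ab E0] := mvt_at0 b e0.
move: E E1 E0; rewrite expR0 expr0n/= mul0r !addr0 subrr !subr0 => -> -> ->.
rewrite !normrM (ger0_norm (expR_ge0 a)).
have bu := le_trans bc cu; have au := le_trans ab bu.
have ea : expR a <= expR `|u| by rewrite ler_expR (le_trans (ler_norm a)).
rewrite mulrC !exprS expr0 mulr1 -!mulrA ler_wpM2l// [leRHS]mulrA [leRHS]mulrC.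
by rewrite !ler_pM// ?mulr_ge0 ?expR_ge0.
Qed.

Lemma ge0_cameron_martin (a : R) (f : TR -> \bar R) :
  measurable_fun [set: TR] f -> (forall x, 0 <= f x)%E ->
  (\int[N]_z f (z + a)%R = \int[N]_z (f z * (expR (a * z - a ^+ 2 / 2))%:E))%E.
Proof.
move=> mf f0.
have mrho : measurable_fun [set: TR] (fun z : TR => (expR (a * z - a ^+ 2 / 2))%:E).
  apply/measurable_EFinP; apply: (measurableT_comp (@measurable_expR R)).
  by apply: measurable_funB => //; exact: measurable_funM.
have msh : measurable_fun [set: TR] (fun z : TR => z + a : TR) by exact: measurable_funD.
have mfa : measurable_fun [set: TR] (fun z : TR => f (z + a)) by exact: measurableT_comp mf msh.
rewrite ge0_integral_normal_prob// ge0_integral_normal_prob; last 2 first.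
- exact: emeasurable_funM.
- by move=> x; rewrite mule_ge0// lee_fin expR_ge0.
have mpdf : measurable_fun [set: TR] (fun x : TR => (normal_pdf 0 1 x)%:E).
  by apply/measurable_EFinP; exact: measurable_normal_pdf.
rewrite -(@ge0_integral_lebesgue_shift _ a (fun x : R => f x * (expR (a * x - a ^+ 2 / 2))%:E * (normal_pdf 0 1 x)%:E)%E).
- apply: eq_integral => x _; rewrite -muleA -EFinM; congr (_ * EFin _)%E.
  rewrite !normal_pdfE ?oner_eq0// /normal_fun mulrCA -expRD; congr (_ * expR _).
  by rewrite !subr0 expr1n; field.
- by apply: emeasurable_funM => //; exact: emeasurable_funM.
- by move=> x; rewrite !mule_ge0// lee_fin ?expR_ge0 ?normal_pdf_ge0.
Qed.

(** The Cameron-Martin formula applied to a constant evaluates the integral. *)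
Lemma intg_normal_expR (t : R) : intg N (fun z : TR => expR (t * z)).
Proof.
have mrho : measurable_fun [set: TR] (fun z : TR => expR (t * z)).
  by apply: (measurableT_comp (@measurable_expR R)); exact: measurable_funM.
apply: ge0_intg => //.
pose f (z : TR) : \bar R := (expR (t ^+ 2 / 2))%:E.
have f0 x : (0 <= f x)%E by rewrite lee_fin expR_ge0.
have E := ge0_cameron_martin t (measurable_cst _ : measurable_fun [set: TR] f) f0.
have -> : (\int[N]_x (expR (t * x))%:E = (expR (t ^+ 2 / 2))%:E)%E; last by rewrite ltry.
transitivity (\int[N]_z f (z + t)%R)%E; last first.
  by rewrite /f integral_cst//= probability_setT mule1.
rewrite E; apply: eq_integral => z _.
by rewrite /f -EFinM -expRD; congr (expR _)%:E; ring.
Qed.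

(** With w = |z| + 1, the remainder below is at most 7 exp (2 w) |a|^3, and exp (2 w) <= e^2 (exp (2
    z) + exp (- 2 z)); the constant 28 leaves room. *)
Definition rho_bound (z : R) : R := 28 * expR 2 * (expR (2 * z) + expR (- 2 * z)).

Lemma intg_rho_bound : intg N rho_bound.
Proof. by apply: intgZ; apply: intgD; exact: intg_normal_expR. Qed.

(** Second order expansion in a of the density of the translated Gaussian. Restricting to |a| <= 1
    gives an integrable bound that does not depend on a. *)
Lemma rho_taylor2 (a z : R) : `|a| <= 1 ->
  `|expR (a * z - a ^+ 2 / 2) - (1 + a * z + a ^+ 2 / 2 * (z ^+ 2 - 1))| <= rho_bound z * `|a| ^+ 3.
Proof.
move=> a1; pose w : R := `|z| + 1; set u : R := a * z - a ^+ 2 / 2.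
have z0 := normr_ge0 z; have a0 := normr_ge0 a.
have w1 : 1 <= w by rewrite /w; lra.
have uw : `|u| <= `|a| * w.
  apply: (le_trans (ler_normB _ _)); rewrite normrM (ger0_norm (_ : 0 <= a ^+ 2 / 2)).
    by rewrite /w mulrDr mulr1 lerD2l -[a ^+ 2]real_normK ?num_real//; nra.
  by rewrite mulr_ge0 ?sqr_ge0.
have ew : expR `|u| <= expR w by rewrite ler_expR; nra.
have split : expR u - (1 + a * z + a ^+ 2 / 2 * (z ^+ 2 - 1)) =
    expR u - (1 + u + u ^+ 2 / 2) + a ^+ 3 * (- z / 2 + a / 8).
  by rewrite /u; field.
have w_exp : w <= expR w by have := expR_ge1Dx w; lra.
have w3_exp : w ^+ 3 <= 6 * expR w.
  have w0 : 0 <= w by lra.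
  have := expR_ge1Dxn 2 w0; rewrite (_ : 3`!%:R = 6)//; lra.
have e1 : 1 <= expR w by lra.
have rhoE : 28 * (expR w * expR w) <= rho_bound z.
  rewrite /rho_bound -mulrA ler_pM2l// -expRD.
  have -> : w + w = 2 + 2 * `|z| by rewrite /w; ring.
  rewrite expRD ler_pM2l ?expR_gt0//.
  have := expR_ge0 (2 * z); have := expR_ge0 (- 2 * z).
  have [zz|zz] := leP 0 z; first by rewrite ger0_norm//; lra.
  by rewrite ltr0_norm// mulrN -mulNr; lra.
rewrite split; apply: (le_trans (ler_normD _ _)).
apply: (@le_trans _ _ (`|a| ^+ 3 * (w ^+ 3 * expR w + w))); last first.
  rewrite mulrC ler_wpM2r ?exprn_ge0//; apply: le_trans rhoE.
  set e := expR w in w_exp w3_exp e1 *.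
  have : w ^+ 3 * e <= 6 * (e * e) by rewrite mulrA ler_wpM2r//; lra.
  have : w <= e * e by nra.
  nra.
rewrite [leRHS]mulrDr; apply: lerD.
  apply: (le_trans (expR_taylor2 u)).
  rewrite mulrA -exprMn ler_pM ?exprn_ge0 ?expR_ge0//.
  by rewrite lerXn2r ?nnegrE// mulr_ge0//; lra.
rewrite normrM normrX ler_wpM2l ?exprn_ge0//.
apply: (le_trans (ler_normD _ _)); rewrite !normrM normrN (ger0_norm (_ : 0 <= 2^-1)) ?invr_ge0// (ger0_norm (_ : 0 <= 8^-1)) ?invr_ge0//.
rewrite /w; lra.
Qed.

Lemma cameron_martin (a B : R) (f : TR -> R) : measurable_fun [set: TR] f ->
  (forall x, `|f x| <= B) ->
  \int[N]_z f (z + a) = \int[N]_z (f z * expR (a * z - a ^+ 2 / 2)).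
Proof.
move=> mf fB.
have rhoE z : expR (a * z - a ^+ 2 / 2) = expR (- (a ^+ 2 / 2)) * expR (a * z).
  by rewrite -expRD addrC.
have ir : intg N (fun z : TR => expR (a * z - a ^+ 2 / 2)).
  by under eq_fun do rewrite rhoE; apply: intgZ; exact: intg_normal_expR.
have mr := intg_meas ir.
have ifr : intg N (fun z : TR => f z * expR (a * z - a ^+ 2 / 2)).
  apply: (@intg_le _ _ _ N _ (fun z => B * expR (a * z - a ^+ 2 / 2))); last exact: intgZ.
    exact: measurable_funM.
  by move=> z; rewrite normrM (ger0_norm (expR_ge0 _)) ler_wpM2r ?expR_ge0.
have ms : measurable_fun [set: TR] (fun z : TR => f (z + a)).
  by apply: (@measurableT_comp _ _ _ _ _ _ f _ (fun z : TR => z + a : TR)) => //; exact: measurable_funD.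
have ish : intg N (fun z : TR => f (z + a)) by apply: (intg_bounded N ms) => z; exact: fB.
have fB0 x : (0 <= (f x + B)%:E)%E.
  by rewrite lee_fin; have := fB x; rewrite ler_norml => /andP[H _]; lra.
have mfB : measurable_fun [set: TR] (fun x => (f x + B)%:E).
  by apply/measurable_EFinP; exact: measurable_funD.
have := congr1 fine (ge0_cameron_martin a mfB fB0).
rewrite -/(Rintegral _ _ _) => E1.
(* At the constant 1 the formula says that the weight has mean 1, which removes the added B. *)
have := congr1 fine (ge0_cameron_martin a (measurable_cst (1%E : \bar R)) (fun=> lee01)).
have -> : fine (\int[N]_z cst 1%E (z + a)%R)%E = 1.
  by rewrite integral_cst//= probability_setT mule1.
have -> : fine (\int[N]_z (cst 1%E z * (expR (a * z - a ^+ 2 / 2))%:E))%E =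
    \int[N]_z expR (a * z - a ^+ 2 / 2).
  by congr fine; apply: eq_integral => z _; rewrite mul1e.
move=> E2; apply: (@addIr _ B).
transitivity (\int[N]_z (f (z + a) + B)).
  by apply/esym; apply: etrans (meanD ish (intg_cst _ B)) _; congr (_ + _); exact: mean_cst.
have E3 : \int[N]_z (B * expR (a * z - a ^+ 2 / 2)) = B.
  by apply: etrans (meanZ B ir) _; rewrite -E2 mulr1.
apply: etrans E1 _; apply: etrans (_ : _ = \int[N]_z (f z * expR (a * z - a ^+ 2 / 2) + B * expR (a * z - a ^+ 2 / 2))) _.
  by congr fine; apply: eq_integral => z _; rewrite -EFinM mulrDl.
by apply: etrans (meanD ifr (intgZ B ir)) _; congr (_ + _).
Qed.

Lemma intg_normal_sqrD1 : intg N (fun z : TR => z ^+ 2 + 1).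
Proof. by apply: intgD; [exact: integrable_normal_exp|exact: intg_cst]. Qed.

(* The derivatives of [gauss_smooth s f] fall on the Gaussian density, as the
   Hermite weights [z] and [z ^+ 2 - 1]. *)
Lemma taylor2_of_gauss_smooth (s B : R) (f : TR -> R) : 0 < s -> measurable_fun [set: TR] f ->
  (forall x, `|f x| <= B) ->
  exists B' C g1 g2, taylor2 B' C (gauss_smooth s f) g1 g2.
Proof.
move=> s0 mf fB.
have B0 : 0 <= B by exact: le_trans (normr_ge0 _) (fB 0).
have sn : s != 0 by rewrite gt_eqF.
pose g (w : TR -> R) (x : TR) := \int[N]_z (f (x + s * z) * w z).
have mid : measurable_fun [set: TR] (id : TR -> R) by [].
have mH2 : measurable_fun [set: TR] (fun z : TR => z ^+ 2 - 1 : R).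
  by apply: measurable_funB => //; exact: measurable_funX.
have mfx x := measurable_shift_scale s x mf.
have ifw (w u : TR -> R) x : measurable_fun [set: TR] w -> intg N u -> (forall z, `|w z| <= u z) ->
    intg N (fun z => f (x + s * z) * w z).
  move=> mw iu wu; apply: (@intg_le _ _ _ N _ (fun z => B * u z)); last exact: intgZ.
    by apply: measurable_funM => //; exact: mfx.
  by move=> z; rewrite normrM ler_pM.
have gle (w u : TR -> R) x : measurable_fun [set: TR] w -> intg N u -> (forall z, `|w z| <= u z) ->
    `|g w x| <= B * \int[N]_z u z.
  move=> mw iu wu; rewrite -meanZ//; apply: norm_mean_le; [exact: ifw wu|exact: intgZ|].
  by move=> z; rewrite normrM ler_pM.
have mg w : measurable_fun [set: TR] w -> measurable_fun [set: TR] (g w).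
  move=> mw; apply: (measurable_Rintegral_section N (F := fun z : TR * TR => f (z.1 + s * z.2) * w z.2)).
  apply: measurable_funM; last by apply: measurableT_comp => //; exact: measurable_snd.
  apply: (@measurableT_comp _ _ _ _ _ _ f _ (fun z : TR * TR => z.1 + s * z.2 : TR)) => //.
  apply: measurable_funD; first exact: measurable_fst.
  by apply: measurable_funM => //; exact: measurable_snd.
have q1 (z : TR) : `|z| <= z ^+ 2 + 1.
  by rewrite -[z ^+ 2]real_normK ?num_real//; have := normr_ge0 z; nra.
have q2 (z : TR) : `|z ^+ 2 - 1| <= z ^+ 2 + 1.
  by apply: (le_trans (ler_normB _ _)); rewrite normr1 ger0_norm ?sqr_ge0.
have iq := intg_normal_sqrD1; set Q := \int[N]_(z in [set: TR]) (z ^+ 2 + 1).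
have Q0 : 0 <= Q by apply: mean_ge0 => z; rewrite addr_ge0 ?sqr_ge0.
have ir := intg_rho_bound; set K := \int[N]_z rho_bound z.
have K0 : 0 <= K.
  by apply: mean_ge0 => z; rewrite /rho_bound !mulr_ge0 ?expR_ge0// addr_ge0 ?expR_ge0.
have b1 x := gle _ _ x mid iq q1; have b2 x := gle _ _ x mH2 iq q2.
pose h1 x := g id x / s; pose h2 x := g (fun z => z ^+ 2 - 1) x / s ^+ 2.
(* B K serves for |a| <= 1. For |a| > 1 each term of the expansion is bounded crudely, and the rest
   of C0 covers their sum since 1, |a| and a^2 are at most |a|^3. *)
pose C0 := B * K + 2 * B + 2 * B * Q.
exists (B + B * Q / s + B * Q / s ^+ 2), (C0 / s ^+ 3), h1, h2.
have BQ0 : 0 <= B * Q by exact: mulr_ge0.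
have s20 : 0 < s ^+ 2 by exact: exprn_gt0.
have BQs : 0 <= B * Q / s by rewrite divr_ge0// ltW.
have BQs2 : 0 <= B * Q / s ^+ 2 by rewrite divr_ge0// ltW.
split.
- exact: measurable_gauss_smooth.
- by apply: measurable_funM => //; exact: mg.
- by apply: measurable_funM => //; exact: mg.
- by move=> x; apply: (le_trans (gauss_smooth_bounded s mf fB x)); lra.
- move=> x; rewrite /h1 normrM (gtr0_norm (_ : 0 < s^-1)) ?invr_gt0//.
  by apply: (@le_trans _ _ (B * Q / s)); [rewrite ler_pM2r ?invr_gt0//; exact: b1|lra].
- move=> x; rewrite /h2 normrM (gtr0_norm (_ : 0 < (s ^+ 2)^-1)) ?invr_gt0//.
  by apply: (@le_trans _ _ (B * Q / s ^+ 2)); [rewrite ler_pM2r ?invr_gt0//; exact: b2|lra].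
move=> x y; set a := y / s.
have ya : y = s * a by rewrite /a mulrC divfK.
have -> : h1 x * y = a * g id x by rewrite /h1 ya; field.
have -> : h2 x / 2 * y ^+ 2 = a ^+ 2 / 2 * g (fun z => z ^+ 2 - 1) x by rewrite /h2 ya; field.
have -> : C0 / s ^+ 3 * `|y| ^+ 3 = C0 * `|a| ^+ 3.
  by rewrite ya normrM (gtr0_norm s0); field.
have a0 := normr_ge0 a.
have [a1|a1] := leP `|a| 1.
  apply: (@le_trans _ _ (B * K * `|a| ^+ 3)); last first.
    by rewrite ler_wpM2r ?exprn_ge0// /C0; have := mulr_ge0 B0 Q0; lra.
  have -> : gauss_smooth s f (x + y) = \int[N]_z (f (x + s * z) * expR (a * z - a ^+ 2 / 2)).
    rewrite -(cameron_martin a (mfx x) (fun z => fB _)).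
    by apply: eq_Rintegral => z _; congr f; rewrite ya; ring.
  have irho : intg N (fun z : TR => f (x + s * z) * expR (a * z - a ^+ 2 / 2)).
    have ir' : intg N (fun z : TR => expR (a * z - a ^+ 2 / 2)).
      have rhoE z : expR (a * z - a ^+ 2 / 2) = expR (- (a ^+ 2 / 2)) * expR (a * z).
        by rewrite -expRD addrC.
      by under eq_fun do rewrite rhoE; apply: intgZ; exact: intg_normal_expR.
    by apply: (ifw _ _ x (intg_meas ir') ir') => z; rewrite ger0_norm ?expR_ge0.
  have i0 := intg_shift_scale s x mf fB.
  have i1 := ifw _ _ x mid iq q1; have i2 := ifw _ _ x mH2 iq q2.
  rewrite /g /gauss_smooth -!meanZ// -meanD//; last exact: intgZ.
  rewrite -meanD//; [|by apply: intgD => //; exact: intgZ|exact: intgZ].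
  rewrite -meanB//; last by apply: intgD; [apply: intgD => //|]; exact: intgZ.
  rewrite [leRHS]mulrC -meanZ; last exact: intgZ.
  apply: norm_mean_le.
  - by apply: intgB => //; apply: intgD; [apply: intgD => //|]; exact: intgZ.
  - by apply: intgZ; exact: intgZ.
  move=> z; rewrite (_ : _ - _ = f (x + s * z) *
    (expR (a * z - a ^+ 2 / 2) - (1 + a * z + a ^+ 2 / 2 * (z ^+ 2 - 1)))); last by ring.
  by rewrite normrM [leRHS]mulrCA ler_pM// [leRHS]mulrC rho_taylor2.
have b0 := gauss_smooth_bounded s mf fB.
have p1 : 1 <= `|a| ^+ 3 by apply: exprn_ege1; exact: ltW.
have p2 : `|a| <= `|a| ^+ 3 by rewrite -[leLHS]expr1 ler_weXn2l// ltW.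
have p3 : `|a| ^+ 2 <= `|a| ^+ 3 by rewrite ler_weXn2l// ltW.
apply: (le_trans (ler_normB _ _)).
apply: (@le_trans _ _ (B + (B + `|a| * (B * Q) + `|a| ^+ 2 / 2 * (B * Q)))).
  apply: lerD; first exact: b0.
  apply: (le_trans (ler_normD _ _)); apply: lerD.
    apply: (le_trans (ler_normD _ _)); apply: lerD; first exact: b0.
    by rewrite normrM ler_wpM2l.
  rewrite normrM normrM normrX (ger0_norm (_ : 0 <= 2^-1)) ?invr_ge0//.
  by rewrite ler_wpM2l// divr_ge0// exprn_ge0.
rewrite /C0; set A := `|a| ^+ 3 in p1 p2 p3 *; set A2 := `|a| ^+ 2 in p3 *.
have BK : 0 <= B * K by exact: mulr_ge0.
have : B <= B * A by rewrite ler_peMr.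
have : `|a| * (B * Q) <= A * (B * Q) by rewrite ler_wpM2r.
have : A2 * (B * Q) <= A * (B * Q) by rewrite ler_wpM2r.
have : 0 <= B * K * A by rewrite mulr_ge0//; lra.
have : 0 <= A * (B * Q) by rewrite mulr_ge0//; lra.
nra.
Qed.

End gaussian_weight.

(** * Lipschitz approximation from below *)

Section lipschitz_envelope.
Context {R : realType}.
Implicit Types (f : R -> R) (k : R).

Lemma lipschitz_continuous f k : (forall x y, `|f x - f y| <= k * `|x - y|) -> continuous f.
Proof.
move=> fk x; apply/cvgrPdist_le => e e0.
have k0 : 0 <= k by have := le_trans (normr_ge0 _) (fk 1 0); rewrite subr0 normr1 mulr1.
near=> y; apply: (le_trans (fk x y)).
apply: (@le_trans _ _ (k * (e / (k + 1)))).
  rewrite ler_wpM2l//; near: y; apply: (@cvgr_dist_le _ _ _ _ _ id) => //.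
  by rewrite divr_gt0//; lra.
by rewrite mulrCA ler_piMr ?(ltW e0)// ler_pdivrMr; lra.
Unshelve. all: end_near. Qed.

(** The infimal convolution of f with k |x|: for bounded f and k >= 0, the largest k-Lipschitz
    function below f. *)
Definition envelope f k x : R := inf [set f y + k * `|x - y| | y in [set: R]].

Section envelope_bounded.
Variables (f : R -> R) (B k : R).
Hypotheses (fB : forall x, `|f x| <= B) (k0 : 0 <= k).

Let lbB x y : - B <= f y + k * `|x - y|.
Proof.
have := fB y; rewrite ler_norml => /andP[H _].
by have := mulr_ge0 k0 (normr_ge0 (x - y)); lra.
Qed.

Lemma envelope_ge c x : (forall y, c <= f y + k * `|x - y|) -> c <= envelope f k x.
Proof. by move=> cf; apply: lb_le_inf => [|_ [y _ <-]//]; exists (f x + k * `|x - x|), x. Qed.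

Lemma envelope_le x y : envelope f k x <= f y + k * `|x - y|.
Proof. by apply: ge_inf; [exists (- B) => _ [z _ <-]; exact: lbB|exists y]. Qed.

Lemma envelope_lef x : envelope f k x <= f x.
Proof. by have := envelope_le x x; rewrite subrr normr0 mulr0 addr0. Qed.

Lemma envelope_bounded x : `|envelope f k x| <= B.
Proof.
rewrite ler_norml; apply/andP; split; first by apply: envelope_ge => y; exact: lbB.
by apply: (le_trans (envelope_lef x)); apply: le_trans (fB x); exact: ler_norm.
Qed.

Lemma envelope_lipschitz x y : `|envelope f k x - envelope f k y| <= k * `|x - y|.
Proof.
have H a b : envelope f k a - k * `|a - b| <= envelope f k b.
  apply: envelope_ge => z; rewrite lerBlDr.
  apply: (le_trans (envelope_le a z)); rewrite -addrA lerD2l -mulrDr ler_wpM2l//.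
  by rewrite [leRHS]addrC ler_distD.
have := H x y; have := H y x; rewrite distrC ler_norml; lra.
Qed.

End envelope_bounded.

(** Points y near x are handled by continuity; at distance d or more the penalty n d exceeds the
    oscillation 2 B once n is large. *)
Lemma cvg_envelope f B x : continuous f -> (forall x, `|f x| <= B) ->
  (fun n => envelope f n%:R x) @ \oo --> f x.
Proof.
move=> cf fB; apply/cvgrPdist_le => e e0.
have /cvgrPdist_le/(_ e e0)[d /= d0 dP] := cf x.
near=> n; have n0 : 0 <= n%:R :> R by [].
rewrite ger0_norm ?subr_ge0 ?(envelope_lef fB)// lerBlDl -lerBlDr.
apply: envelope_ge => y; rewrite lerBlDl.
have [xy|xy] := ltP `|x - y| d.
  have := dP y xy; have := mulr_ge0 n0 (normr_ge0 (x - y)).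
  by rewrite ler_norml => ? /andP[_ ?]; lra.
have nd : 2 * B <= n%:R * d.
  by rewrite -ler_pdivrMr//; near: n; exact: nbhs_infty_ger.
have : n%:R * d <= n%:R * `|x - y| by rewrite ler_wpM2l.
have := fB x; have := fB y; rewrite !ler_norml => /andP[? _] /andP[_ ?]; lra.
Unshelve. all: end_near. Qed.

End lipschitz_envelope.

(** * From Lipschitz test functions to convergence in law *)

Section weak_convergence.
Context {d0 : measure_display} {T : measurableType d0} {R : realType} (P : probability T R).
Local Notation TR := (measurableTypeR R).

Lemma continuous_measurableTR (f : R -> R) : continuous f -> measurable_fun [set: TR] (f : TR -> R).
Proof. by move=> cf; exact: continuous_measurable_fun. Qed.

(* [f] is the limit of the Lipschitz functions [envelope f k] below it, which
   bounds the expectations from below; the same applies to [- f]. *)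
Lemma cvg_in_law_lipschitz (Y : nat -> T -> R) (L : probability TR R) :
  (forall n, measurable_fun [set: T] (Y n)) ->
  (forall (f : R -> R) k B, (forall x y, `|f x - f y| <= k * `|x - y|) ->
     (forall x, `|f x| <= B) -> (fun n => \int[P]_t f (Y n t)) @ \oo --> \int[L]_x f x) ->
  cvg_in_law P Y L.
Proof.
move=> mY HY; split => // f cf [B fB].
have mc (g : R -> R) n : continuous g -> measurable_fun [set: T] (fun t => g (Y n t)).
  move=> cg; have mg := continuous_measurableTR cg.
  by apply: (@measurableT_comp _ _ _ _ _ _ (g : TR -> R) _ (Y n : T -> TR)) => //; exact: mY.
have iY (g : R -> R) n : continuous g -> (forall x, `|g x| <= B) -> intg P (fun t => g (Y n t)).
  by move=> cg gB; apply: (intg_bounded P (mc g n cg)) => t; exact: gB.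
have iL (g : R -> R) : continuous g -> (forall x, `|g x| <= B) -> intg L (g : TR -> R).
  by move=> cg gB; exact: (intg_bounded L (continuous_measurableTR cg)).
have lower (g : R -> R) (e : R) : continuous g -> (forall x, `|g x| <= B) -> 0 < e ->
    \forall n \near \oo, \int[L]_x g x - e <= \int[P]_t g (Y n t).
  move=> cg gB e0; pose F k := envelope g k%:R.
  have k0 k : 0 <= k%:R :> R by [].
  have FL k x y : `|F k x - F k y| <= k%:R * `|x - y| by exact: envelope_lipschitz gB _ _ _.
  have FB k x : `|F k x| <= B by exact: envelope_bounded gB _ _.
  have cF k : continuous (F k) by exact: lipschitz_continuous (FL k).
  have FcvgL : (fun k => \int[L]_x F k x) @ \oo --> \int[L]_x g x.
    have : ((fun k => \int[L]_x (F k x)%:E) @ \oo --> \int[L]_x (g x)%:E)%E.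
      apply: (@dominated_cvg _ _ _ L setT measurableT (fun k x => (F k x)%:E) (fun x => (g x)%:E) (fun=> B%:E)) => //.
      - by move=> k; apply/measurable_EFinP; exact: continuous_measurableTR.
      - move=> x _; apply: cvg_EFin; first by near=> k.
        exact: cvg_envelope gB.
      - exact: intg_cst.
      - by move=> k x _; rewrite /= lee_fin.
    under eq_fun => k do rewrite (EFin_mean (iL _ (cF k) (FB k))).
    by rewrite (EFin_mean (iL _ cg gB)) => /fine_cvgP[_].
  have e20 : 0 < e / 2 by lra.
  have /cvgrPdist_le/(_ _ e20)[k _ kP] := FcvgL.
  have {}kP := kP k (leqnn k); rewrite ler_norml in kP; case/andP: kP => _ kP.
  have /cvgrPdist_le/(_ _ e20) := HY _ _ _ (FL k) (FB k).
  apply: filterS => n; rewrite ler_norml => /andP[_ H].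
  have : \int[P]_t F k (Y n t) <= \int[P]_t g (Y n t).
    apply: le_mean; [exact: iY|exact: iY|move=> t; exact: envelope_lef gB _ _].
  lra.
have EfN n : \int[P]_t (- f) (Y n t) = - \int[P]_t f (Y n t).
  by rewrite -[RHS]mulN1r -meanZ; [apply: eq_Rintegral => t _; rewrite mulN1r|exact: iY].
have LfN : \int[L]_t (- f) t = - \int[L]_t f t.
  by rewrite -[RHS]mulN1r -meanZ; [apply: eq_Rintegral => t _; rewrite mulN1r|exact: iL].
have cfN : continuous (- f) by move=> x; apply: cvgN; exact: cf.
have fNB x : `|(- f) x| <= B by rewrite normrN.
under eq_fun => n do rewrite (EFin_mean (iY _ n cf fB)).
rewrite (EFin_mean (iL _ cf fB)); apply: cvg_EFin; first by near=> n.
apply/cvgrPdist_le => e e0.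
have := lower _ e cfN fNB e0; have := lower _ e cf fB e0.
apply: filterS2 => n H; rewrite EfN LfN => H'.
by rewrite /= ler_norml; lra.
Unshelve. all: end_near. Qed.

Lemma near_inv_sqrt (a e : R) : 0 < e -> \forall n \near \oo, a * (Num.sqrt n%:R)^-1 <= e.
Proof.
move=> e0; near=> n.
have n0 : 0 < n%:R :> R by near: n; exact: nbhs_infty_gtr.
have s0 : 0 < Num.sqrt n%:R :> R by rewrite sqrtr_gt0.
rewrite ler_pdivrMr//.
have H : (a / e) ^+ 2 <= n%:R by near: n; exact: nbhs_infty_ger.
have : `|a / e| <= Num.sqrt n%:R by rewrite -sqrtr_sqr ler_wsqrtr.
by move=> /(le_trans (ler_norm _)); rewrite ler_pdivrMr// mulrC.
Unshelve. all: end_near. Qed.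

Context {d1 : measure_display} {T' : measurableType d1}.
Variables (X : nat -> {RV P >-> T'}) (L : probability T' R).
Hypothesis hX : iid X L.
Variable xi : T' -> R.
Hypothesis mxi : measurable_fun [set: T'] xi.
Hypothesis ixi : forall p, intg L (fun y => xi y ^+ p).
Hypothesis Exi : \int[L]_y xi y = 0.
Let v := \int[L]_y (xi y ^+ 2).
Hypothesis v0 : 0 < v.

(** Against a Lipschitz f an L^1 bound on the remainder passes directly to expectations. The
    swapping bound is applied to a smoothing g of f, at uniform distance at most k r E|Z|. *)
Theorem clt_remainder (Y : nat -> T -> R) (K : R) :
  (forall n, measurable_fun [set: T] (Y n)) ->
  (forall n, (1 < n)%N -> exists Q : T -> R, [/\ intg P Q,
     forall t, `|Y n t - (Num.sqrt n%:R)^-1 * partial_sum X xi n t| <= Q t &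
     \int[P]_t Q t <= K * (Num.sqrt n%:R)^-1]) ->
  cvg_in_law P Y (normal_prob 0 (Num.sqrt v)).
Proof.
move=> mY YQ; apply: cvg_in_law_lipschitz => // f k B fk fB.
have cf := lipschitz_continuous fk.
have mf : measurable_fun [set: TR] (f : TR -> R) by exact: continuous_measurableTR.
have s0 : 0 < Num.sqrt v by rewrite sqrtr_gt0.
have k0 : 0 <= k by have := le_trans (normr_ge0 _) (fk 1 0); rewrite subr0 normr1 mulr1.
rewrite (normal_prob_scale s0 cf fB).
set N := @normal_prob R 0 1; set m1 := \int[N]_z `|z : R|.
have m10 : 0 <= m1 by apply: mean_ge0.
have iid1 : intg N (fun z : TR => `|z : R|).
  by apply: intg_norm; exact: (@integrable_normal_exp R 1).
apply/cvgrPdist_le => e e0.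
(* Each of the two replacements of f by g then costs at most e / 4. The other e / 2 is for the
   remainder and the swapping, both of order n^(-1/2). *)
pose r := e / (4 * (k * m1 + 1)).
have q0 : 0 < 4 * (k * m1 + 1) by have := mulr_ge0 k0 m10; lra.
have r0 : 0 < r by rewrite divr_gt0.
have krm : k * (r * m1) <= e / 4.
  rewrite /r [_ * m1]mulrAC mulrA ler_pdivrMr//; have := mulr_ge0 k0 m10; nra.
have [B' [C [g1 [g2 tg]]]] := taylor2_of_gauss_smooth r0 mf fB.
set g := gauss_smooth r f in tg.
have mg : measurable_fun [set: TR] g by exact: measurable_gauss_smooth.
have gB x : `|g x| <= B by exact: gauss_smooth_bounded.
have fg x : `|f x - g x| <= e / 4.
  apply: le_trans krm; rewrite mulrA -meanZ//.
  have ish := intg_shift_scale r x mf fB.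
  rewrite -{1}(@mean_cst _ _ _ N (f x)) -meanB//; last exact: intg_cst.
  apply: norm_mean_le; [by apply: intgB => //; exact: intg_cst|exact: intgZ|].
  move=> z; apply: (le_trans (fk _ _)).
  by rewrite opprD addNKr normrN normrM (gtr0_norm r0) mulrA.
have e20 : 0 < e / 2 by lra.
have lb n (n0 : (0 < n)%N) := lindeberg_bound hX mxi ixi Exi v0 tg n0.
move: lb; set c := C * _ => lb.
have near1 : \forall n \near \oo, (1 < n)%N by exists 2%N.
move: near1 (near_inv_sqrt (k * K + c) e20); apply: filterS2 => n n1 nE.
have n0 : (0 < n)%N by exact: ltnW.
have [Q [iQ YQn EQ]] := YQ n n1.
pose S t := (Num.sqrt n%:R)^-1 * partial_sum X xi n t.
have mS : measurable_fun [set: T] S.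
  by apply: measurable_funM => //; exact: measurable_partial_sum.
have mfc (h : TR -> R) (Z : T -> R) : measurable_fun [set: TR] h -> measurable_fun [set: T] Z ->
    measurable_fun [set: T] (fun t => h (Z t)).
  by move=> mh mZ; apply: (@measurableT_comp _ _ _ _ _ _ h _ (Z : T -> TR)) => //; exact: mZ.
have ifY : intg P (fun t => f (Y n t)) by apply: (intg_bounded P (mfc _ _ mf (mY n))) => t; exact: fB.
have ifS : intg P (fun t => f (S t)) by apply: (intg_bounded P (mfc _ _ mf mS)) => t; exact: fB.
have igS : intg P (fun t => g (S t)) by apply: (intg_bounded P (mfc _ _ mg mS)) => t; exact: gB.
have D1 : `|\int[P]_t f (Y n t) - \int[P]_t f (S t)| <= k * (K * (Num.sqrt n%:R)^-1).
  rewrite -meanB//; apply: (@le_trans _ _ (k * \int[P]_t Q t)); last by rewrite ler_wpM2l.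
  rewrite -meanZ//; apply: norm_mean_le; [exact: intgB|exact: intgZ|] => t.
  by apply: (le_trans (fk _ _)); rewrite ler_wpM2l//; exact: YQn.
have D2 : `|\int[P]_t f (S t) - \int[P]_t g (S t)| <= e / 4.
  rewrite -meanB// -[leRHS](@mean_cst _ _ _ P); apply: norm_mean_le; [exact: intgB|exact: intg_cst|].
  by move=> t; exact: fg.
have D3 := lb n n0.
have D4 : `|gauss_smooth (Num.sqrt v) g 0 - gauss_smooth (Num.sqrt v) f 0| <= e / 4.
  have i1 := intg_shift_scale (Num.sqrt v) 0 mf fB.
  have i2 := intg_shift_scale (Num.sqrt v) 0 mg gB.
  rewrite /gauss_smooth -/N -meanB// -[leRHS](@mean_cst _ _ _ N).
  apply: norm_mean_le; [exact: intgB|exact: intg_cst|].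
  by move=> z; rewrite distrC; exact: fg.
move: nE; rewrite mulrDl.
move: D1 D2 D3 D4; rewrite -/S -/v [(Num.sqrt n%:R)^-1 * c]mulrC -mulrA.
rewrite !ler_norml; lra.
Qed.

End weak_convergence.

(** * First order expansion and limit *)

Section expansion.
Context {R : realType}.

Lemma trace_cov_mul_le d (A W : 'M[R]_d) : covariance_matrix A -> covariance_matrix W ->
  \tr (A *m W) <= \tr A * \tr W.
Proof.
move=> hA hW.
have -> : \tr (A *m W) = \tr (sqrtm W *m A *m (sqrtm W)^T).
  by rewrite sqrtm_sym// -[X in _ = \tr X]mulmxA [RHS]mxtrace_mulC -mulmxA sqrtmK.
rewrite covariance_conj_fro//; apply: (le_trans (fro_mulmx _ _)).
by rewrite !sqrtm_gram// mulrC.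
Qed.

Lemma trace_mul_norm_le d (G H : 'M[R]_d) : H^T = H ->
  `|\tr (G *m H)| <= 2^-1 * (\tr (G *m G^T) + \tr (H *m H^T)).
Proof.
move=> HT; have := fro_mul_le G H 1; have := fro_mul_le G H (-1).
by rewrite HT ler_norml expr1n sqrrN expr1n; lra.
Qed.

Lemma fro_addscale_le d (X Y : 'M[R]_d) (a b : R) :
  \tr ((a *: X + b *: Y) *m (a *: X + b *: Y)^T) <=
  2 * (a ^+ 2 * \tr (X *m X^T) + b ^+ 2 * \tr (Y *m Y^T)).
Proof.
have sq (Z : 'M[R]_d) k : \tr ((k *: Z) *m (k *: Z)^T) = k ^+ 2 * \tr (Z *m Z^T).
  by rewrite linearZ/= -scalemxAl -scalemxAr !mxtraceZ mulrA.
rewrite -!sq; move: (a *: X) (b *: Y) => U V.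
have := fro_mul_le U V 1; have VU : \tr (V *m U^T) = \tr (U *m V^T).
  by rewrite -mxtraceT trmx_mul trmxK.
rewrite [(U + V)^T]linearD/= mulmxDl !mulmxDr !mxtraceD VU expr1n; lra.
Qed.

(* The nonnegative part [W] enters linearly because tr((A - B) W) >= - tr(B W).
   For [W] the rank one matrix built on the error of the empirical mean, this
   avoids fourth moments of the empirical mean. *)
Lemma sqrt_perturbation_psd d (B : 'M[R]_d) : covariance_matrix B -> B \in unitmx ->
  exists2 K, 0 <= K & forall A E W, covariance_matrix A -> covariance_matrix W ->
   E^T = E -> A *m A - B *m B = E - W ->
   \tr ((A - B) *m (A - B)^T) <= K * (\tr (E *m E^T) + \tr W).
Proof.
move=> hB uB; have [c c0 Hc] := covariance_coercive hB uB.
have tB : 0 <= \tr B by have := covariance_conj_ge0 1%:M hB; rewrite mul1mx trmx1 mulmx1.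
exists ((c ^+ 2)^-1 + 2 * (c^-1 * \tr B)) => [|A E W hA hW ET EW].
  have i0 : 0 <= c^-1 by rewrite invr_ge0 ltW.
  have := mulr_ge0 i0 tB; have : 0 <= (c ^+ 2)^-1 by rewrite invr_ge0 sqr_ge0.
  lra.
have := sqrt_difference_trace hA.1 hB.1 => /=; rewrite EW.
have := Hc _ (A - B); have := covariance_conj_ge0 (A - B) hA.
have tW : 0 <= \tr W by have := covariance_conj_ge0 1%:M hW; rewrite mul1mx trmx1 mulmx1.
have := trace_cov_mul_le hB hW; have := trace_cov_mul_ge0 hA hW.
have tDW : \tr ((A - B) *m W) = \tr (A *m W) - \tr (B *m W) by rewrite mulmxBl mxtraceB.
rewrite mulmxBr mxtraceB tDW.
have := fro_mul_le (A - B) E c; rewrite ET.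
have := fro_ge0 E; rewrite ET.
set x := \tr (_ *m A *m _); set y := \tr ((A - B) *m B *m _); set z := \tr ((A - B) *m E).
set p := \tr ((A - B) *m (A - B)^T); set q := \tr (E *m E).
set aw := \tr (A *m W); set bw := \tr (B *m W); set b := \tr B in tB *; set w := \tr W in tW *.
move=> q0 H1 H2 H3 H4 H5 H6.
(* Coercivity gives c p <= z + b w. Young's inequality 2 c z <= c^2 p + q then absorbs z into the
   left side. *)
have cp : c * p <= z + b * w by lra.
have cc : c ^+ 2 * p <= q + 2 * c * (b * w).
  have : c * (c * p) <= c * (z + b * w) by rewrite ler_pM2l.
  by rewrite !expr2 in H1 *; lra.
have cn : c != 0 by rewrite gt_eqF.
have -> : p = (c ^+ 2)^-1 * (c ^+ 2 * p) by field.
apply: (@le_trans _ _ ((c ^+ 2)^-1 * (q + 2 * c * (b * w)))).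
  by rewrite ler_pM2l// invr_gt0 exprn_gt0.
have -> : (c ^+ 2)^-1 * (q + 2 * c * (b * w)) = (c ^+ 2)^-1 * q + 2 * (c^-1 * b) * w by field.
have : 0 <= (c ^+ 2)^-1 * w by rewrite mulr_ge0// invr_ge0 sqr_ge0.
have : 0 <= c^-1 * b * q by rewrite !mulr_ge0// invr_ge0 ltW.
lra.
Qed.

Section gelbrich_derivative.
Context {d : nat} (mu nu : 'cV[R]_d) (Sigma Xi : 'M[R]_d).
Hypotheses (hSigma : covariance_matrix Sigma) (hXi : covariance_matrix Xi).
Hypotheses (uSigma : Sigma \in unitmx) (uXi : Xi \in unitmx).

Let X2 := sqrtm Xi.
Let M0 := X2 *m Sigma *m X2.
Let N0 := sqrtm M0.

(* The optimal map from N(mu, Sigma) to N(nu, Xi) is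
   x |-> nu + transport_mx (x - mu). *)
Definition transport_mx : 'M[R]_d := X2 *m invmx N0 *m X2.

Let uX2 : X2 \in unitmx. Proof. exact: sqrtm_unitmx. Qed.
Let X2T : X2^T = X2. Proof. exact: sqrtm_sym. Qed.
Let X2K : X2 *m X2 = Xi. Proof. exact: sqrtmK. Qed.
Let hM S : covariance_matrix S -> covariance_matrix (X2 *m S *m X2).
Proof. by move=> hS; rewrite -{2}X2T; exact: covariance_conj. Qed.
Let hN : covariance_matrix N0. Proof. by apply: sqrtm_cov; exact: hM. Qed.
Let uM : M0 \in unitmx. Proof. by rewrite !unitmx_mul uX2 uSigma. Qed.
Let uN : N0 \in unitmx. Proof. by apply: sqrtm_unitmx => //; exact: hM. Qed.
Let N0K : N0 *m N0 = M0. Proof. by apply: sqrtmK; exact: hM. Qed.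
Let NiM : invmx N0 *m M0 = N0.
Proof. by rewrite -[X in _ *m X]N0K mulmxA mulVmx// mul1mx. Qed.
Let hNi : covariance_matrix (invmx N0). Proof. exact: covariance_inv. Qed.

Lemma transport_mx_cov : covariance_matrix transport_mx.
Proof. exact: hM. Qed.

Lemma transport_mxE : transport_mx *m Sigma *m transport_mx = Xi.
Proof.
have -> : transport_mx *m Sigma *m transport_mx = X2 *m (invmx N0 *m M0 *m invmx N0) *m X2.
  by rewrite /transport_mx /M0 !mulmxA.
by rewrite NiM mulmxV// mulmx1.
Qed.

(** Brings the trace to the form that [sqrtm_eigenpairs] evaluates: the square root of M0 against
    Xi^(-1/2) Sigma Xi^(1/2). *)
Lemma trace_transport_sqr :
  \tr (transport_mx *m Sigma *m Sigma) = \tr (N0 *m (invmx X2 *m Sigma *m X2)).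
Proof.
have -> : transport_mx *m Sigma *m Sigma = X2 *m (invmx N0 *m M0 *m invmx X2 *m Sigma).
  rewrite /transport_mx /M0 !mulmxA; congr (_ *m _).
  by rewrite -(mulmxA _ X2 (invmx X2)) mulmxV// mulmx1.
by rewrite mxtrace_mulC NiM !mulmxA.
Qed.

(** Only H enters the linear term; the terms in W, of the order of tr W, go into the error. S is not
    assumed close to Sigma. *)
Lemma gelbrich_expansion : exists2 K, 0 <= K &
  forall m S H W, covariance_matrix S -> covariance_matrix W -> H^T = H ->
  S - Sigma = H - W ->
  `|gelbrich_value m nu S Xi - gelbrich_value mu nu Sigma Xi -
    (2 * ((mu - nu)^T *m (m - mu)) 0 0 + \tr ((1%:M - transport_mx) *m H))| <=
  K * (sqnorm (m - mu) + \tr (H *m H^T) + \tr W).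
Proof.
have [K K0 HK] := sqrt_perturbation_psd hN uN.
set T := transport_mx; have hT := transport_mx_cov.
have trc_ge0 (A : 'M[R]_d) : covariance_matrix A -> 0 <= \tr A.
  by move=> hA; have := covariance_conj_ge0 1%:M hA; rewrite mul1mx trmx1 mulmx1.
have tT := trc_ge0 _ hT; have tNi := trc_ge0 _ hNi; have tXi := trc_ge0 _ hXi.
set q := \tr (X2 *m X2^T).
have q0 : 0 <= q by exact: fro_ge0.
(* Conjugation by X2 costs a factor q^2 on the squared norm of H and a factor q on the trace of
   W. *)
pose K1 := \tr (invmx N0) * K * (q * q + q).
have K10 : 0 <= K1 by rewrite /K1 !mulr_ge0// addr_ge0// mulr_ge0.
exists (1 + \tr T + K1) => [|m S H W hS hW HT EHW].
  by rewrite !addr_ge0.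
pose M := X2 *m S *m X2; pose N := sqrtm M.
have hN' : covariance_matrix N by apply: sqrtm_cov; exact: hM.
have NK : N *m N = M by apply: sqrtmK; exact: hM.
have NNE : N *m N - N0 *m N0 = X2 *m (S - Sigma) *m X2.
  by rewrite NK N0K /M /M0 mulmxBr mulmxBl.
have tW := trc_ge0 _ hW.
(* The exact remainder of [mxtrace_sqrt_expansion], a squared norm of N - N0 weighted by the inverse
   of N0. *)
pose P := \tr (invmx N0 *m ((N - N0) *m (N - N0))).
have DT : (N - N0)^T = N - N0 by rewrite linearB/= hN'.1 hN.1.
have PE : P = \tr ((N - N0) *m invmx N0 *m (N - N0)^T).
  by rewrite /P mulmxA mxtrace_mulC DT mulmxA.
have P0 : 0 <= P by rewrite PE; exact: covariance_conj_ge0.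
have PK : P <= K1 * (\tr (H *m H^T) + \tr W).
  rewrite PE covariance_conj_fro//; apply: (le_trans (fro_mulmx _ _)).
  rewrite sqrtm_gram// mulrC /K1 -!mulrA ler_wpM2l//.
  apply: (le_trans (HK N (X2 *m H *m X2) (X2 *m W *m X2) hN' (hM hW) _ _)).
  - by rewrite !trmx_mul X2T HT mulmxA.
  - by rewrite NNE EHW mulmxBr mulmxBl.
  rewrite ler_wpM2l// mulrDr; apply: lerD.
    apply: (@le_trans _ _ (q * q * \tr (H *m H^T))); last first.
      by rewrite ler_wpM2r ?fro_ge0// lerDl.
    apply: (le_trans (fro_mulmx _ _)); rewrite -/q.
    by rewrite mulrAC ler_wpM2r// fro_mulmx.
  have -> : \tr (X2 *m W *m X2) = \tr (X2 *m X2^T *m W).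
    by rewrite X2T mxtrace_mulC mulmxA.
  apply: (@le_trans _ _ (q * \tr W)); last by rewrite ler_wpM2r// lerDr mulr_ge0.
  by apply: trace_cov_mul_le => //; exact: covariance_gram.
have TW := trace_cov_mul_le hT hW; have TW0 := trace_cov_mul_ge0 hT hW.
have tN : \tr N - \tr N0 = 2^-1 * \tr (T *m (S - Sigma)) - 2^-1 * P.
  rewrite -mxtraceB mxtrace_sqrt_expansion//; last exact: hN.1.
  rewrite NNE; congr (_ * _ - _).
  by rewrite [X in \tr X = _]mulmxA [LHS]mxtrace_mulC /T /transport_mx !mulmxA.
have sq : sqnorm (m - nu) = sqnorm (m - mu) + 2 * ((mu - nu)^T *m (m - mu)) 0 0 + sqnorm (mu - nu).
  have -> : m - nu = (m - mu) + (mu - nu) by rewrite addrA subrK.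
  by rewrite sqnormD -[in LHS](trmxK (mu - nu)) -trmx_mul mxE trmxK.
have trS : \tr S - \tr Sigma = \tr H - \tr W by rewrite -mxtraceB EHW mxtraceB.
have -> : gelbrich_value m nu S Xi - gelbrich_value mu nu Sigma Xi -
    (2 * ((mu - nu)^T *m (m - mu)) 0 0 + \tr ((1%:M - T) *m H)) =
    sqnorm (m - mu) - \tr W + \tr (T *m W) + P.
  move: tN; rewrite EHW mulmxBr mxtraceB mulmxBl mul1mx mxtraceB /gelbrich_value sq.
  rewrite -/X2 -/M -/M0 -/N -/N0; lra.
have s0 := sqnorm_ge0 (m - mu); have h0 := fro_ge0 H.
have := mulr_ge0 tT s0; have := mulr_ge0 tT h0; have := mulr_ge0 K10 s0; move: PK.
rewrite ler_norml; lra.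
Qed.

End gelbrich_derivative.
End expansion.

(** * The empirical moments *)

Section sample.
Context {R : realType} {disp : measure_display} {T : measurableType disp}.
Context (P : probability T R) {d : nat} (mu : 'cV[R]_d) (Sigma : 'M[R]_d).
Variable X : nat -> {RV P >-> 'cV[R]_d}.
Hypothesis hSigma : covariance_matrix Sigma.
Hypothesis hX : iid X (gaussian mu Sigma).

Lemma emp_cov_covariance n t : covariance_matrix (emp_cov X n t).
Proof.
(* At n = 0 the scaling factor is negative but the sum is empty; at n = 1 it is the inverse of 0,
   which is 0. *)
rewrite /emp_cov; case: n => [|n].
  by rewrite big_ord0 scaler0; exact: covariance0.
apply: covarianceZ; first by rewrite invr_ge0 subr_ge0 ler1n.
by elim/big_rec: _ => [|i A _ hA]; [exact: covariance0|apply: covarianceD => //; exact: covariance_gram].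
Qed.

Lemma measurable_sample_entry k i j : measurable_fun [set: T] (fun t => X k t i j).
Proof.
by apply: (@measurableT_comp _ _ _ _ _ _ (fun v : 'cV[R]_d => v i j) _ (X k));
  [exact: measurable_entry|exact: measurable_funP].
Qed.

Lemma measurable_emp_mean n i j : measurable_fun [set: T] (fun t => emp_mean X n t i j).
Proof.
rewrite /emp_mean; under eq_fun do rewrite mxE summxE.
apply: measurable_funM => //; apply: measurable_sum => k.
exact: measurable_sample_entry.
Qed.

Lemma measurable_emp_cov n i j : measurable_fun [set: T] (fun t => emp_cov X n t i j).
Proof.
rewrite /emp_cov; under eq_fun do rewrite mxE summxE.
apply: measurable_funM => //; apply: measurable_sum => k.
have outerE (u v : 'cV[R]_d) : ((u - v) *m (u - v)^T) i j = (u i 0 - v i 0) * (u j 0 - v j 0).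
  by rewrite mxE big_ord1 !mxE.
under eq_fun do rewrite outerE.
have mX l := measurable_sample_entry k l 0; have mm l := measurable_emp_mean n l 0.
by apply: measurable_funM; apply: measurable_funB.
Qed.

Lemma measurable_gelbrich_value nu (Xi : 'M[R]_d) n : covariance_matrix Xi ->
  measurable_fun [set: T] (fun t => gelbrich_value (emp_mean X n t) nu (emp_cov X n t) Xi).
Proof.
move=> hXi; rewrite /gelbrich_value.
apply: measurable_funB.
  apply: measurable_funD => //; apply: measurable_funD.
    rewrite /sqnorm; apply: measurable_sum => i; apply: measurable_funX.
    have subE (u v : 'cV[R]_d) : (u - v) i 0 = u i 0 - v i 0 by rewrite !mxE.
    under eq_fun do rewrite subE.
    by apply: measurable_funB => //; exact: measurable_emp_mean.
  by apply: measurable_sum => i; exact: measurable_emp_cov.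
apply: measurable_funM => //; apply: measurable_trace_sqrtm.
  move=> i j; under eq_fun do rewrite mxE; apply: measurable_sum => k.
  apply: measurable_funM => //.
  under eq_fun do rewrite mxE; apply: measurable_sum => l.
  by apply: measurable_funM => //; exact: measurable_emp_cov.
move=> t; rewrite -{2}(sqrtm_sym hXi); apply: covariance_conj; exact: emp_cov_covariance.
Qed.

(** Centered at mu, not at the empirical mean, hence an average of i.i.d. centered matrices. *)
Definition second_moment_dev n t : 'M[R]_d :=
  n%:R^-1 *: \sum_(i < n) (X i t - mu) *m (X i t - mu)^T - Sigma.

Lemma second_moment_dev_sym n t : (second_moment_dev n t)^T = second_moment_dev n t.
Proof.
rewrite /second_moment_dev [LHS]linearB/= linearZ/= linear_sum/= hSigma.1.
by congr (_ *: _ - _); apply: eq_bigr => i _; rewrite trmx_mul trmxK.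
Qed.

Lemma emp_mean_dev n t : (0 < n)%N ->
  emp_mean X n t - mu = n%:R^-1 *: \sum_(i < n) (X i t - mu).
Proof.
move=> n0; rewrite /emp_mean sumrB sumr_const card_ord scalerBr -[mu *+ n]scaler_nat scalerA.
by rewrite mulVf ?scale1r// pnatr_eq0 -lt0n.
Qed.

Lemma partial_sum_quadratic c G n t : (0 < n)%N ->
  partial_sum X (centered_quadratic mu Sigma c G) n t =
  n%:R * ((c^T *m (emp_mean X n t - mu)) 0 0 + \tr (G *m second_moment_dev n t)).
Proof.
move=> n0; have nn : n%:R != 0 :> R by rewrite pnatr_eq0 -lt0n.
rewrite emp_mean_dev// /second_moment_dev mulmxBr mxtraceB -!scalemxAr mxtraceZ mxE.
rewrite !mulmx_sumr summxE raddf_sum/=.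
rewrite /partial_sum /centered_quadratic sumrB sumr_const card_ord -[\tr _ *+ n]mulr_natl.
rewrite /quadratic big_split/= !mulrDr !mulVKf// mulrN addrA; congr (_ + _ - _).
by apply: eq_bigr => i _; rewrite /bform -trace_mx11 -mulmxA mxtrace_mulC -mulmxA mxtrace_mulC -mulmxA.
Qed.

(** The form H - W that [gelbrich_expansion] expects: recentering at the empirical mean gives the
    rank one W, and the divisor n - 1 gives the term in Sigma. *)
Lemma emp_cov_dev n t : (1 < n)%N ->
  let a := (n%:R - 1)^-1 in let e := emp_mean X n t - mu in
  emp_cov X n t - Sigma = ((n%:R * a) *: second_moment_dev n t + a *: Sigma) - (n%:R * a) *: (e *m e^T).
Proof.
move=> n1 a e; have n0 := ltnW n1.
have nn : n%:R != 0 :> R by rewrite pnatr_eq0 -lt0n.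
have n1n : n%:R - 1 != 0 :> R by rewrite subr_eq0 pnatr_eq1 gtn_eqF.
have sumE : \sum_(i < n) (X i t - mu) = n%:R *: e.
  by rewrite /e emp_mean_dev// scalerA mulfV// scale1r.
rewrite /emp_cov -/a.
have -> : \sum_(i < n) (X i t - emp_mean X n t) *m (X i t - emp_mean X n t)^T =
    \sum_(i < n) (X i t - mu) *m (X i t - mu)^T - n%:R *: (e *m e^T).
  under eq_bigr => i _.
    rewrite (_ : X i t - emp_mean X n t = (X i t - mu) - e); last first.
      by rewrite /e opprB addrA subrK.
    rewrite [(_ - e)^T]linearB/= mulmxBl !mulmxBr.
  over.
  rewrite !sumrB -mulmx_suml -mulmx_sumr sumr_const card_ord -linear_sum/= sumE.
  by rewrite linearZ/= -scalemxAl -scalemxAr -[_ *m _ *+ n]scaler_nat subrr subr0.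
have -> : \sum_(i < n) (X i t - mu) *m (X i t - mu)^T = n%:R *: (second_moment_dev n t + Sigma).
  by rewrite /second_moment_dev subrK scalerA mulfV// scale1r.
have e2 : n%:R * a = 1 + a.
  by rewrite -[n%:R](subrK 1) mulrDl mul1r mulfV.
rewrite scalerBr !scalerA [a * _]mulrC scalerDr -!addrA; congr (_ + _).
by rewrite addrCA [RHS]addrC; congr (_ + _); rewrite e2 scalerDl scale1r addrAC subrr add0r.
Qed.

Lemma mean_sqr_quadratic c G n : G^T = G -> (0 < n)%N ->
  let f t := (c^T *m (emp_mean X n t - mu)) 0 0 + \tr (G *m second_moment_dev n t) in
  intg P (fun t => f t ^+ 2) /\
  \int[P]_t (f t ^+ 2) = n%:R^-1 * (bform c Sigma c + 2 * \tr (G *m Sigma *m G *m Sigma)).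
Proof.
move=> GT n0 f; have nn : n%:R != 0 :> R by rewrite pnatr_eq0 -lt0n.
have [xi1 xi2 xi3] := @E_centered_quadratic _ _ mu Sigma c G hSigma GT.
have [i1 E1] := E_sqr_partial_sum hX (measurable_centered_quadratic mu Sigma c G) xi1 xi2 n.
have fE : (fun t => f t ^+ 2) =
    (fun t => n%:R^-1 ^+ 2 * partial_sum X (centered_quadratic mu Sigma c G) n t ^+ 2).
  by apply/funext => t; rewrite partial_sum_quadratic// exprMn mulrA -exprMn mulVf// expr1n mul1r.
rewrite fE; split; first exact: intgZ.
by rewrite meanZ// E1 xi3; field.
Qed.

Definition mean_dev_error n t : R :=
  sqnorm (emp_mean X n t - mu) + \tr (second_moment_dev n t *m (second_moment_dev n t)^T).

(** Each entry of the two deviations is an average of a centered quadratic function of the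
    observations, so its second moment is its variance divided by n. *)
Lemma E_mean_dev_error : exists2 C, 0 <= C & forall n, (0 < n)%N ->
  intg P (mean_dev_error n) /\ \int[P]_t mean_dev_error n t = n%:R^-1 * C.
Proof.
pose c j : 'cV[R]_d := delta_mx j 0.
(* Symmetrized because the variance formula is for symmetric G; on symmetric matrices it still reads
   off the entry (j, k). *)
pose G j k : 'M[R]_d := 2^-1 *: (delta_mx j k + delta_mx k j).
have GT j k : (G j k)^T = G j k.
  by rewrite /G linearZ/= linearD/= !trmx_delta addrC.
pose V (c : 'cV[R]_d) (G : 'M[R]_d) : R := bform c Sigma c + 2 * \tr (G *m Sigma *m G *m Sigma).
have GH j k n t : \tr (G j k *m second_moment_dev n t) = second_moment_dev n t j k.
  have trd a b (H : 'M[R]_d) : \tr (delta_mx a b *m H) = H b a.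
    rewrite /mxtrace (bigD1 a)//= big1 ?addr0 => [|i ia]; rewrite mxE.
      rewrite (bigD1 b)//= big1 ?addr0 => [|i ib]; first by rewrite mxE !eqxx mul1r.
      by rewrite mxE (negbTE ib) andbF mul0r.
    by apply: big1 => l _; rewrite mxE (negbTE ia) mul0r.
  rewrite /G -scalemxAl mxtraceZ mulmxDl mxtraceD !trd.
  have -> : second_moment_dev n t k j = second_moment_dev n t j k.
    by rewrite -[in LHS]second_moment_dev_sym mxE.
  by field.
have cD j (e : 'cV[R]_d) : ((c j)^T *m e) 0 0 = e j 0.
  rewrite mxE (bigD1 j)//= big1 ?addr0 => [|i ij]; rewrite !mxE; first by rewrite !eqxx mul1r.
  by rewrite (negbTE ij) mul0r.
exists (\sum_j V (c j) 0 + \sum_j \sum_k V 0 (G j k)).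
  have V0 c' G' : G'^T = G' -> 0 <= V c' G'.
    move=> GT'; rewrite /V; have [_ _ <-] := @E_centered_quadratic _ _ mu Sigma c' G' hSigma GT'.
    by apply: mean_ge0 => t; exact: sqr_ge0.
  apply: addr_ge0; apply: sumr_ge0 => j _; first by apply: V0; rewrite trmx0.
  by apply: sumr_ge0 => k _; exact: V0.
move=> n n0.
have A1 j := @mean_sqr_quadratic (c j) 0 n (trmx0 _ _ _) n0.
have A2 j k := @mean_sqr_quadratic 0 (G j k) n (GT j k) n0.
have E1 : mean_dev_error n = (fun t =>
    \sum_j ((c j)^T *m (emp_mean X n t - mu)) 0 0 ^+ 2 +
    \sum_j \sum_k \tr (G j k *m second_moment_dev n t) ^+ 2).
  apply/funext => t; rewrite /mean_dev_error; congr (_ + _).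
    by apply: eq_bigr => j _; rewrite cD.
  apply: eq_bigr => j _; rewrite gram_entry; apply: eq_bigr => k _.
  by rewrite GH.
have B1 j : intg P (fun t => ((c j)^T *m (emp_mean X n t - mu)) 0 0 ^+ 2) /\
    \int[P]_t (((c j)^T *m (emp_mean X n t - mu)) 0 0 ^+ 2) = n%:R^-1 * V (c j) 0.
  by have := A1 j; under eq_fun do rewrite mul0mx mxtrace0 addr0.
have B2 j k : intg P (fun t => \tr (G j k *m second_moment_dev n t) ^+ 2) /\
    \int[P]_t (\tr (G j k *m second_moment_dev n t) ^+ 2) = n%:R^-1 * V 0 (G j k).
  by have := A2 j k; under eq_fun do rewrite trmx0 mul0mx mxE add0r.
rewrite E1; split.
  by apply: intgD; apply: intg_sum => j; [exact: (B1 j).1|apply: intg_sum => k; exact: (B2 j k).1].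
rewrite meanD; last 2 first.
- by apply: intg_sum => j; exact: (B1 j).1.
- by apply: intg_sum => j; apply: intg_sum => k; exact: (B2 j k).1.
rewrite mean_sum; last by move=> j; exact: (B1 j).1.
rewrite mean_sum; last by move=> j; apply: intg_sum => k; exact: (B2 j k).1.
rewrite mulrDr !mulr_sumr; congr (_ + _); apply: eq_bigr => j _; first exact: (B1 j).2.
rewrite mean_sum; last by move=> k; exact: (B2 j k).1.
by rewrite mulr_sumr; apply: eq_bigr => k _; exact: (B2 j k).2.
Qed.

End sample.

(** * The limit variance and the remainder for a given sample *)

Section limit_variance.
Context {R : realType} {d : nat}.

(** The eigenvectors are the columns of an orthogonal matrix that diagonalizes M; by uniqueness of
    the square root any choice of eigenpairs gives the same sum. *)
Lemma sqrtm_eigenpairs (M : 'M[R]_d) kappa r (B : 'M[R]_d) : covariance_matrix M ->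
  orthonormal_eigenpairs M kappa r ->
  \tr (sqrtm M *m B) = \sum_(k < d) Num.sqrt (kappa k) * bform (r k) B (r k).
Proof.
move=> hM [Mr rr].
pose U : 'M[R]_d := \matrix_(i, k) r k i 0; pose l : 'rV[R]_d := \row_k kappa k.
have colU k : col k U = r k by apply/matrixP => i j; rewrite !mxE ord1.
have UTU : U^T *m U = 1%:M.
  apply/matrixP => j k; rewrite [RHS]mxE -rr !mxE; apply: eq_bigr => i _.
  by rewrite !mxE.
have UUT : U *m U^T = 1%:M by exact: mulmx1C.
have MU : M *m U = U *m diag_mx l.
  apply/matrixP => i k; rewrite mul_mx_diag !mxE.
  transitivity ((M *m r k) i 0); last by rewrite Mr mxE mulrC.
  by rewrite mxE; apply: eq_bigr => j _; rewrite mxE.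
have ME : M = U *m diag_mx l *m U^T by rewrite -MU -mulmxA UUT mulmx1.
have l0 k : 0 <= l 0 k.
  have := hM.2 (r k); rewrite /bform -mulmxA Mr -scalemxAr mxE rr eqxx mulr1.
  by rewrite mxE.
rewrite {1}ME sqrtm_diag// -!mulmxA mxtrace_mulC -!mulmxA mul_diag_mx /mxtrace.
apply: eq_bigr => k _; rewrite !mxE /bform; congr (_ * _).
rewrite -!mulmxA !mxE; apply: eq_bigr => i _; rewrite !mxE; congr (_ * _).
by apply: eq_bigr => j _; rewrite !mxE.
Qed.

Context (mu nu : 'cV[R]_d) (Sigma Xi : 'M[R]_d).
Hypotheses (hSigma : covariance_matrix Sigma) (hXi : covariance_matrix Xi).
Hypotheses (uSigma : Sigma \in unitmx) (uXi : Xi \in unitmx).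
Let G : 'M[R]_d := 1%:M - transport_mx Sigma Xi.
Let c : 'cV[R]_d := 2 *: (mu - nu).

Let hT : covariance_matrix (transport_mx Sigma Xi).
Proof. exact: transport_mx_cov. Qed.

Let GT : G^T = G. Proof. by rewrite /G linearB/= trmx1 hT.1. Qed.

Lemma limit_variance_formula kappa r :
  orthonormal_eigenpairs (sqrtm Xi *m Sigma *m sqrtm Xi) kappa r ->
  bform c Sigma c + 2 * \tr (G *m Sigma *m G *m Sigma) =
  4 * bform (nu - mu) Sigma (nu - mu)
    + 2 * \tr (Sigma *m Sigma) + 2 * \tr (Sigma *m Xi)
    - 4 * \sum_(k < d) Num.sqrt (kappa k)
            * bform (r k) (invmx (sqrtm Xi) *m Sigma *m sqrtm Xi) (r k).
Proof.
move=> hr; rewrite -(sqrtm_eigenpairs _ _ hr); last first.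
  by rewrite -{2}(sqrtm_sym hXi); exact: covariance_conj.
rewrite -trace_transport_sqr//.
have -> : bform c Sigma c = 4 * bform (nu - mu) Sigma (nu - mu).
  have -> : c = (- 2) *: (nu - mu) by rewrite /c -[mu - nu]opprB scalerN scaleNr.
  move: (nu - mu) => x; rewrite /bform [(_ *: x)^T]linearZ/= -scalemxAr -!scalemxAl scalerA mxE.
  by congr (_ * _); ring.
have -> : \tr (G *m Sigma *m G *m Sigma) = \tr (Sigma *m Sigma)
    - 2 * \tr (transport_mx Sigma Xi *m Sigma *m Sigma) + \tr (Sigma *m Xi).
  have := transport_mxE hSigma hXi uSigma uXi.
  rewrite /G; move: (transport_mx Sigma Xi) => A AE.
  rewrite !mulmxBl !mulmxBr !mul1mx !mulmxBl !mulmx1 !mxtraceB AE.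
  have -> : \tr (Sigma *m A *m Sigma) = \tr (A *m Sigma *m Sigma).
    by rewrite -mulmxA mxtrace_mulC.
  by rewrite (mxtrace_mulC Xi); ring.
ring.
Qed.

Lemma limit_variance_ge0 : 0 <= bform c Sigma c + 2 * \tr (G *m Sigma *m G *m Sigma).
Proof.
have [_ _ <-] := @E_centered_quadratic _ _ mu Sigma c G hSigma GT.
by apply: mean_ge0 => x; exact: sqr_ge0.
Qed.

(** With A the square root of Sigma the variance is |A c|^2 + 2 |A G A|^2, and A is invertible. G =
    0 says that the transport matrix is the identity. *)
Lemma limit_variance_eq0 : bform c Sigma c + 2 * \tr (G *m Sigma *m G *m Sigma) = 0 ->
  mu = nu /\ Sigma = Xi.
Proof.
set A := sqrtm Sigma; have uA : A \in unitmx by exact: sqrtm_unitmx.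
have AT : A^T = A by exact: sqrtm_sym.
have AK : A *m A = Sigma by exact: sqrtmK.
have e1 : bform c Sigma c = sqnorm (A *m c).
  by rewrite sqnormE trmx_mul AT mulmxA -(mulmxA _ A A) AK.
have e2 : \tr (G *m Sigma *m G *m Sigma) = \tr ((A *m G *m A) *m (A *m G *m A)^T).
  rewrite !trmx_mul AT GT -[in LHS]AK !mulmxA mxtrace_mulC !mulmxA.
  by congr (\tr (_ *m _)).
have := sqnorm_ge0 (A *m c); have := fro_ge0 (A *m G *m A).
rewrite e1 e2 => f0 s0 E.
have Ac0 : A *m c = 0 by apply: sqnorm_eq0; lra.
have G0 : A *m G *m A = 0 by apply: fro_eq0; lra.
have c0 : c = 0 by rewrite -[c](mulKmx uA) Ac0 mulmx0.
have {}G0 : G = 0 by rewrite -[G](mulKmx uA) -[A *m G](mulmxK uA) G0 mul0mx mulmx0.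
split.
  apply/eqP; rewrite -subr_eq0; move/eqP: c0; rewrite /c scaler_eq0.
  by rewrite pnatr_eq0.
rewrite -(transport_mxE hSigma hXi uSigma uXi).
by move/eqP: G0; rewrite subr_eq0 => /eqP <-; rewrite mul1mx mulmx1.
Qed.

Context {disp : measure_display} {T : measurableType disp}.
Context (P : probability T R) (X : nat -> {RV P >-> 'cV[R]_d}).

(** The term 1/n pays for the divisor n - 1, through a = 1 / (n - 1) <= 2 / n; it multiplies
    quantities that do not tend to 0. *)
Lemma gelbrich_remainder : exists2 K, 0 <= K & forall n t, (1 < n)%N ->
  `|gelbrich_value (emp_mean X n t) nu (emp_cov X n t) Xi - gelbrich_value mu nu Sigma Xi
    - ((c^T *m (emp_mean X n t - mu)) 0 0 + \tr (G *m second_moment_dev mu Sigma X n t))|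
  <= K * (mean_dev_error mu Sigma X n t + n%:R^-1).
Proof.
have [K K0 HK] := gelbrich_expansion mu nu hSigma hXi uSigma uXi.
set fS := \tr (Sigma *m Sigma^T); have fS0 : 0 <= fS by exact: fro_ge0.
set fG := \tr (G *m G^T); have fG0 : 0 <= fG by exact: fro_ge0.
set gS := \tr (G *m Sigma); have gS0 := normr_ge0 gS.
exists (8 * K + 1 + 4 * K * fS + fG + 2 * `|gS|) => [|n t n1].
  by have := mulr_ge0 K0 fS0; lra.
pose a : R := (n%:R - 1)^-1; pose e := emp_mean X n t - mu.
set H := second_moment_dev mu Sigma X n t.
have HT : H^T = H by exact: second_moment_dev_sym.
have hW : covariance_matrix ((n%:R * a) *: (e *m e^T)).
  apply: covarianceZ; last exact: covariance_gram.
  by rewrite mulr_ge0// invr_ge0 subr_ge0 ler1n ltnW.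
have n2 : 2 <= n%:R :> R by rewrite ler_nat.
have n0 : 0 < n%:R :> R by lra.
have a0 : 0 <= a by rewrite invr_ge0; lra.
have na : n%:R * a = 1 + a.
  by rewrite -[n%:R](subrK 1) mulrDl mul1r mulfV// gt_eqF//; lra.
have a1 : a <= 1 by rewrite invf_le1; lra.
have an : a <= 2 * n%:R^-1.
  rewrite -[leRHS]invrK invfM invrK mulrC lef_pV2 ?posrE; [lra|lra|].
  by rewrite mulr_gt0// invr_gt0.
have ni : 0 <= n%:R^-1 :> R by rewrite invr_ge0.
have HT' : ((n%:R * a) *: H + a *: Sigma)^T = (n%:R * a) *: H + a *: Sigma.
  by rewrite linearD/= !linearZ/= HT hSigma.1.
have := HK (emp_mean X n t) _ _ _ (emp_cov_covariance X n t) hW HT' (emp_cov_dev _ _ _ _ n1).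
have tGH : \tr (G *m ((n%:R * a) *: H + a *: Sigma)) = (n%:R * a) * \tr (G *m H) + a * gS.
  by rewrite mulmxDr mxtraceD -!scalemxAr !mxtraceZ.
rewrite -/e -/a -/G tGH [\tr (_ *: _)]mxtraceZ.
have := fro_addscale_le H Sigma (n%:R * a) a; rewrite -/fS na.
set fH' := \tr (_ *m (_ + _)^T).
have eE : \tr (e *m e^T) = sqnorm e by rewrite mxtrace_mulC trace_mx11 sqnormE.
rewrite eE.
have ce : (c^T *m e) 0 0 = 2 * ((mu - nu)^T *m e) 0 0.
  by rewrite /c linearZ/= -scalemxAl mxE.
rewrite ce /mean_dev_error -/H -/e.
have s0 : 0 <= sqnorm e by exact: sqnorm_ge0.
have := trace_mul_norm_le G HT; rewrite -/fG.
have := fro_ge0 H.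
set fH := \tr (H *m H^T); set gH := \tr (G *m H); set s := sqnorm e in s0 *.
set D := gelbrich_value _ _ _ _ - _; set l := 2 * ((mu - nu)^T *m e) 0 0; set m := n%:R^-1 in an ni *.
move=> fH0 GH1 F1 B1.
have a2 : a ^+ 2 <= a by rewrite expr2 ler_piMl.
have F2 : fH' <= 8 * fH + 4 * (m * fS).
  have : (1 + a) ^+ 2 * fH <= 4 * fH by rewrite ler_wpM2r//; nra.
  have : a ^+ 2 * fS <= 2 * m * fS by rewrite ler_wpM2r//; lra.
  lra.
have F3 : (1 + a) * s <= 2 * s by rewrite ler_wpM2r//; lra.
have F4 : K * (s + fH' + (1 + a) * s) <= K * (3 * s + (8 * fH + 4 * (m * fS))).
  by rewrite ler_wpM2l//; lra.
have F5 : a * `|gH + gS| <= fH + m * (fG + 2 * `|gS|).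
  have g1 : `|gH + gS| <= 2^-1 * (fG + fH) + `|gS|.
    by apply: (le_trans (ler_normD _ _)); lra.
  apply: (@le_trans _ _ (a * (2^-1 * (fG + fH) + `|gS|))); first by rewrite ler_wpM2l.
  have : a * fH <= fH by rewrite ler_piMl.
  have : a * (2^-1 * fG + `|gS|) <= 2 * m * (2^-1 * fG + `|gS|) by rewrite ler_wpM2r//; lra.
  lra.
(* The expansion produces the coefficient 1 + a and the bias term a gS; their excess over the linear
   statistic is a (gH + gS). *)
have -> : D - (l + gH) = (D - (l + ((1 + a) * gH + a * gS))) + a * (gH + gS) by ring.
apply: (le_trans (ler_normD _ _)).
rewrite [X in _ + X <= _]normrM (ger0_norm a0).
have p1 := mulr_ge0 K0 s0; have p2 := mulr_ge0 K0 fH0.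
have p3 := mulr_ge0 K0 fS0; have p4 := mulr_ge0 K0 ni.
have p5 := mulr_ge0 p3 s0; have p6 := mulr_ge0 p3 fH0.
have p7 := mulr_ge0 fG0 s0; have p8 := mulr_ge0 fG0 fH0.
have p9 := mulr_ge0 gS0 s0; have p10 := mulr_ge0 gS0 fH0.
lra.
Qed.

End limit_variance.

Theorem theorem2p1 (R : realType) (d : nat)
  (mu nu : 'cV[R]_d) (Sigma Xi : 'M[R]_d)
  (hSigma : covariance_matrix Sigma) (hXi : covariance_matrix Xi)
  (rkSigma : \rank Sigma = d) (rkXi : \rank Xi = d)
  (hPQ : ~ measure_eq (gaussian mu Sigma) (gaussian nu Xi))
  (disp : measure_display) (T : measurableType disp) (P : probability T R)
  (X : nat -> {RV P >-> 'cV[R]_d})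
  (hX : iid X (gaussian mu Sigma))
  (kappa : 'I_d -> R) (r : 'I_d -> 'cV[R]_d)
  (hr : orthonormal_eigenpairs (sqrtm Xi *m Sigma *m sqrtm Xi) kappa r) :
  let GW : R :=
    fine (wasserstein2sq (gaussian mu Sigma) (gaussian nu Xi)) in
  let GWn (n : nat) (t : T) : R :=
    fine (wasserstein2sq (gaussian (emp_mean X n t) (emp_cov X n t))
                         (gaussian nu Xi)) in
  let upsilon2 : R :=
    4 * bform (nu - mu) Sigma (nu - mu)
    + 2 * \tr (Sigma *m Sigma) + 2 * \tr (Sigma *m Xi)
    - 4 * \sum_(k < d) Num.sqrt (kappa k)
            * bform (r k) (invmx (sqrtm Xi) *m Sigma *m sqrtm Xi) (r k) in
  cvg_in_law P (fun n t => Num.sqrt n%:R * (GWn n t - GW))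
    (normal_prob 0 (Num.sqrt upsilon2)).
Proof.
have uSigma := rank_unitmx rkSigma; have uXi := rank_unitmx rkXi.
move=> GW GWn upsilon2.
have GWE : GW = gelbrich_value mu nu Sigma Xi by rewrite /GW gelbrich_formula.
have GWnE n t : GWn n t = gelbrich_value (emp_mean X n t) nu (emp_cov X n t) Xi.
  by rewrite /GWn gelbrich_formula//; exact: emp_cov_covariance.
pose G : 'M[R]_d := 1%:M - transport_mx Sigma Xi; pose c : 'cV[R]_d := 2 *: (mu - nu).
have GT : G^T = G by rewrite /G linearB/= trmx1 (transport_mx_cov hSigma hXi uSigma uXi).1.
have [xi1 xi2 xi3] := @E_centered_quadratic _ _ mu Sigma c G hSigma GT.
have mxi := @measurable_centered_quadratic R d mu Sigma c G.
have vE := limit_variance_formula mu nu hSigma hXi uSigma uXi hr.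
(* The hypothesis that the measures differ enters here: the central limit theorem above is for
   positive variance. *)
have v_gt0 : 0 < bform c Sigma c + 2 * \tr (G *m Sigma *m G *m Sigma).
  rewrite lt_neqAle limit_variance_ge0// andbT eq_sym; apply/eqP => v0.
  have [munu SXi] := limit_variance_eq0 hSigma hXi uSigma uXi v0.
  by apply: hPQ; rewrite munu SXi.
rewrite -[upsilon2]vE -xi3; rewrite -xi3 in v_gt0.
have [K K0 HK] := gelbrich_remainder mu nu hSigma hXi uSigma uXi X.
have [C C0 HC] := E_mean_dev_error hSigma hX.
apply: (clt_remainder hX mxi xi1 xi2 v_gt0 (K := K * (C + 1))).
  move=> n; under eq_fun do rewrite GWnE.
  by apply: measurable_funM => //; apply: measurable_funB => //; exact: measurable_gelbrich_value.
move=> n n1; have n0 := ltnW n1.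
have nR : 0 < n%:R :> R by rewrite ltr0n.
have s0 : 0 < Num.sqrt n%:R :> R by rewrite sqrtr_gt0.
have ss : Num.sqrt n%:R * Num.sqrt n%:R = n%:R :> R by rewrite -expr2 sqr_sqrtr ?ltW.
have sn : Num.sqrt n%:R != 0 :> R by rewrite gt_eqF.
have [iE EE] := HC n n0.
have iEn : intg P (fun t => mean_dev_error mu Sigma X n t + n%:R^-1).
  by apply: intgD => //; exact: intg_cst.
(* Its mean is K sqrt n (C + 1) / n = K (C + 1) / sqrt n. *)
exists (fun t => Num.sqrt n%:R * K * (mean_dev_error mu Sigma X n t + n%:R^-1)); split.
- exact: intgZ.
- move=> t; rewrite partial_sum_quadratic// GWnE GWE.
  have sE x : (Num.sqrt n%:R)^-1 * (n%:R * x) = Num.sqrt n%:R * x :> R.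
    by rewrite -[X in _ * (X * _)]ss -mulrA mulKf.
  rewrite sE.
  rewrite -mulrBr normrM (gtr0_norm s0) -mulrA ler_wpM2l ?(ltW s0)//.
  exact: HK.
rewrite meanZ// meanD//; last exact: intg_cst.
have ni : n%:R^-1 = (Num.sqrt n%:R)^-1 * (Num.sqrt n%:R)^-1 :> R by rewrite -invfM ss.
by rewrite EE mean_cst ni le_eqVlt; apply/orP; left; apply/eqP; field.
Qed.
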